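(* Let $n\ge1$, let $U\subseteq\mathbb H^n$ be an open set and $f\in\mathcal C^0(U,\mathbb H)\cap\mathcal C^n(U\setminus\mathbb R_\bullet,\mathbb H)$. Then: (i) If $f$ is strongly slice in $U$, then $f\in\mathcal{SR}(U)$ (i.e. $f$ is strongly slice-regular in $U$) if and only if $\overline\theta_m(f)=0$ on $U\setminus\mathbb R_\bullet$ for every $m\in\{1,\ldots,n\}$. (ii) If $f$ is locally strongly slice in $U$, then $f\in\mathcal{SR}_{loc}(U)$ (i.e. $f$ is locally strongly slice-regular in $U$) if and only if $\overline\theta_m(f)=0$ on $U\setminus\mathbb R_\bullet$ for every $m\in\{1,\ldots,n\}$.
   Context: Notation. $\mathbb H$ is the algebra of quaternions, $\mathrm{Im}(x)=(x-\overline x)/2$, $\mathbb S=\{J\in\mathbb H: J^2=-1\}$, $\mathbb C_I=\{\alpha+I\beta:\alpha,\beta\in\mathbb R\}$ for $I\in\mathbb S$, $\mathbb R_\bullet=\bigcup_{k=1}^n\{x\in\mathbb H^n:x_k\in\mathbb R\}$. For $a=\alpha+J\beta\in\mathbb H$ ($\alpha,\beta\in\mathbb R$, $J\in\mathbb S$), $\mathbb S_a=\{\alpha+I\beta:I\in\mathbb S\}$. $\mathcal P(m)$ is the set of all subsets of $\{1,\ldots,m\}$, $\mathbf 1_K$ the characteristic function of $K$. Write $x_m=x_{m_0}+ix_{m_1}+jx_{m_2}+kx_{m_3}$. The functions $\Gamma^m_K(f)$. Let $L^m_{ij}=x_{m_i}\frac{\partial}{\partial x_{m_j}}-x_{m_j}\frac{\partial}{\partial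 x_{m_i}}$ and $\Gamma_{x_m}=-iL^m_{23}+jL^m_{13}-kL^m_{12}$. For $f\in\mathcal C^n(U\setminus\mathbb R_\bullet,\mathbb H)$, $m\in\{0,\ldots,n\}$ and $K\in\mathcal P(m)$ define recursively on $U\setminus\mathbb R_\bullet$: $\Gamma^0_\emptyset(f)=f$ and, for $m\ge1$, $\Gamma^m_K(f)=(2\,\mathrm{Im}(x_m))^{-1}\Gamma_{x_m}\big(x_m^{\mathbf 1_K(m)}\Gamma^{m-1}_{K\setminus\{m\}}(f)\big)$. (Locally) strongly slice functions. A function $f\in\mathcal C^0(U,\mathbb H)\cap\mathcal C^n(U\setminus\mathbb R_\bullet,\mathbb H)$ is strongly slice (resp. locally strongly slice) in $U$ if for every $y\in U\setminus\mathbb R_\bullet$, every $m\in\{1,\ldots,n\}$ and every $K\in\mathcal P(m)$, the function $\Gamma^m_K(f)$ is constant (resp. locally constant) on the set $(\mathbb S_{y_1}\times\cdots\times\mathbb S_{y_m}\times\{y_{m+1}\}\times\cdots\times\{y_n\})\cap U$. Wirtinger operators. Let $\overline\vartheta_{x_m}=\frac12\Big(\frac{\partial}{\partial x_{m_0}}-\mathrm{Im}(x_m)^{-1}\sum_{i=1}^3x_{m_i}\frac{\partial}{\partial x_{m_i}}\Big)$. For $m\in\{1,\ldots,n\}$, $\overline\theta_m:\mathcal C^n(U\setminus\mathbb R_\bullet,\mathbb H)\to\mathcal C^{n-m}(U\setminus\mathbb R_\bullet,\mathbb H)$ is \[\overline\theta_m(f)=\sum_{K\in\mathcal P(m-1)}(-\overline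 x)_{K^c}\,\overline\vartheta_{x_m}\Gamma^{m-1}_K(f),\] where $K^c=\{1,\ldots,m-1\}\setminus K$ and, for $H=\{h_1<\cdots<h_p\}$, $(-\overline x)_H=(-\overline x_{h_1})\cdots(-\overline x_{h_p})$, $(-\overline x)_\emptyset=1$. (Locally) strongly slice-regular functions. Let $\overline\partial_{x_m}=\frac12\big(\frac{\partial}{\partial x_{m_0}}+i\frac{\partial}{\partial x_{m_1}}+j\frac{\partial}{\partial x_{m_2}}+k\frac{\partial}{\partial x_{m_3}}\big)$. For $f\in\mathcal C^n(U,\mathbb H)$, $m\in\{0,\ldots,n\}$, $K\in\mathcal P(m)$ define $A^0_\emptyset(f)=f$ and, for $m\ge1$, $A^m_K(f)=-\overline\partial_{x_m}\big(x_m^{\mathbf 1_K(m)}A^{m-1}_{K\setminus\{m\}}(f)\big)$. For $y\in U$ let $U_{m+1}(y)=\{a\in\mathbb H:(y_1,\ldots,y_m,a,y_{m+2},\ldots,y_n)\in U\}$ and $A^{m,y}_K(f)(a)=A^m_K(f)(y_1,\ldots,y_m,a,y_{m+2},\ldots,y_n)$. A function $f$ belongs to $\mathcal{SR}(U)$ (resp. $\mathcal{SR}_{loc}(U)$), and is called strongly slice-regular (resp. locally strongly slice-regular), if $f\in\mathcal C^n(U,\mathbb H)$ and for every $y\in U$: (a) for every $m\in\{0,\ldots,n-1\}$, $K\in\mathcal P(m)$ and $I\in\mathbb S$ with $U_{m+1}(y)\cap\mathbb C_I\neq\emptyset$, the restriction of $A^{m,y}_K(f)$ to $U_{m+1}(y)\cap\mathbb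 C_I$ is holomorphic with respect to left multiplication by $I$, i.e. $\big(\frac{\partial}{\partial\alpha}+I\frac{\partial}{\partial\beta}\big)A^{m,y}_K(f)(\alpha+I\beta)=0$; (b) for every $m\in\{1,\ldots,n\}$ and $K\in\mathcal P(m)$, the function $A^m_K(f)$ is constant (resp. locally constant) on $(\mathbb S_{y_1}\times\cdots\times\mathbb S_{y_m}\times\{y_{m+1}\}\times\cdots\times\{y_n\})\cap U$. *)

(* Defs.v *)
From HB Require Import structures.
From mathcomp Require Import all_boot all_order all_algebra.
From mathcomp Require Import ring lra.
From mathcomp Require Import all_classical all_reals all_analysis.
Set Implicit Arguments.
Unset Strict Implicit.
Unset Printing Implicit Defensive.
Import Order.TTheory GRing.Theory Num.Theory.
Import numFieldNormedType.Exports.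
Local Open Scope classical_set_scope.
Local Open Scope ring_scope.

(* The quaternion x_0 + i x_1 + j x_2 + k x_3 is the row vector of its real
   coordinates, so the real normed space structure is that of 'rV[R]_4. Its
   norm is the sup norm, which is not multiplicative: only the topology it
   induces is relevant. Numerals 0, 1, 2, 3 used as column indices are the
   elements of 'I_4. *)
Definition quat (R : realType) : Type := 'rV[R]_4.

HB.instance Definition _ (R : realType) :=
  NormedModule.copy (quat R) 'rV[R]_4.
HB.instance Definition _ (R : realType) := Complete.copy (quat R) 'rV[R]_4.

Definition mkquat (R : realType) (a b c d : R) : quat R :=
  \row_(l < 4) nth 0 [:: a; b; c; d] l.

Definition quat_mul (R : realType) (x y : quat R) : quat R :=
  mkquat
    (x 0 0 * y 0 0 - x 0 1 * y 0 1 - x 0 2 * y 0 2 - x 0 3 * y 0 3)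
    (x 0 0 * y 0 1 + x 0 1 * y 0 0 + x 0 2 * y 0 3 - x 0 3 * y 0 2)
    (x 0 0 * y 0 2 - x 0 1 * y 0 3 + x 0 2 * y 0 0 + x 0 3 * y 0 1)
    (x 0 0 * y 0 3 + x 0 1 * y 0 2 - x 0 2 * y 0 1 + x 0 3 * y 0 0).

Definition qconj (R : realType) (x : quat R) : quat R :=
  mkquat (x 0 0) (- x 0 1) (- x 0 2) (- x 0 3).

Definition quat_sqnorm (R : realType) (x : quat R) : R :=
  x 0 0 ^+ 2 + x 0 1 ^+ 2 + x 0 2 ^+ 2 + x 0 3 ^+ 2.

Definition quat_inv (R : realType) (x : quat R) : quat R :=
  (quat_sqnorm x)^-1 *: qconj x.

Lemma quatP (R : realType) (x y : quat R) :
  x 0 0 = y 0 0 -> x 0 1 = y 0 1 -> x 0 2 = y 0 2 -> x 0 3 = y 0 3 -> x = y.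
Proof.
move=> h0 h1 h2 h3; apply/rowP => -[[|[|[|[|l]]]] hl] //.
- by have -> : Ordinal hl = 0 by exact/val_inj.
- by have -> : Ordinal hl = 1 by exact/val_inj.
- by have -> : Ordinal hl = 2 by exact/val_inj.
- by have -> : Ordinal hl = 3 by exact/val_inj.
Qed.

Lemma mkquat0 (R : realType) (a b c d : R) : mkquat a b c d 0 0 = a.
Proof. by rewrite mxE. Qed.
Lemma mkquat1 (R : realType) (a b c d : R) : mkquat a b c d 0 1 = b.
Proof. by rewrite mxE. Qed.
Lemma mkquat2 (R : realType) (a b c d : R) : mkquat a b c d 0 2 = c.
Proof. by rewrite mxE. Qed.
Lemma mkquat3 (R : realType) (a b c d : R) : mkquat a b c d 0 3 = d.
Proof. by rewrite mxE. Qed.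

Definition mkquatE := (mkquat0, mkquat1, mkquat2, mkquat3).

Lemma quat_addE (R : realType) (x y : quat R) l : (x + y) 0 l = x 0 l + y 0 l.
Proof. exact: mxE. Qed.
Lemma quat_scaleE (R : realType) (a : R) (x : quat R) l :
  (a *: x) 0 l = a * x 0 l.
Proof. exact: mxE. Qed.

Lemma quat_mulA (R : realType) : associative (@quat_mul R).
Proof. by move=> x y z; apply: quatP; rewrite !mkquatE; ring. Qed.

Lemma quat_mul1l (R : realType) : left_id (mkquat 1 0 0 0) (@quat_mul R).
Proof. by move=> x; apply: quatP; rewrite !mkquatE; ring. Qed.

Lemma quat_mul1r (R : realType) : right_id (mkquat 1 0 0 0) (@quat_mul R).
Proof. by move=> x; apply: quatP; rewrite !mkquatE; ring. Qed.

Lemma quat_mulDl (R : realType) : left_distributive (@quat_mul R) +%R.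
Proof. by move=> x y z; apply: quatP; rewrite !(mkquatE, quat_addE); ring. Qed.

Lemma quat_mulDr (R : realType) : right_distributive (@quat_mul R) +%R.
Proof. by move=> x y z; apply: quatP; rewrite !(mkquatE, quat_addE); ring. Qed.

Lemma quat_1_neq0 (R : realType) : mkquat 1 0 0 0 != 0 :> quat R.
Proof.
apply/eqP => /(congr1 (fun x : quat R => x 0 0)); rewrite mkquatE mxE.
by move/eqP; rewrite oner_eq0.
Qed.

HB.instance Definition _ (R : realType) :=
  GRing.Zmodule_isNzRing.Build (quat R) (@quat_mulA R) (@quat_mul1l R)
    (@quat_mul1r R) (@quat_mulDl R) (@quat_mulDr R) (@quat_1_neq0 R).

Lemma quat_1E (R : realType) : 1 = mkquat 1 0 0 0 :> quat R.
Proof. by []. Qed.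

Lemma quat_scalerAl (R : realType) (a : R) (x y : quat R) :
  a *: (x * y) = (a *: x) * y.
Proof. by apply: quatP; rewrite !(mkquatE, quat_scaleE); ring. Qed.

Lemma quat_scalerAr (R : realType) (a : R) (x y : quat R) :
  a *: (x * y) = x * (a *: y).
Proof. by apply: quatP; rewrite !(mkquatE, quat_scaleE); ring. Qed.

HB.instance Definition _ (R : realType) :=
  GRing.Lmodule_isLalgebra.Build R (quat R) (@quat_scalerAl R).
HB.instance Definition _ (R : realType) :=
  GRing.Lalgebra_isAlgebra.Build R (quat R) (@quat_scalerAr R).

Lemma quat_sqnorm_eq0 (R : realType) (x : quat R) :
  (quat_sqnorm x == 0) = (x == 0).
Proof.
apply/eqP/eqP => [h|->]; last by rewrite /quat_sqnorm !mxE; ring.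
have sq0 (a s : R) : a ^+ 2 + s = 0 -> 0 <= s -> a = 0.
  by move=> e s0; apply/eqP; rewrite -sqrf_eq0 eq_le sqr_ge0 andbT; lra.
have := sqr_ge0 (x 0 0); have := sqr_ge0 (x 0 1).
have := sqr_ge0 (x 0 2); have := sqr_ge0 (x 0 3).
move: h; rewrite /quat_sqnorm => h h3 h2 h1 h0.
apply: quatP; rewrite [RHS]mxE; apply: sq0.
- by rewrite -h -!addrA.
- by rewrite addrA !addr_ge0.
- by rewrite -h [_ ^+ 2 + x 0 1 ^+ 2]addrC -!addrA.
- by rewrite addrA !addr_ge0.
- by rewrite -h [RHS]addrAC addrC.
- by rewrite !addr_ge0.
- by rewrite -h addrC.
- by rewrite !addr_ge0.
Qed.

Definition quat_unit (R : realType) : {pred quat R} := fun x => x != 0.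

Lemma quat_mulVx (R : realType) :
  {in @quat_unit R, left_inverse 1 (@quat_inv R) *%R}.
Proof.
move=> x; rewrite unfold_in -quat_sqnorm_eq0 /quat_inv /quat_sqnorm => x0.
by rewrite quat_1E; apply: quatP; rewrite !(mkquatE, quat_scaleE); field.
Qed.

Lemma quat_mulxV (R : realType) :
  {in @quat_unit R, right_inverse 1 (@quat_inv R) *%R}.
Proof.
move=> x; rewrite unfold_in -quat_sqnorm_eq0 /quat_inv /quat_sqnorm => x0.
by rewrite quat_1E; apply: quatP; rewrite !(mkquatE, quat_scaleE); field.
Qed.

Lemma quat_unitP (R : realType) (x y : quat R) :
  y * x = 1 /\ x * y = 1 -> quat_unit x.
Proof.
move=> [+ _]; apply: contra_eqN => /eqP ->.
by rewrite mulr0 eq_sym oner_eq0.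
Qed.

Lemma quat_inv_out (R : realType) :
  {in [predC @quat_unit R], @quat_inv R =1 id}.
Proof.
move=> x; rewrite inE unfold_in negbK => /eqP ->.
by apply: quatP; rewrite !(mkquatE, quat_scaleE, mxE) ?oppr0 mulr0.
Qed.

HB.instance Definition _ (R : realType) :=
  GRing.NzRing_hasMulInverse.Build (quat R) (@quat_mulVx R) (@quat_mulxV R)
    (@quat_unitP R) (@quat_inv_out R).

Definition qi {R : realType} : quat R := mkquat 0 1 0 0.
Definition qj {R : realType} : quat R := mkquat 0 0 1 0.
Definition qk {R : realType} : quat R := mkquat 0 0 0 1.

Definition qIm (R : realType) (x : quat R) : quat R := 2^-1 *: (x - qconj x).

Definition imag_units (R : realType) : set (quat R) := [set J | J ^+ 2 = -1].

Definition slice_plane (R : realType) (I : quat R) : set (quat R) :=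
  [set a | exists alpha beta : R, a = alpha%:A + I * beta%:A].

Definition qsphere (R : realType) (a : quat R) : set (quat R) :=
  [set b | exists (alpha beta : R) (J I : quat R),
    [/\ imag_units J, imag_units I, a = alpha%:A + J * beta%:A
      & b = alpha%:A + I * beta%:A]].

(* Points of H^n are n x 4 real matrices whose rows are the quaternionic
   coordinates. Coordinates are numbered from 0: the variables x_1, ..., x_n
   are qcoord x i for i = 0, ..., n - 1. *)
Definition qcoord (R : realType) (n : nat) (x : 'M[R]_(n, 4)) (i : 'I_n) :
  quat R := row i x.

Definition subst_coord (R : realType) (n : nat) (y : 'M[R]_(n, 4)) (i : 'I_n)
    (a : quat R) : 'M[R]_(n, 4) :=
  \matrix_(l, c) if l == i then a 0 c else y l c.

Definition real_points (R : realType) (n : nat) : set 'M[R]_(n, 4) :=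
  [set x | exists (i : 'I_n) (a : R), qcoord x i = a%:A].

Definition pderiv (R : realType) (n : nat) (i : 'I_n) (c : 'I_4)
    (f : 'M[R]_(n, 4) -> quat R) : 'M[R]_(n, 4) -> quat R :=
  'D_(delta_mx i c) f.

(* C^k on an open set D, in terms of iterated partial derivatives; the values
   of f outside D are irrelevant because D is open. *)
Fixpoint Ck (R : realType) (n k : nat) (D : set 'M[R]_(n, 4))
    (f : 'M[R]_(n, 4) -> quat R) : Prop :=
  (forall x, D x -> {for x, continuous f}) /\
  match k with
  | 0 => True
  | k'.+1 => forall (i : 'I_n) (c : 'I_4),
      (forall x, D x -> derivable f x (delta_mx i c)) /\ Ck k' D (pderiv i c f)
  end.

(* With coordinates numbered from 0, a subset of {1, ..., m} is a
   K : {set 'I_n} with K \subset first_coords n m. *)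
Definition first_coords (n m : nat) : {set 'I_n} :=
  [set i : 'I_n | (i < m)%N]%SET.

Definition L_op (R : realType) (n : nat) (m : 'I_n) (p q : 'I_4)
    (f : 'M[R]_(n, 4) -> quat R) (x : 'M[R]_(n, 4)) : quat R :=
  x m p *: pderiv m q f x - x m q *: pderiv m p f x.

Definition Gamma_op (R : realType) (n : nat) (m : 'I_n)
    (f : 'M[R]_(n, 4) -> quat R) (x : 'M[R]_(n, 4)) : quat R :=
  - qi * L_op m 2 3 f x + qj * L_op m 1 3 f x - qk * L_op m 1 2 f x.

(* The m'.+1-th step acts on the variable of index m'; the None branch is
   reached only for m > n. *)
Fixpoint Gamma (R : realType) (n m : nat) (K : {set 'I_n})
    (f : 'M[R]_(n, 4) -> quat R) {struct m} : 'M[R]_(n, 4) -> quat R :=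
  match m with
  | 0 => f
  | m'.+1 =>
    if insub m' is Some i then
      fun x => (2 * qIm (qcoord x i))^-1 *
        Gamma_op i (fun z => qcoord z i ^+ (i \in K) *
                             Gamma m' (K :\ i)%SET f z) x
    else fun=> 0
  end.

Definition polysphere (R : realType) (n m : nat) (y : 'M[R]_(n, 4)) :
    set 'M[R]_(n, 4) :=
  [set x | forall i : 'I_n,
    if (i < m)%N then qsphere (qcoord y i) (qcoord x i)
    else qcoord x i = qcoord y i].

Definition constant_on (T : Type) (V : Type) (A : set T) (g : T -> V) : Prop :=
  forall x x', A x -> A x' -> g x = g x'.

Definition locally_constant_on (T : topologicalType) (V : Type) (A : set T)
    (g : T -> V) : Prop :=
  forall x, A x -> \forall x' \near within A (nbhs x), g x' = g x.

Definition strongly_slice (R : realType) (n : nat) (U : set 'M[R]_(n, 4))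
    (f : 'M[R]_(n, 4) -> quat R) : Prop :=
  [/\ Ck 0 U f, Ck n (U `\` @real_points R n) f &
    forall (y : 'M[R]_(n, 4)) (m : nat) (K : {set 'I_n}),
      (U `\` @real_points R n) y -> (1 <= m <= n)%N ->
      K \subset first_coords n m ->
      constant_on (polysphere m y `&` U) (Gamma m K f)].

Definition locally_strongly_slice (R : realType) (n : nat)
    (U : set 'M[R]_(n, 4)) (f : 'M[R]_(n, 4) -> quat R) : Prop :=
  [/\ Ck 0 U f, Ck n (U `\` @real_points R n) f &
    forall (y : 'M[R]_(n, 4)) (m : nat) (K : {set 'I_n}),
      (U `\` @real_points R n) y -> (1 <= m <= n)%N ->
      K \subset first_coords n m ->
      locally_constant_on (polysphere m y `&` U) (Gamma m K f)].

Definition vartheta_bar (R : realType) (n : nat) (m : 'I_n)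
    (f : 'M[R]_(n, 4) -> quat R) (x : 'M[R]_(n, 4)) : quat R :=
  2^-1 *: (pderiv m 0 f x -
    (qIm (qcoord x m))^-1 * \sum_(c < 4 | c != 0) x m c *: pderiv m c f x).

(* The product is ordered: enum H lists H increasingly. *)
Definition neg_conj_prod (R : realType) (n : nat) (H : {set 'I_n})
    (x : 'M[R]_(n, 4)) : quat R :=
  \prod_(h <- enum H) (- qconj (qcoord x h)).

(* theta_bar m, for m : 'I_n, is attached to the (m+1)-th variable. *)
Definition theta_bar (R : realType) (n : nat) (m : 'I_n)
    (f : 'M[R]_(n, 4) -> quat R) (x : 'M[R]_(n, 4)) : quat R :=
  \sum_(K in powerset (first_coords n m))
    neg_conj_prod (first_coords n m :\: K)%SET x *
    vartheta_bar m (Gamma m K f) x.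

Definition CRF (R : realType) (n : nat) (m : 'I_n)
    (f : 'M[R]_(n, 4) -> quat R) (x : 'M[R]_(n, 4)) : quat R :=
  2^-1 *: (pderiv m 0 f x + qi * pderiv m 1 f x + qj * pderiv m 2 f x +
           qk * pderiv m 3 f x).

Fixpoint A_op (R : realType) (n m : nat) (K : {set 'I_n})
    (f : 'M[R]_(n, 4) -> quat R) {struct m} : 'M[R]_(n, 4) -> quat R :=
  match m with
  | 0 => f
  | m'.+1 =>
    if insub m' is Some i then
      fun x => - CRF i (fun z => qcoord z i ^+ (i \in K) *
                                 A_op m' (K :\ i)%SET f z) x
    else fun=> 0
  end.

Definition fiber (R : realType) (n : nat) (U : set 'M[R]_(n, 4)) (m : 'I_n)
    (y : 'M[R]_(n, 4)) : set (quat R) :=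
  [set a | U (subst_coord y m a)].

Definition A_fiber (R : realType) (n : nat) (m : 'I_n) (K : {set 'I_n})
    (f : 'M[R]_(n, 4) -> quat R) (y : 'M[R]_(n, 4)) (a : quat R) : quat R :=
  A_op m K f (subst_coord y m a).

(* Holomorphy on D `&` slice_plane I, for D open. It includes real
   differentiability, so that the partial derivatives are meaningful. *)
Definition slice_holomorphic (R : realType) (I : quat R) (D : set (quat R))
    (g : quat R -> quat R) : Prop :=
  forall alpha beta : R, D (alpha%:A + I * beta%:A) ->
    differentiable (fun p : R * R => g (p.1%:A + I * p.2%:A)) (alpha, beta) /\
    derive1 (fun a : R => g (a%:A + I * beta%:A)) alpha +
      I * derive1 (fun b : R => g (alpha%:A + I * b%:A)) beta = 0.

Definition SR_slice (R : realType) (n : nat) (U : set 'M[R]_(n, 4))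
    (f : 'M[R]_(n, 4) -> quat R) : Prop :=
  forall (y : 'M[R]_(n, 4)) (m : 'I_n) (K : {set 'I_n}) (I : quat R),
    U y -> K \subset first_coords n m -> imag_units I ->
    fiber U m y `&` slice_plane I !=set0 ->
    slice_holomorphic I (fiber U m y) (A_fiber m K f y).

Definition SR (R : realType) (n : nat) (U : set 'M[R]_(n, 4))
    (f : 'M[R]_(n, 4) -> quat R) : Prop :=
  [/\ Ck n U f, SR_slice U f &
    forall (y : 'M[R]_(n, 4)) (m : nat) (K : {set 'I_n}),
      U y -> (1 <= m <= n)%N -> K \subset first_coords n m ->
      constant_on (polysphere m y `&` U) (A_op m K f)].

Definition SR_loc (R : realType) (n : nat) (U : set 'M[R]_(n, 4))
    (f : 'M[R]_(n, 4) -> quat R) : Prop :=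
  [/\ Ck n U f, SR_slice U f &
    forall (y : 'M[R]_(n, 4)) (m : nat) (K : {set 'I_n}),
      U y -> (1 <= m <= n)%N -> K \subset first_coords n m ->
      locally_constant_on (polysphere m y `&` U) (A_op m K f)].

(* Main.v *)
(* Off the real points, [Gamma] recovers the coefficients of a slice function:
   [f] is the sum over [K] of [(-conj x)_{K^c} Gamma^m_K f], where the
   [Gamma^m_K f] are constant on spheres in the first [m] variables. Evaluating
   [theta_m f = 0] at two points of each sphere therefore separates it into
   [vartheta Gamma^{m-1}_K f = 0] for all [K], and since the Fueter operator is
   the difference of [vartheta] and the [Gamma]-step, this gives
   [A^m_K f = Gamma^m_K f] off the real points.

   What remains is the smoothness of [f] at the real points. A continuous
   function [g] of one variable that is affine on spheres and left holomorphic
   on slices satisfies, by the Poisson formula on circles of slices, an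
   identity [g(x) = sum_l int k_l(t, x) g(s_l(t)) dt], with real kernels [k_l]
   smooth in [x]. Real kernels commute with quaternionic coefficients, so the
   identity passes from the [Gamma^m_K f] to [f] in each variable separately.
   Differentiating under the integral, one variable after the other, shows
   that [f] is smooth near every point of [U]. The conditions on [A^m_K f] at
   real points then follow by continuity. *)

Require Import Defs.
From HB Require Import structures.
From mathcomp Require Import all_boot all_order all_algebra.
From mathcomp Require Import ring lra.
From mathcomp Require Import all_classical all_reals all_analysis.
Set Implicit Arguments.
Unset Strict Implicit.
Unset Printing Implicit Defensive.
Import Order.TTheory GRing.Theory Num.Theory.
Import numFieldNormedType.Exports.
Local Open Scope classical_set_scope.
Local Open Scope ring_scope.

(** * Integrals over a segment *)

(** Smoothness at real points cannot be read off [Gamma], which divides by [Im x_m]: there only the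
    continuity of [f] is known. Three obstacles follow. Discs of a slice may cross the real axis,
    where holomorphy is unknown, so the Poisson formula is proved for pairs that are continuous on
    the disc and satisfy the Cauchy-Riemann equations off a line; circle integrals are compared by
    differentiating in the angle, which tolerates finitely many bad rays. A Cauchy kernel would be
    quaternion-valued and get stuck between the factors [(-conj x)_{K^c}] and the coefficients,
    hence the choice of Poisson. Finally the slice through [x] turns with [x], and its unit
    [Im x / |Im x|] is singular at real points: a few fixed slices, with weights affine in that
    unit, replace it, and at a real centre the contributions of [J] and [-J] are added, which leaves
    a kernel rational in the coordinates of [x]. *)

Lemma pair_cst_continuous (T U : topologicalType) (x : T) (t : U) :
  {for t, continuous (fun t => (x, t))}.
Proof.
by apply: (cvg_pair (f := fun=> x) (g := id)); [exact: cvg_cst|exact: cvg_id].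
Qed.

Lemma pair_continuous (T U V : topologicalType) (f : T -> U) (g : T -> V) (x : T) :
  {for x, continuous f} -> {for x, continuous g} ->
  {for x, continuous (fun t => (f t, g t))}.
Proof. by move=> cf cg; exact: cvg_pair. Qed.

Section segment_integral.
Variable R : realType.
Implicit Types (a b : R) (h : R -> R).

Definition segint a b h : R := \int[@lebesgue_measure R]_(t in `[a, b]) h t.

Definition continuous_on_segment a b h :=
  forall t, a <= t <= b -> {for t, continuous h}.

Lemma continuous_on_segment_within a b h :
  continuous_on_segment a b h -> {within `[a, b], continuous h}.
Proof.
move=> ch; apply/continuous_in_subspaceT => t /set_mem/=.
by rewrite in_itv => /ch.
Qed.

Lemma continuous_on_segment_integrable a b h : continuous_on_segment a b h ->
  (@lebesgue_measure R).-integrable `[a, b] (EFin \o h).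
Proof.
move=> /continuous_on_segment_within ch.
by apply: continuous_compact_integrable => //; exact: segment_compact.
Qed.

Lemma eq_segint a b h k : (forall t, a <= t <= b -> h t = k t) ->
  segint a b h = segint a b k.
Proof. by move=> hk; apply: eq_Rintegral => t /set_mem/=; rewrite in_itv; exact: hk. Qed.

Lemma segintD a b h k : continuous_on_segment a b h ->
  continuous_on_segment a b k ->
  segint a b (fun t => h t + k t) = segint a b h + segint a b k.
Proof.
by move=> ch ck; apply: RintegralD => //; exact: continuous_on_segment_integrable.
Qed.

Lemma segintZ a b c h : continuous_on_segment a b h ->
  segint a b (fun t => c * h t) = c * segint a b h.
Proof.
by move=> ch; apply: RintegralZl => //; exact: continuous_on_segment_integrable.
Qed.

Lemma segint_cst a b c : a <= b -> segint a b (fun=> c) = c * (b - a).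
Proof.
move=> ab; rewrite /segint Rintegral_cst//= lebesgue_measure_itv/= lte_fin.
by case: ltgtP ab => // -> _; rewrite subrr.
Qed.

Lemma continuous_on_segmentD a b h k : continuous_on_segment a b h ->
  continuous_on_segment a b k -> continuous_on_segment a b (fun t => h t + k t).
Proof. by move=> ch ck t tab; apply: cvgD; [exact: ch|exact: ck]. Qed.

Lemma continuous_on_segmentM a b h k : continuous_on_segment a b h ->
  continuous_on_segment a b k -> continuous_on_segment a b (fun t => h t * k t).
Proof. by move=> ch ck t tab; apply: cvgM; [exact: ch|exact: ck]. Qed.

Lemma continuous_on_segment_cst a b c : continuous_on_segment a b (fun=> c).
Proof. by move=> t _; exact: cvg_cst. Qed.

Lemma segint_sum a b n (h : 'I_n -> R -> R) :
  (forall i, continuous_on_segment a b (h i)) ->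
  segint a b (fun t => \sum_(i < n) h i t) = \sum_(i < n) segint a b (h i).
Proof.
move=> ch.
suff [//] : segint a b (fun t => \sum_(i < n) h i t) = \sum_(i < n) segint a b (h i)
  /\ continuous_on_segment a b (fun t => \sum_(i < n) h i t).
elim: n h ch => [|n IH] h ch.
  have -> : (fun t => \sum_(i < 0) h i t) = fun=> 0.
    by apply/funext => t; rewrite big_ord0.
  split; last exact: continuous_on_segment_cst.
  by rewrite big_ord0 /segint Rintegral_cst//= mul0r.
have [IH1 IH2] := IH (fun i => h (widen_ord (leqnSn n) i)) (fun i => ch _).
have -> : (fun t => \sum_(i < n.+1) h i t) = fun t =>
    \sum_(i < n) h (widen_ord (leqnSn n) i) t + h ord_max t.
  by apply/funext => t; rewrite big_ord_recr.
by rewrite big_ord_recr/= -IH1 segintD//; split=> //; exact: continuous_on_segmentD.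
Qed.

Lemma segint_normr_le a b h M : a <= b -> continuous_on_segment a b h ->
  (forall t, a <= t <= b -> `|h t| <= M) -> `|segint a b h| <= M * (b - a).
Proof.
move=> ab ch hM; apply: le_trans.
  by apply: le_normr_Rintegral => //; exact: continuous_on_segment_integrable.
rewrite -segint_cst//; apply: le_Rintegral => //.
- apply: (@continuous_on_segment_integrable _ _ (fun t => `|h t|)) => t tab.
  by apply: cvg_norm; exact: ch.
- exact/continuous_on_segment_integrable/continuous_on_segment_cst.
Qed.

Lemma segint_FTC2 a b h (F : R -> R) : a < b -> continuous_on_segment a b h ->
  (forall t, a <= t <= b -> is_derive t 1 F (h t)) ->
  segint a b h = F b - F a.
Proof.
move=> ab ch dF; rewrite /segint /Rintegral (@continuous_FTC2 _ h F)//.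
  exact: continuous_on_segment_within.
- have cF t : a <= t <= b -> {for t, continuous F}.
    move=> /dF ?; apply: differentiable_continuous.
    exact/derivable1_diffP.
  split.
  + by move=> t; rewrite in_itv/= => /andP[/ltW at_ /ltW tb]; apply: ex_derive; apply: dF; rewrite at_.
  + by apply: cvg_at_right_filter; apply: cF; rewrite lexx ltW.
  + by apply: cvg_at_left_filter; apply: cF; rewrite lexx ltW.
- move=> t; rewrite in_itv/= => /andP[/ltW at_ /ltW tb].
  by rewrite derive1E; apply: derive_val; apply: dF; rewrite at_.
Qed.

Lemma segint_FTC1 a b h x : continuous_on_segment a b h -> a < x < b ->
  is_derive x 1 (fun x => segint a x h) (h x).
Proof.
move=> ch /andP[ax xb].
have cx : {for x, continuous h} by apply: ch; rewrite !ltW.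
have [d e] :=
  continuous_FTC1_closed xb (continuous_on_segment_integrable ch) ax cx.
by apply: DeriveDef; [exact: d|rewrite -derive1E; exact: e].
Qed.

Lemma segint_within_continuous a b h : a <= b -> continuous_on_segment a b h ->
  {within `[a, b], continuous (fun x => segint a x h)}.
Proof.
move=> ab ch.
exact: (parameterized_integral_continuous ab (continuous_on_segment_integrable ch)).
Qed.

(** Tube lemma: compactness of the segment turns joint continuity at the points [(x, t)] into an
    estimate that is uniform in [t]. *)
Lemma continuous_uniform_segment (T : topologicalType) a b (g : T -> R -> R) x :
  (forall t, a <= t <= b -> {for (x, t), continuous (fun p : T * R => g p.1 p.2)}) ->
  forall e, 0 < e -> \forall y \near x, forall t, a <= t <= b ->
    `|g x t - g y t| < e.
Proof.
move=> cg e e0.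
have /compact_near_coveringP/near_covering_withinP Q : compact (`[a, b] : set R)
  by exact: segment_compact.
have H := Q _ (nbhs x) (fun y t => `|g x t - g y t| < e) _.
near=> y => t tab.
suff : `[a, b] `<=` (fun t => `|g x t - g y t| < e) by apply; rewrite /= in_itv.
near: y; apply: H => t'; rewrite /= in_itv/= => /cg/cvgrPdist_lt c.
have e2 : 0 < e / 2 by rewrite divr_gt0.
have [[A B]/= [nA nB] AB] := c _ e2.
exists (B, A) => //= -[s y'] [/= Bs Ay] _.
have h1 := AB (x, s) (conj (nbhs_singleton nA) Bs).
have h2 := AB (y', s) (conj Ay Bs).
by rewrite /= in h1 h2; rewrite [e]splitr;
  apply: le_lt_trans (ler_distD (g x t') _ _) _;
  rewrite ltrD// distrC.
Unshelve. all: end_near. Qed.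

Lemma segint_param_continuous (T : topologicalType) a b (g : T -> R -> R) x :
  a <= b ->
  (\forall y \near x, continuous_on_segment a b (g y)) ->
  (forall t, a <= t <= b -> {for (x, t), continuous (fun p : T * R => g p.1 p.2)}) ->
  {for x, continuous (fun y => segint a b (g y))}.
Proof.
move=> ab cgy cg; apply/cvgrPdist_le => e e0.
(* The summand [1] keeps the divisor positive when [a = b]. *)
have ba0 : 0 < b - a + 1 by rewrite ltr_wpDl// subr_ge0.
have e'0 : 0 < e / (b - a + 1) by rewrite divr_gt0.
near=> y.
have cgx : continuous_on_segment a b (g x) by exact: (nbhs_singleton cgy).
have cgy' : continuous_on_segment a b (g y).
  by near: y; exact: cgy.
have cN : continuous_on_segment a b (fun t => (- 1) * g y t).
  by apply: continuous_on_segmentM => //; exact: continuous_on_segment_cst.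
have -> : segint a b (g x) - segint a b (g y) =
    segint a b (fun t => g x t + (- 1) * g y t).
  by rewrite segintD// segintZ// mulN1r.
apply: (@le_trans _ _ (e / (b - a + 1) * (b - a))).
  apply: segint_normr_le => //; first exact: continuous_on_segmentD.
  move=> t tab; rewrite mulN1r ltW//.
  by move: t tab; near: y; exact: continuous_uniform_segment.
rewrite mulrAC ler_pdivrMr// ler_pM2l// lerDl//.
Unshelve. all: end_near. Qed.

(** Dominated differentiation with the bound [|g' x t| + 1], independent of [y]: uniformity in [t]
    gives a radius on which [g' y t] stays within [1] of [g' x t]. Continuity of [g'] is therefore
    asked only at the points above [x]. *)
Lemma segint_param_is_derive a b (g g' : R -> R -> R) (x d : R) : a <= b -> 0 < d ->
  (forall y t : R, `|y - x| < d -> a <= t <= b ->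
    is_derive y 1 (g^~ t) (g' y t)) ->
  (forall y : R, `|y - x| < d -> continuous_on_segment a b (g y)) ->
  (forall t, a <= t <= b ->
    {for (x, t), continuous (fun p : R * R => g' p.1 p.2)}) ->
  is_derive x 1 (fun y => segint a b (g y)) (segint a b (g' x)).
Proof.
move=> ab d0 dg cg cg'.
have [r r0 rP] : exists2 r, 0 < r & forall y, `|y - x| < r -> forall t, a <= t <= b ->
    `|g' x t - g' y t| < 1.
  have [r/= r0 rP] := continuous_uniform_segment cg' ltr01.
  by exists r => // y yr; apply: rP; rewrite /ball/= distrC.
have cg'x : continuous_on_segment a b (g' x).
  move=> t tab.
  apply: (@continuous_comp _ _ _ (fun t => (x, t)) (fun p : R * R => g' p.1 p.2)).
    exact: pair_cst_continuous.
  exact: cg'.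
pose m := Num.min r d.
have m0 : 0 < m by rewrite lt_min r0.
have xm : `]x - m, x + m[%classic x by rewrite /= in_itv/= ltrBlDr !ltrDl m0.
have mP y : `]x - m, x + m[%classic y -> `|y - x| < r /\ `|y - x| < d.
  rewrite /= in_itv/= => /andP[y1 y2]; have : `|y - x| < m by rewrite ltr_norml; lra.
  by rewrite lt_min => /andP[].
pose G t := `|g' x t| + 1.
have iG : (@lebesgue_measure R).-integrable `[a, b] (EFin \o G).
  apply: continuous_on_segment_integrable; apply: continuous_on_segmentD.
    by move=> t tab; apply: cvg_norm; exact: cg'x.
  exact: continuous_on_segment_cst.
have ig y : `]x - m, x + m[%classic y ->
    (@lebesgue_measure R).-integrable `[a, b] (EFin \o g y).
  by move=> /mP[_ yd]; apply: continuous_on_segment_integrable; exact: cg.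
have dgy y t : `]x - m, x + m[%classic y -> `[a, b]%classic t -> is_derive y 1 (g^~ t) (g' y t).
  by move=> /mP[_ yd]; rewrite /= in_itv; exact: dg.
have dgy' y t : `]x - m, x + m[%classic y -> `[a, b]%classic t -> derivable (g^~ t) y 1.
  by move=> xy tab; apply: ex_derive; exact: dgy.
have G0 t : 0 <= G t by rewrite addr_ge0.
have ubG y t : `]x - m, x + m[%classic y -> `[a, b]%classic t ->
    `|partial1of2 g y t| <= G t.
  move=> xy tab; have ? := dgy _ _ xy tab; rewrite partial1of2E derive_val.
  have {}tab : a <= t <= b by move: tab; rewrite /= in_itv.
  have [/rP/(_ _ tab)] := mP _ xy; rewrite distrC => /ltW h _.
  rewrite -lerBlDl; apply: le_trans h.
  exact: lerB_dist.
apply: DeriveDef.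
  exact: (derivable_under_integral _ xm ig dgy' G0 iG ubG).
rewrite -derive1E [LHS](differentiation_under_integral _ xm ig dgy' G0 iG ubG)//.
apply: eq_segint => t tab.
have xx : `|x - x| < d by rewrite subrr normr0.
by have ? := dg x t xx tab; rewrite partial1of2E derive_val.
Qed.

End segment_integral.

(** * Planar Cauchy-Riemann pairs and the Poisson formula *)

Section planar_differential.
Variable R : realType.
Implicit Types (u v p q : R * R -> R) (w z : R * R) (t x : R).

Definition has_gradient u (a b : R) w :=
  differentiable u w /\ forall h : R * R, 'd u w h = a * h.1 + b * h.2.

Lemma is_derive1P (f : R -> R) x (d : R) :
  is_derive x 1 f d <-> differentiable f x /\ forall h : R, 'd f x h = d * h.
Proof.
split=> [dfx|[df e]].
  have df : differentiable f x by exact/derivable1_diffP.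
  split=> // h; rewrite -[h in LHS]mulr1 -[h * 1]/(h *: 1) linearZ/= -deriveE//.
  by rewrite derive_val mulrC.
apply: DeriveDef; first exact/derivable1_diffP.
by rewrite deriveE// e mulr1.
Qed.

Lemma has_gradient_comp u a b (g1 g2 : R -> R) t d1 d2 :
  is_derive t 1 g1 d1 -> is_derive t 1 g2 d2 ->
  has_gradient u a b (g1 t, g2 t) ->
  is_derive t 1 (fun s => u (g1 s, g2 s)) (a * d1 + b * d2).
Proof.
move=> /is_derive1P[dg1 e1] /is_derive1P[dg2 e2] [du eu].
have dg : differentiable (fun s => (g1 s, g2 s)) t by exact: differentiable_pair.
apply/is_derive1P; split; first exact: (differentiable_comp dg).
move=> h; rewrite (diff_comp dg)//= eu diff_pair//= e1 e2; ring.
Qed.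

Lemma has_gradient_cst (c : R) w : has_gradient (fun=> c) 0 0 w.
Proof. by split=> [//|h]; rewrite diff_cst/= !mul0r addr0. Qed.

Lemma has_gradientD u v a b c d w : has_gradient u a b w ->
  has_gradient v c d w -> has_gradient (fun z => u z + v z) (a + c) (b + d) w.
Proof.
move=> [du eu] [dv ev]; split; first exact: differentiableD.
move=> h; have -> : (fun z => u z + v z) = u + v by [].
by rewrite (diffD du dv)/= eu ev; ring.
Qed.

Lemma has_gradientM u v a b c d w : has_gradient u a b w ->
  has_gradient v c d w ->
  has_gradient (fun z => u z * v z) (a * v w + u w * c) (b * v w + u w * d) w.
Proof.
move=> [du eu] [dv ev]; split; first exact: differentiableM.
move=> h; have -> : (fun z => u z * v z) = u * v by [].
rewrite (diffM du dv); transitivity (u w * 'd v w h + v w * 'd u w h); first by [].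
by rewrite eu ev; ring.
Qed.

Lemma has_gradientV u a b w : u w != 0 -> has_gradient u a b w ->
  has_gradient (fun z => (u z)^-1) (- a / (u w) ^+ 2) (- b / (u w) ^+ 2) w.
Proof.
move=> u0 [du eu].
have /is_derive1P[dV eV] := is_deriveV u0 (@is_derive_id _ _ (u w) 1).
split; first exact: (differentiable_comp du dV).
move=> h; rewrite (diff_comp du dV)/= eV eu /GRing.scale/=.
by rewrite -[_ ^- 2]/((u w ^+ 2)^-1); field.
Qed.

Lemma has_gradient_linear (f : {linear (R * R)%type -> R}) w : continuous f ->
  has_gradient f (f (1, 0)) (f (0, 1)) w.
Proof.
move=> cf; split; first exact: linear_differentiable.
move=> -[a b]; rewrite diff_lin//=.
have -> : (a, b) = a *: (1, 0) + b *: (0, 1) :> R * R.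
  by congr pair; rewrite /= !(scaler0, addr0, add0r) /GRing.scale/= mulr1.
by rewrite linearD !linearZ/= /GRing.scale/= mulrC [b * _]mulrC.
Qed.

Lemma has_gradient_fst w : has_gradient fst 1 0 w.
Proof. by apply: (has_gradient_linear (f := fst)) => x; exact: cvg_fst. Qed.

Lemma has_gradient_snd w : has_gradient snd 0 1 w.
Proof. by apply: (has_gradient_linear (f := snd)) => x; exact: cvg_snd. Qed.

Lemma has_gradient_continuous u a b w : has_gradient u a b w ->
  {for w, continuous u}.
Proof. by case=> /differentiable_continuous. Qed.

Lemma has_gradient_eq u v a b c d w : has_gradient u a b w -> u =1 v -> a = c ->
  b = d -> has_gradient v c d w.
Proof. by move=> h /funext <- <- <-. Qed.

(* u + iv is holomorphic with derivative p - iq. *)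
Definition CR_on (G : set (R * R)) u v := exists p q, forall w, G w ->
  [/\ has_gradient u (p w) (q w) w, has_gradient v (- q w) (p w) w,
     {for w, continuous p} & {for w, continuous q}].

Lemma sub_CR_on (G H : set (R * R)) u v : H `<=` G -> CR_on G u v -> CR_on H u v.
Proof. by move=> HG [p [q h]]; exists p, q => w /HG /h. Qed.

Lemma CR_onM (G : set (R * R)) u1 v1 u2 v2 : CR_on G u1 v1 -> CR_on G u2 v2 ->
  CR_on G (fun w => u1 w * u2 w + - (v1 w * v2 w))
          (fun w => u1 w * v2 w + v1 w * u2 w).
Proof.
move=> [p1 [q1 h1]] [p2 [q2 h2]].
exists (fun w => p1 w * u2 w + q1 w * v2 w + (p2 w * u1 w + q2 w * v1 w)).
exists (fun w => q1 w * u2 w - p1 w * v2 w + (q2 w * u1 w - p2 w * v1 w)).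
move=> w Gw; have [U1 V1 P1 Q1] := h1 w Gw; have [U2 V2 P2 Q2] := h2 w Gw.
have cU1 := has_gradient_continuous U1; have cU2 := has_gradient_continuous U2.
have cV1 := has_gradient_continuous V1; have cV2 := has_gradient_continuous V2.
split.
- apply: has_gradient_eq (has_gradientD (has_gradientM U1 U2)
    (has_gradientM (has_gradient_cst (- 1) w) (has_gradientM V1 V2))) _ _ _.
  + by move=> z /=; rewrite mulN1r.
  + by ring.
  + by ring.
- by apply: has_gradient_eq (has_gradientD (has_gradientM U1 V2)
    (has_gradientM V1 U2)) _ _ _ => //; ring.
- by apply: cvgD; apply: cvgD; apply: cvgM.
- by apply: cvgD; apply: cvgB; apply: cvgM.
Qed.

Lemma CR_onV (G : set (R * R)) u v : CR_on G u v ->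
  (forall w, G w -> u w ^+ 2 + v w ^+ 2 != 0) ->
  CR_on G (fun w => u w / (u w ^+ 2 + v w ^+ 2))
          (fun w => - (v w / (u w ^+ 2 + v w ^+ 2))).
Proof.
move=> [p [q h]] n0.
(* [A + iB] is the square of [u + iv] and [N] is the modulus of that square: the derivative
   [-(p - iq) / (u + iv)^2] becomes [-(p - iq) (A - iB) / N^2]. *)
pose A w := u w * u w - v w * v w; pose B w := 2 * (u w * v w).
pose N w := u w * u w + v w * v w.
exists (fun w => - (p w * A w - q w * B w) / (N w * N w)).
exists (fun w => - (p w * B w + q w * A w) / (N w * N w)).
move=> w Gw; have [U V P Q] := h w Gw.
have cU := has_gradient_continuous U; have cV := has_gradient_continuous V.
have N0 : N w != 0 by have := n0 w Gw; rewrite !expr2.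
have NN : has_gradient (fun z => u z ^+ 2 + v z ^+ 2)
    (2 * (p w * u w - q w * v w)) (2 * (q w * u w + p w * v w)) w.
  apply: has_gradient_eq (has_gradientD (has_gradientM U U) (has_gradientM V V)) _ _ _.
  + by move=> z; rewrite !expr2.
  + by ring.
  + by ring.
have NV := has_gradientV (n0 w Gw) NN.
have cA : {for w, continuous A} by apply: cvgB; apply: cvgM.
have cB : {for w, continuous B} by apply: cvgM; [exact: cvg_cst|exact: cvgM].
have cN : {for w, continuous N} by apply: cvgD; apply: cvgM.
have cNV : {for w, continuous (fun w => (N w * N w)^-1)}.
  by apply: cvgV; [rewrite mulf_neq0|exact: cvgM].
split.
- apply: has_gradient_eq (has_gradientM U NV) _ _ _ => //;
  by rewrite /A /B /N; field; exact: N0.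
- apply: has_gradient_eq (has_gradientM (has_gradient_cst (- 1) w)
    (has_gradientM V NV)) _ _ _ => [z||];
  by rewrite ?mulN1r// /A /B /N; field; exact: N0.
- by apply: cvgM => //; apply: cvgN; apply: cvgB; apply: cvgM.
- by apply: cvgM => //; apply: cvgN; apply: cvgD; apply: cvgM.
Qed.

(** The map [w -> (a + ib) w + (c + id)]. *)
Lemma CR_on_affine (G : set (R * R)) (a b c d : R) :
  CR_on G (fun w => a * w.1 + - b * w.2 + c) (fun w => b * w.1 + a * w.2 + d).
Proof.
exists (fun=> a), (fun=> - b) => w _; split; try exact: cvg_cst.
- apply: has_gradient_eq (has_gradientD (has_gradientD
    (has_gradientM (has_gradient_cst a w) (has_gradient_fst w))
    (has_gradientM (has_gradient_cst (- b) w) (has_gradient_snd w)))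
    (has_gradient_cst c w)) _ _ _ => //; ring.
- apply: has_gradient_eq (has_gradientD (has_gradientD
    (has_gradientM (has_gradient_cst b w) (has_gradient_fst w))
    (has_gradientM (has_gradient_cst a w) (has_gradient_snd w)))
    (has_gradient_cst d w)) _ _ _ => //; ring.
Qed.

Lemma CR_on_addc (G : set (R * R)) u v (c d : R) : CR_on G u v ->
  CR_on G (fun w => u w + c) (fun w => v w + d).
Proof.
move=> [p [q h]]; exists p, q => w /h[U V P Q]; split; [| |exact: P|exact: Q].
- by apply: has_gradient_eq (has_gradientD U (has_gradient_cst c w)) _ _ _ => //; rewrite addr0.
- by apply: has_gradient_eq (has_gradientD V (has_gradient_cst d w)) _ _ _ => //; rewrite addr0.
Qed.

End planar_differential.

(** * Mean values over circles *)

Section mean_value.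
Variable R : realType.
Implicit Types (u v p q : R * R -> R) (w z : R * R) (t s x : R).

(** The interval is cut at each exceptional point, and continuity glues the pieces. This is what
    allows holomorphy to fail on finitely many rays. *)
Lemma is_derive0_outside_seq_cst (F : R -> R) (E : seq R) a b : a <= b ->
  {within `[a, b], continuous F} ->
  (forall x, a < x < b -> x \notin E -> is_derive x 1 F 0) -> F a = F b.
Proof.
elim: E a b => [|e E IH] a b ab cF dF.
  have d0 x : x \in `]a, b[%R -> is_derive x 1 F ((fun=> 0) x).
    by rewrite in_itv/= => xab; apply: dF.
  have [c _] := MVT_segment ab d0 cF.
  by rewrite mul0r => /eqP; rewrite subr_eq0 => /eqP.
have [/andP[ae eb]|eab] := boolP (a < e < b); last first.
  apply: IH => // x xab xE; apply: dF => //; rewrite inE negb_or xE andbT.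
  by apply: contraNneq eab => <-.
have sub c d : a <= c -> d <= b -> {within `[c, d], continuous F}.
  move=> ac db; apply: continuous_subspaceW cF => x /=; rewrite !in_itv/=.
  by move=> /andP[cx xd]; rewrite (le_trans ac cx) (le_trans xd db).
transitivity (F e); apply: IH; rewrite ?(ltW ae) ?(ltW eb)//.
- by apply: sub => //; exact: ltW.
- move=> x /andP[ax xe] xE; apply: dF; first by rewrite ax (lt_trans xe eb).
  by rewrite inE negb_or xE andbT lt_eqF.
- by apply: sub => //; exact: ltW.
- move=> x /andP[ex xb] xE; apply: dF; first by rewrite xb (lt_trans ae ex).
  by rewrite inE negb_or xE andbT gt_eqF.
Qed.

Lemma notin_seq_dist (E : seq R) x : x \notin E ->
  exists2 d : R, 0 < d & forall y, `|y - x| < d -> y \notin E.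
Proof.
elim: E => [|e E IH]; first by exists 1.
rewrite inE negb_or => /andP[xe /IH[d d0 dE]].
exists (Num.min d `|e - x|); first by rewrite lt_min d0 normr_gt0 subr_eq0 eq_sym.
move=> y; rewrite lt_min => /andP[/dE yE ye]; rewrite inE negb_or yE andbT.
by apply: contraTneq ye => ->; rewrite ltxx.
Qed.

Definition polar t s : R * R := (t * cos s, t * sin s).

Lemma polar_continuous t s :
  {for (t, s), continuous (fun w : R * R => polar w.1 w.2)}.
Proof.
apply: pair_continuous.
- apply: cvgM; first exact: cvg_fst.
  by apply: continuous_comp; [exact: cvg_snd|exact: continuous_cos].
- apply: cvgM; first exact: cvg_fst.
  by apply: continuous_comp; [exact: cvg_snd|exact: continuous_sin].
Qed.

Lemma polar_sqr t s : (polar t s).1 ^+ 2 + (polar t s).2 ^+ 2 = t ^+ 2.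
Proof. by rewrite /polar/= !exprMn -mulrDr cos2Dsin2 mulr1. Qed.

Lemma continuous_polar_angle u t s : {for polar t s, continuous u} ->
  {for s, continuous (fun s => u (polar t s))}.
Proof.
move=> cu; apply: (@continuous_comp _ _ _ (fun s => polar t s) u) => //.
apply: (@continuous_comp _ _ _ (fun s => (t, s)) (fun w => polar w.1 w.2)).
  exact: pair_cst_continuous.
exact: polar_continuous.
Qed.

Lemma continuous_polar u t s : {for polar t s, continuous u} ->
  {for (t, s), continuous (fun w : R * R => u (polar w.1 w.2))}.
Proof.
move=> cu; apply: (@continuous_comp _ _ _ (fun w : R * R => polar w.1 w.2) u) => //.
exact: polar_continuous.
Qed.

Lemma swap_continuous t s : {for (s, t), continuous (fun w : R * R => (w.2, w.1))}.
Proof. by apply: pair_continuous; [exact: cvg_snd|exact: cvg_fst]. Qed.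

(** In polar coordinates the Cauchy-Riemann equations give [dv/ds = t du/dt]. Hence the integral
    over the angles [[0, x]] of the difference of [u] at the radii [r] and [e], and the integral of
    [v / t] over the radii [[e, r]] at the angle [x], have the same derivative in [x]. A ray with
    angle in [E], where the equations may fail, only costs the differentiability of [F] at one
    point. *)
Lemma circle_integral_const u v (G : set (R * R)) (E : seq R) e r :
  0 < e -> e < r ->
  (forall w, w.1 ^+ 2 + w.2 ^+ 2 <= r ^+ 2 ->
    {for w, continuous u} /\ {for w, continuous v}) ->
  CR_on G u v ->
  (forall t s, 0 < t <= r -> 0 < s < 2 * pi -> s \notin E -> G (polar t s)) ->
  segint 0 (2 * pi) (fun s => u (polar e s)) =
  segint 0 (2 * pi) (fun s => u (polar r s)).
Proof.
move=> e0 er cuv [p [q h]] GE.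
have pi20 : 0 <= 2 * pi :> R by rewrite mulr_ge0// pi_ge0.
have inr t s : 0 <= t <= r -> (polar t s).1 ^+ 2 + (polar t s).2 ^+ 2 <= r ^+ 2.
  by move=> /andP[t0 tr]; rewrite polar_sqr ler_sqr// nnegrE// (le_trans t0).
have cu t s : 0 <= t <= r -> {for polar t s, continuous u}.
  by move=> /(inr _ s)/cuv[].
have cv t s : 0 <= t <= r -> {for polar t s, continuous v}.
  by move=> /(inr _ s)/cuv[].
have r0 : 0 < r by exact: lt_trans er.
pose X s := u (polar r s) + (-1) * u (polar e s).
pose Y s t := v (polar t s) * t^-1.
have cX a b : continuous_on_segment a b X.
  apply: continuous_on_segmentD.
    by move=> s _; apply: continuous_polar_angle; apply: cu; rewrite ltW/=.
  apply: continuous_on_segmentM; first exact: continuous_on_segment_cst.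
  by move=> s _; apply: continuous_polar_angle; apply: cu; rewrite !ltW.
have cY s t : e <= t <= r -> {for (s, t), continuous (fun w : R * R => Y w.1 w.2)}.
  move=> /andP[et tr]; have t0 : 0 < t by exact: lt_le_trans et.
  apply: cvgM.
    apply: (@continuous_comp _ _ _ (fun w : R * R => (w.2, w.1))
      (fun w => v (polar w.1 w.2))); first exact: swap_continuous.
    by apply: continuous_polar; apply: cv; rewrite tr ltW.
  by apply: cvgV; [rewrite gt_eqF|exact: cvg_snd].
have cY2 s : continuous_on_segment e r (Y s).
  move=> t ter; apply: (@continuous_comp _ _ _ (fun t => (s, t)) (fun w : R * R => Y w.1 w.2)).
    exact: pair_cst_continuous.
  exact: cY.
pose F x := segint 0 x X + (-1) * segint e r (Y x).
have F2 : F 0 = F (2 * pi).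
  apply: (@is_derive0_outside_seq_cst _ E) => //.
    have c1 := segint_within_continuous pi20 (cX 0 (2 * pi)).
    have c2 : {within `[0, 2 * pi], continuous (fun x => segint e r (Y x))}.
      apply: continuous_subspaceT => x; apply: (@segint_param_continuous R R e r Y x).
      - exact: ltW.
      - by apply: filterE => y; exact: cY2.
      - by move=> t; exact: cY.
    move=> x; apply: cvgD; first exact: c1.
    by apply: cvgM; [exact: cvg_cst|exact: c2].
  move=> x x2 xE.
  have [d d0 dE] := notin_seq_dist xE.
  (* Angles within [m] of [x] avoid [E] and stay between [0] and [2 * pi]. *)
  pose m := Num.min d (Num.min x (2 * pi - x)).
  have m0 : 0 < m.
    by case/andP: x2 => x1 x2; rewrite !lt_min d0 x1 subr_gt0.
  have mG y t : `|y - x| < m -> e <= t <= r -> G (polar t y).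
    rewrite !lt_min => /and3P[yd yx yx2] /andP[et tr]; apply: GE.
    - by rewrite tr (lt_le_trans e0).
    - by move: yx yx2; rewrite !ltr_norml; lra.
    - exact: dE.
  pose Y' y t := p (polar t y) * cos y + q (polar t y) * sin y.
  have xx : `|x - x| < m by rewrite subrr normr0.
  have dY : is_derive x 1 (fun y => segint e r (Y y)) (segint e r (Y' x)).
    apply: (segint_param_is_derive (d := m)) => //; first exact: ltW.
    - move=> y t ym ter; have [_ V _ _] := h _ (mG _ _ ym ter).
      have t0 : 0 < t by case/andP: ter => et _; exact: lt_le_trans et.
      have d1 : is_derive y 1 (fun s => t * cos s) (t * - sin y).
        exact: is_deriveZ.
      have d2 : is_derive y 1 (fun s => t * sin s) (t * cos y).
        exact: is_deriveZ.
      have dv := has_gradient_comp d1 d2 V.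
      have := is_deriveM dv (is_derive_cst t^-1 y 1).
      move=> D; apply: is_derive_eq D _.
      rewrite /Y' /GRing.scale/= mulr0 add0r; field.
      by rewrite gt_eqF.
    - move=> t ter; have [_ _ P Q] := h _ (mG _ _ xx ter).
      have sw (k : R * R -> R) : {for polar t x, continuous k} ->
          {for (x, t), continuous (fun w : R * R => k (polar w.2 w.1))}.
        move=> ck; apply: (@continuous_comp _ _ _ (fun w : R * R => (w.2, w.1))
          (fun w => k (polar w.1 w.2))); first exact: swap_continuous.
        exact: continuous_polar.
      apply: cvgD; apply: cvgM.
      + exact: sw.
      + by apply: continuous_comp; [exact: cvg_fst|exact: continuous_cos].
      + exact: sw.
      + by apply: continuous_comp; [exact: cvg_fst|exact: continuous_sin].
  have FT : segint e r (Y' x) = u (polar r x) - u (polar e x).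
    apply: (segint_FTC2 (F := fun t => u (polar t x))) => //.
      move=> t ter; have [_ _ P Q] := h _ (mG _ _ xx ter).
      have sw (k : R * R -> R) : {for polar t x, continuous k} ->
          {for t, continuous (fun t => k (polar t x))}.
        move=> ck; apply: (@continuous_comp _ _ _ (fun t => (t, x))
          (fun w => k (polar w.1 w.2))); last exact: continuous_polar.
        by apply: pair_continuous; [exact: cvg_id|exact: cvg_cst].
      by apply: cvgD; apply: cvgM; (exact: sw || exact: cvg_cst).
    move=> t ter; have [U _ _ _] := h _ (mG _ _ xx ter).
    have d1 : is_derive t 1 (fun t => t * cos x) (cos x).
      apply: is_derive_eq (is_deriveM (@is_derive_id _ _ t 1) (is_derive_cst (cos x) t 1)) _.
      by rewrite /GRing.scale/= mulr0 add0r mulr1.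
    have d2 : is_derive t 1 (fun t => t * sin x) (sin x).
      apply: is_derive_eq (is_deriveM (@is_derive_id _ _ t 1) (is_derive_cst (sin x) t 1)) _.
      by rewrite /GRing.scale/= mulr0 add0r mulr1.
    exact: has_gradient_comp.
  have dX := segint_FTC1 (cX 0 (2 * pi)) x2.
  apply: is_derive_eq (is_deriveD dX (is_deriveZ (-1) dY)) _.
  by rewrite FT /X /GRing.scale/= !mulN1r subrr.
have P0 t : polar t (2 * pi) = polar t 0.
  by rewrite /polar mulr_natl cos2pi sin2pi cos0 sin0.
(* By periodicity the radial integrals at the angles [0] and [2 * pi] agree, so [F 0 = F (2 * pi)]
   says that the full angular integral vanishes. *)
move: F2; rewrite /F (_ : segint e r (Y (2 * pi)) = segint e r (Y 0)); last first.
  by apply: eq_segint => t _; rewrite /Y P0.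
move=> /addIr; rewrite [LHS](_ : _ = 0); last first.
  by rewrite /segint set_itv1 Rintegral_set1.
rewrite segintD ?segintZ ?mulN1r.
- by move=> /esym/eqP; rewrite subr_eq0 => /eqP.
- by move=> s _; apply: continuous_polar_angle; apply: cu; rewrite !ltW.
- by move=> s _; apply: continuous_polar_angle; apply: cu; rewrite ltW/=.
- apply: continuous_on_segmentM; first exact: continuous_on_segment_cst.
  by move=> s _; apply: continuous_polar_angle; apply: cu; rewrite !ltW.
Qed.

(** The circle integrals do not depend on the radius; as the radius tends to [0] they converge to
    the value at the centre, by continuity alone. *)
Lemma mean_value_CR u v (G : set (R * R)) (E : seq R) r : 0 < r ->
  (forall w, w.1 ^+ 2 + w.2 ^+ 2 <= r ^+ 2 ->
    {for w, continuous u} /\ {for w, continuous v}) ->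
  CR_on G u v ->
  (forall t s, 0 < t <= r -> 0 < s < 2 * pi -> s \notin E -> G (polar t s)) ->
  segint 0 (2 * pi) (fun s => u (polar r s)) = 2 * pi * u (0, 0).
Proof.
move=> r0 cuv uvG GE.
pose F x := segint 0 (2 * pi) (fun s => u (polar x s)).
have pi20 : 0 <= 2 * pi :> R by rewrite mulr_ge0// pi_ge0.
have cF : {for 0, continuous F}.
  have pr t s : `|t| <= r -> (polar t s).1 ^+ 2 + (polar t s).2 ^+ 2 <= r ^+ 2.
    by move=> tr; rewrite polar_sqr -real_normK ?num_real// ler_sqr// nnegrE ltW.
  apply: (@segint_param_continuous R R 0 (2 * pi) (fun t s => u (polar t s)) 0) => //.
    near=> t.
    have tr : `|t| <= r.
      by near: t; exists r => //= t /=; rewrite sub0r normrN; exact: ltW.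
    move=> s' _; apply: continuous_polar_angle.
    by have [] := cuv (polar t s') (pr _ _ tr).
  have r1 : `|0 : R| <= r by rewrite normr0 ltW.
  move=> s _; apply: continuous_polar.
  by have [] := cuv (polar 0 s) (pr _ _ r1).
have F0 : F 0 = 2 * pi * u (0, 0).
  rewrite /F (_ : (fun s => _) = fun=> u (0, 0)); last first.
    by apply/funext => s; rewrite /polar !mul0r.
  by rewrite segint_cst// subr0 mulrC.
rewrite -F0 -/(F r); apply/eqP; rewrite -subr_eq0 -normr_le0.
apply/ler_addgt0Pr => x x0; rewrite add0r.
have /cvgrPdist_le/(_ x x0)[d /= d0 dF] := cF.
pose e := Num.min d r / 2.
have m0 : 0 < Num.min d r by rewrite lt_min d0.
have e0 : 0 < e by rewrite divr_gt0.
have em : e < Num.min d r by rewrite ltr_pdivrMr// ltr_pMr// ltr1n.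
have [ed er] : e < d /\ e < r by move: em; rewrite lt_min => /andP[].
rewrite /F -(circle_integral_const e0 er cuv uvG GE) -[segint _ _ _]/(F e) distrC -[X in X - _]/(F 0).
by apply: dF; rewrite /= sub0r normrN gtr0_norm.
Unshelve. all: end_near. Qed.

End mean_value.

Section differential_eps.
Context {R : realType} {V W : normedModType R}.

Lemma differentiable_epsP (f : V -> W) (l : {linear V -> W}) x : continuous l ->
  (forall e, 0 < e -> \forall h \near (0 : V), `|f (h + x) - f x - l h| <= e * `|h|) ->
  differentiable f x /\ forall h, 'd f x h = l h.
Proof.
move=> cl hf.
have E : f \o shift x = cst (f x) + l +o_ 0 id.
  apply/eqaddoP => e e0; near=> h.
  rewrite [leLHS](_ : _ = `|f (h + x) - f x - l h|); last first.
    by rewrite /= !fctE/= opprD addrA.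
  by near: h; exact: hf.
have dE := diff_unique cl E; split; last by move=> h; rewrite dE.
by apply/diff_locallyP; rewrite dE.
Unshelve. all: end_near. Qed.

Lemma differentiable_eps (f : V -> W) x : differentiable f x ->
  forall e, 0 < e -> \forall h \near (0 : V),
    `|f (h + x) - f x - 'd f x h| <= e * `|h|.
Proof.
move=> /diff_locallyP[_ /eqaddoP hf] e e0; near=> h.
rewrite [leLHS](_ : _ = `|(f \o shift x - (cst (f x) + 'd f x)) h|); last first.
  by rewrite /= !fctE/= opprD addrA.
by near: h; exact: hf.
Unshelve. all: end_near. Qed.

Lemma near_differentiable (f g : V -> W) x : (\forall y \near x, f y = g y) ->
  differentiable f x -> differentiable g x /\ forall h, 'd g x h = 'd f x h.
Proof.
move=> fg df; apply: differentiable_epsP; first exact: diff_continuous.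
move=> e e0; near=> h.
rewrite -(nbhs_singleton fg) -(_ : f (h + x) = g (h + x)).
  by near: h; exact: differentiable_eps.
near: h; have : (h + x) @[h --> 0] --> x.
  by rewrite -[x in X in _ --> X]add0r; apply: cvgD; [exact: cvg_id|exact: cvg_cst].
by move=> /(_ _ fg).
Unshelve. all: end_near. Qed.

End differential_eps.

(** * The Poisson formula for functions holomorphic off a line *)

Section poisson.
Variable R : realType.
Implicit Types (u v p q : R * R -> R) (w z : R * R) (t s x r : R).

Lemma near_has_gradient u v (a b : R) w : (\forall z \near w, u z = v z) ->
  has_gradient u a b w -> has_gradient v a b w.
Proof.
move=> uv [du eu]; have [dv ev] := near_differentiable uv du.
by split=> [|h]; [exact: dv|rewrite ev; exact: eu].
Qed.

Lemma near_CR_on (G : set (R * R)) u v u' v' :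
  (forall w, G w -> \forall z \near w, u z = u' z) ->
  (forall w, G w -> \forall z \near w, v z = v' z) ->
  CR_on G u v -> CR_on G u' v'.
Proof.
move=> uu vv [p [q h]]; exists p, q => w Gw; have [U V P Q] := h w Gw.
split; [exact: near_has_gradient (uu w Gw) U|exact: near_has_gradient (vv w Gw) V|exact: P|exact: Q].
Qed.

(** The rays to be avoided are those of the real axis and of the line through [0] and [(a, b)]; the
    latter has angle [pi / 2 - atan (a / b)] modulo [pi]. *)
Lemma angle_exists (a b : R) : b != 0 -> exists E : seq R,
  forall s, 0 < s < 2 * pi -> s \notin E -> sin s != 0 /\ a * sin s - b * cos s != 0.
Proof.
move=> b0.
have sin0 x : - pi < x < 2 * pi -> sin x = 0 -> x = 0 \/ x = pi.
  move=> /andP[x1 x2] sx.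
  have [x0|x0|->] := ltgtP x 0; [|right|by left].
    have : 0 < sin (- x) by apply: sin_gt0_pi; lra.
    by rewrite sinN sx oppr0 ltxx.
  have [xp|xp|//] := ltgtP x pi.
    by have := @sin_gt0_pi R x; rewrite x0 xp sx ltxx => /(_ isT).
  have : 0 < sin (x - pi) by apply: sin_gt0_pi; lra.
  have -> : sin (x - pi) = - sin x by rewrite -[x in RHS](subrK pi) sinDpi opprK.
  by rewrite sx oppr0 ltxx.
pose A := atan (a / b); pose T := pi / 2 - A.
have ca : cos A != 0 by rewrite gt_eqF// cos_gt0_pihalf// atan_gtNpi2 atan_ltpi2.
have tA : sin A / cos A = a / b by rewrite -[LHS]/(tan A) atanK.
have eA : a = b * (sin A / cos A) by rewrite tA; field.
have T0 : 0 < T < pi.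
  have := atan_gtNpi2 (a / b); have := atan_ltpi2 (a / b).
  have := pi_gt0 R; rewrite /T /A; lra.
exists [:: pi; T; T + pi] => s s2; rewrite !inE !negb_or => /and3P[sp sT sTp].
have pi0 := pi_gt0 R; have [/andP[s0 s2'] /andP[T1 T2]] := (s2, T0).
split; apply/eqP.
  move=> /sin0[|e|e]; first by lra.
    by move: s0; rewrite e ltxx.
  by move/eqP: sp.
move=> e; have sT0 : sin (s - T) = 0.
  have -> : sin (s - T) = - cos (s + A).
    rewrite -[s + A](_ : s - T + pi / 2 = _); last by rewrite /T; ring.
    by rewrite cosD sin_pihalf cos_pihalf; ring.
  have : b / cos A * cos (s + A) = 0.
    rewrite cosD -[RHS]oppr0 -e {1}eA; field.
    exact: ca.
  move=> /eqP; rewrite mulf_eq0 (negPf (mulf_neq0 b0 _)) ?invr_neq0//=.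
  by move=> /eqP ->; rewrite oppr0.
case: (sin0 _ _ sT0) => [|d|d]; first by lra.
  by move/eqP: sT; apply; lra.
by move/eqP: sTp; apply; lra.
Qed.

(** The kernel of the disc of radius [r] about [0], without the factor [1 / (2 * pi)]. *)
Definition poisson r z s : R := (r ^+ 2 - (z.1 ^+ 2 + z.2 ^+ 2)) /
  ((r * cos s - z.1) ^+ 2 + (r * sin s - z.2) ^+ 2).

(* Real and imaginary part of (g(w) - g(z)) / (w - z), where g = u + iv. *)
Definition quotient_re u v z w : R := if w == z then 'd u z (1, 0) else
  ((u w - u z) * (w.1 - z.1) + (v w - v z) * (w.2 - z.2)) /
  ((w.1 - z.1) ^+ 2 + (w.2 - z.2) ^+ 2).

Definition quotient_im u v z w : R := if w == z then 'd v z (1, 0) else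
  ((v w - v z) * (w.1 - z.1) - (u w - u z) * (w.2 - z.2)) /
  ((w.1 - z.1) ^+ 2 + (w.2 - z.2) ^+ 2).

Lemma sqdist_eq0 w z : ((w.1 - z.1) ^+ 2 + (w.2 - z.2) ^+ 2 == 0) = (w == z).
Proof.
rewrite paddr_eq0 ?sqr_ge0// !sqrf_eq0 !subr_eq0.
by case: w z => [a b] [c d].
Qed.

Lemma sqdist_continuous w z :
  {for w, continuous (fun w => (w.1 - z.1) ^+ 2 + (w.2 - z.2) ^+ 2)}.
Proof.
by apply: cvgD; rewrite expr2; under eq_fun do rewrite expr2;
  apply: cvgM; apply: cvgB; (exact: cvg_fst || exact: cvg_snd || exact: cvg_cst).
Qed.

(** Removable singularity. At [z] the first-order errors of [u] and [v] are at most [e * |y - z|],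
    so the quotient differs from the derivative by at most [2 * e]. *)
Lemma quotient_continuous u v (a b : R) w z :
  {for w, continuous u} -> {for w, continuous v} ->
  has_gradient u a b z -> has_gradient v (- b) a z ->
  {for w, continuous (quotient_re u v z)} /\ {for w, continuous (quotient_im u v z)}.
Proof.
move=> cu cv Gu Gv; have [wz|wz] := eqVneq w z; last first.
  have N0 : (w.1 - z.1) ^+ 2 + (w.2 - z.2) ^+ 2 != 0 by rewrite sqdist_eq0.
  have nwz : \forall y \near w, y != z.
    near=> y; rewrite -sqdist_eq0; near: y.
    exact: cvgr_neq0 (@sqdist_continuous w z) N0.
  have cV : {for w, continuous (fun w => ((w.1 - z.1) ^+ 2 + (w.2 - z.2) ^+ 2)^-1)}.
    by apply: cvgV => //; exact: (@sqdist_continuous w z).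
  have cm (f g : R * R -> R) c d : {for w, continuous f} -> {for w, continuous g} ->
      {for w, continuous (fun w => (f w - c) * (g w - d))}.
    by move=> cf cg; apply: cvgM; apply: cvgB => //; exact: cvg_cst.
  have c1 : {for w, continuous (@fst R R)} by exact: cvg_fst.
  have c2 : {for w, continuous (@snd R R)} by exact: cvg_snd.
  split.
  - have cq : {for w, continuous (fun w => ((u w - u z) * (w.1 - z.1) +
        (v w - v z) * (w.2 - z.2)) * ((w.1 - z.1) ^+ 2 + (w.2 - z.2) ^+ 2)^-1)}.
      by apply: cvgM => //; apply: cvgD; exact: cm.
    rewrite /prop_for /continuous_at [X in _ --> X]/quotient_re (negPf wz).
    apply: cvg_trans cq; apply: near_eq_cvg; near=> y.
    rewrite /quotient_re ifF//; apply/negbTE; near: y; exact: nwz.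
  - have cq : {for w, continuous (fun w => ((v w - v z) * (w.1 - z.1) -
        (u w - u z) * (w.2 - z.2)) * ((w.1 - z.1) ^+ 2 + (w.2 - z.2) ^+ 2)^-1)}.
      by apply: cvgM => //; apply: cvgB; exact: cm.
    rewrite /prop_for /continuous_at [X in _ --> X]/quotient_im (negPf wz).
    apply: cvg_trans cq; apply: near_eq_cvg; near=> y.
    rewrite /quotient_im ifF//; apply/negbTE; near: y; exact: nwz.
move: Gu Gv => [du eu] [dv ev]; rewrite wz.
have key : forall e, 0 < e -> \forall y \near z, y != z ->
    `|u y - u z - (a * (y.1 - z.1) + b * (y.2 - z.2))| <= e * `|y - z| /\
    `|v y - v z - (- b * (y.1 - z.1) + a * (y.2 - z.2))| <= e * `|y - z|.
  move=> e e0; have yz0 : (y - z) @[y --> z] --> (0 : R * R).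
    by rewrite -(subrr z); apply: cvgB; [exact: cvg_id|exact: cvg_cst].
  have nu : \forall y \near z, `|u (y - z + z) - u z - 'd u z (y - z)| <= e * `|y - z|.
    exact: (yz0 _ (differentiable_eps du e0)).
  have nv : \forall y \near z, `|v (y - z + z) - v z - 'd v z (y - z)| <= e * `|y - z|.
    exact: (yz0 _ (differentiable_eps dv e0)).
  apply: filterS2 nu nv => y hu hv _.
  by move: hu hv; rewrite subrK eu ev.
have bound (y : R * R) (A B e : R) : y != z -> `|A| <= e * `|y - z| -> `|B| <= e * `|y - z| ->
    forall c d : R, `|c| <= `|y - z| -> `|d| <= `|y - z| ->
    `|(A * c + B * d) / ((y.1 - z.1) ^+ 2 + (y.2 - z.2) ^+ 2)| <= 2 * e.
  move=> yz Ae Be c d cy dy.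
  have N0 : 0 < (y.1 - z.1) ^+ 2 + (y.2 - z.2) ^+ 2.
    by rewrite lt_neqAle eq_sym sqdist_eq0 yz addr_ge0 ?sqr_ge0.
  (* The norm on pairs is the sup norm, so its square is below the Euclidean denominator. *)
  have yN : `|y - z| ^+ 2 <= (y.1 - z.1) ^+ 2 + (y.2 - z.2) ^+ 2.
    have [->|->] : `|y - z| = `|y.1 - z.1| \/ `|y - z| = `|y.2 - z.2|.
      by rewrite prod_normE /Num.max; case: ifP => _; [right|left].
      by rewrite real_normK ?num_real// lerDl sqr_ge0.
    by rewrite real_normK ?num_real// lerDr sqr_ge0.
  rewrite normrM normfV (gtr0_norm N0) ler_pdivrMr//.
  have e0 : 0 <= e.
    have := le_trans (normr_ge0 _) Ae; rewrite pmulr_lge0// normr_gt0.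
    by rewrite subr_eq0.
  apply: (@le_trans _ _ (2 * e * `|y - z| ^+ 2)); last first.
    by rewrite ler_wpM2l// mulr_ge0.
  apply: le_trans (ler_normD _ _) _; rewrite !normrM.
  have -> : 2 * e * `|y - z| ^+ 2 = e * `|y - z| * `|y - z| + e * `|y - z| * `|y - z| by ring.
  by apply: lerD; apply: ler_pM.
have c12 (y : R * R) : `|y.1 - z.1| <= `|y - z| /\ `|y.2 - z.2| <= `|y - z|.
  by rewrite prod_normE/= !le_max !lexx orbT.
split; apply/cvgrPdist_le => e e0.
- have e2 : 0 < e / 2 by rewrite divr_gt0.
  near=> y; have [->|yz] := eqVneq y z; first by rewrite subrr normr0 ltW.
  have [h1 h2] : `|u y - u z - (a * (y.1 - z.1) + b * (y.2 - z.2))| <= e / 2 * `|y - z| /\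
    `|v y - v z - (- b * (y.1 - z.1) + a * (y.2 - z.2))| <= e / 2 * `|y - z|.
    by move: yz; near: y; exact: key.
  rewrite distrC /quotient_re eqxx (negPf yz) eu/=.
  have [c1 c2] := c12 y.
  have := bound _ _ _ _ yz h1 h2 _ _ c1 c2; rewrite (_ : 2 * (e / 2) = e); last by field.
  apply: le_trans; rewrite le_eqVlt; apply/orP; left; apply/eqP; congr `|_|.
  field; apply: contra_neq yz => N0; apply/eqP; rewrite -sqdist_eq0 -[X in _ == X]N0.
  by apply/eqP; ring.
- have e2 : 0 < e / 2 by rewrite divr_gt0.
  near=> y; have [->|yz] := eqVneq y z; first by rewrite subrr normr0 ltW.
  have [h1 h2] : `|u y - u z - (a * (y.1 - z.1) + b * (y.2 - z.2))| <= e / 2 * `|y - z| /\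
    `|v y - v z - (- b * (y.1 - z.1) + a * (y.2 - z.2))| <= e / 2 * `|y - z|.
    by move: yz; near: y; exact: key.
  rewrite distrC /quotient_im eqxx (negPf yz) ev/=.
  have [c1 c2'] := c12 y.
  have c2 : `|- (y.2 - z.2)| <= `|y - z| by rewrite normrN.
  have := bound _ _ _ _ yz h2 h1 _ _ c1 c2; rewrite (_ : 2 * (e / 2) = e); last by field.
  apply: le_trans; rewrite le_eqVlt; apply/orP; left; apply/eqP; congr `|_|.
  field; apply: contra_neq yz => N0; apply/eqP; rewrite -sqdist_eq0 -[X in _ == X]N0.
  by apply/eqP; ring.
Unshelve. all: end_near. Qed.


(** [Dre + i Dim] is [r^2 - conj(z) w], which has no zero in the closed disc when [|z| < r]. The
    shape, with its summand [0], is that of [CR_on_affine]. *)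
Let Dre r z w : R := - z.1 * w.1 + - z.2 * w.2 + r ^+ 2.
Let Dim r z w : R := z.2 * w.1 + - z.1 * w.2 + 0.

Let Dre_gt0 r z w : z.1 ^+ 2 + z.2 ^+ 2 < r ^+ 2 ->
  w.1 ^+ 2 + w.2 ^+ 2 <= r ^+ 2 -> 0 < Dre r z w.
Proof.
move=> zr wr; have := sqr_ge0 (z.1 - w.1); have := sqr_ge0 (z.2 - w.2).
rewrite /Dre; nra.
Qed.

Let DD_neq0 r z w : z.1 ^+ 2 + z.2 ^+ 2 < r ^+ 2 ->
  w.1 ^+ 2 + w.2 ^+ 2 <= r ^+ 2 -> Dre r z w ^+ 2 + Dim r z w ^+ 2 != 0.
Proof.
move=> zr wr; rewrite paddr_eq0 ?sqr_ge0// sqrf_eq0.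
by rewrite gt_eqF// Dre_gt0.
Qed.

Lemma CR_on_D_inv r z : z.1 ^+ 2 + z.2 ^+ 2 < r ^+ 2 ->
  CR_on [set w | w.1 ^+ 2 + w.2 ^+ 2 <= r ^+ 2]
    (fun w => Dre r z w / (Dre r z w ^+ 2 + Dim r z w ^+ 2))
    (fun w => - (Dim r z w / (Dre r z w ^+ 2 + Dim r z w ^+ 2))).
Proof.
move=> zr; apply: CR_onV; last by move=> w; exact: DD_neq0.
by rewrite /Dre /Dim; exact: CR_on_affine.
Qed.

(** [num1 + i num2] is [(a + ib) w], and [frac1 + i frac2] is [(a + ib) w / (r^2 - conj(z) w)],
    which vanishes at [0]. *)
Let num1 (a b : R) w := a * w.1 + - b * w.2 + 0.
Let num2 (a b : R) w := b * w.1 + a * w.2 + 0.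
Let frac1 r z (a b : R) w :=
  num1 a b w * (Dre r z w / (Dre r z w ^+ 2 + Dim r z w ^+ 2)) +
  - (num2 a b w * - (Dim r z w / (Dre r z w ^+ 2 + Dim r z w ^+ 2))).
Let frac2 r z (a b : R) w :=
  num1 a b w * - (Dim r z w / (Dre r z w ^+ 2 + Dim r z w ^+ 2)) +
  num2 a b w * (Dre r z w / (Dre r z w ^+ 2 + Dim r z w ^+ 2)).

Let frac1_0 r z (a b : R) : frac1 r z a b (0, 0) = 0.
Proof. by rewrite /frac1 /num1 /num2/= !mulr0 !addr0 !mul0r oppr0 addr0. Qed.

Let frac2_0 r z (a b : R) : frac2 r z a b (0, 0) = 0.
Proof. by rewrite /frac2 /num1 /num2/= !mulr0 !addr0 !mul0r addr0. Qed.

Let CR_on_frac r z (a b : R) : z.1 ^+ 2 + z.2 ^+ 2 < r ^+ 2 ->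
  CR_on [set w | w.1 ^+ 2 + w.2 ^+ 2 <= r ^+ 2] (frac1 r z a b) (frac2 r z a b).
Proof.
move=> zr; apply: CR_onM; last exact: CR_on_D_inv.
exact: CR_on_affine.
Qed.

Lemma CR_on_continuous (G : set (R * R)) u v w : CR_on G u v -> G w ->
  {for w, continuous u} /\ {for w, continuous v}.
Proof.
move=> [p [q h]] Gw; have [U V _ _] := h w Gw.
by split; [exact: has_gradient_continuous U|exact: has_gradient_continuous V].
Qed.

Lemma polar_in_disc t s r : 0 < t <= r ->
  (polar t s).1 ^+ 2 + (polar t s).2 ^+ 2 <= r ^+ 2.
Proof.
move=> /andP[t0 tr]; rewrite polar_sqr ler_sqr ?nnegrE// ltW//.
exact: lt_le_trans tr.
Qed.

(** On the circle [|w| = r] one has [r^2 - conj(z) w = w conj(w - z)]. *)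
Let polar_D r z s : z.1 ^+ 2 + z.2 ^+ 2 < r ^+ 2 -> 0 < r ->
  let N := (r * cos s - z.1) ^+ 2 + (r * sin s - z.2) ^+ 2 in
  N != 0 /\ Dre r z (polar r s) ^+ 2 + Dim r z (polar r s) ^+ 2 = r ^+ 2 * N.
Proof.
move=> zr r0 N; have e := polar_sqr r s; rewrite /polar/= in e.
split; last first.
  by rewrite /N /Dre /Dim /polar/= -e; ring.
apply/negP; rewrite (@sqdist_eq0 (r * cos s, r * sin s) z) => /eqP zE.
by move: zr; rewrite -zE /= e ltxx.
Qed.

Lemma continuous_poisson r z : 0 < r -> z.1 ^+ 2 + z.2 ^+ 2 < r ^+ 2 ->
  forall s, {for s, continuous (poisson r z)}.
Proof.
move=> r0 zr s; have [N0 _] := polar_D s zr r0.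
apply: cvgM; first exact: cvg_cst.
apply: cvgV => //.
have c (f : R -> R) (b : R) : {for s, continuous f} ->
    {for s, continuous (fun x => (r * f x - b) ^+ 2)}.
  move=> cf; have -> : (fun x => (r * f x - b) ^+ 2) =
    fun x => (r * f x - b) * (r * f x - b) by apply/funext => x; rewrite expr2.
  by apply: cvgM; (apply: cvgB; [apply: cvgM => //; exact: cvg_cst|exact: cvg_cst]).
by apply: cvgD; apply: c; [exact: continuous_cos|exact: continuous_sin].
Qed.

(** On the circle the kernel is [1 + 2 Re (conj(z) w / (r^2 - conj(z) w))]. The fraction vanishes at
    the centre, so the mean value property leaves only the [1]. *)
Lemma segint_poisson r z : 0 < r -> z.1 ^+ 2 + z.2 ^+ 2 < r ^+ 2 ->
  segint 0 (2 * pi) (poisson r z) = 2 * pi.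
Proof.
move=> r0 zr; have pi20 : 0 <= 2 * pi :> R by rewrite mulr_ge0// pi_ge0.
have H := CR_on_frac z.1 (- z.2) zr.
have cf w := @CR_on_continuous _ _ _ w H.
have := @mean_value_CR _ _ _ _ [::] r r0 (fun w wr => cf w wr) H.
move=> /(_ (fun t s tr _ _ => polar_in_disc s tr)).
rewrite frac1_0 mulr0 => I0.
have E s : poisson r z s = 1 + 2 * frac1 r z z.1 (- z.2) (polar r s).
  have [N0 DDE] := polar_D s zr r0.
  rewrite /poisson /frac1 /num1 /num2 DDE.
  have e := polar_sqr r s; rewrite /Dre /Dim /polar/= in e *.
  have r00 : r ^+ 2 != 0 by rewrite sqrf_eq0 gt_eqF.
  move: r00 N0; rewrite -e; set x := r * cos s; set y := r * sin s => r00 N0.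
  by field; rewrite r00 N0.
have rr : 0 < r <= r by rewrite r0/=.
have c2 : continuous_on_segment 0 (2 * pi) (fun s => frac1 r z z.1 (- z.2) (polar r s)).
  move=> s _; apply: continuous_polar_angle.
  by have [] := cf (polar r s) (polar_in_disc s rr).
rewrite (eq_segint (fun s _ => E s)) segintD.
- by rewrite segintZ// I0 segint_cst// mulr0 addr0 mul1r subr0.
- exact: continuous_on_segment_cst.
- by apply: continuous_on_segmentM => //; exact: continuous_on_segment_cst.
Qed.

(** With [g = u + iv], the mean value property is applied to [(g(w) - g(z)) / (w - z)] times
    [(r^2 - |z|^2) w / (r^2 - conj(z) w)]. This vanishes at [0], and on the circle it is
    [g(w) - g(z)] times the Poisson kernel. The condition [z.2 != 0] makes [g] differentiable at
    [z], so that the quotient is continuous there. *)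
Lemma poisson_formula0 u v r z : 0 < r ->
  (forall w, w.1 ^+ 2 + w.2 ^+ 2 <= r ^+ 2 ->
    {for w, continuous u} /\ {for w, continuous v}) ->
  CR_on [set w | w.1 ^+ 2 + w.2 ^+ 2 <= r ^+ 2 /\ w.2 != 0] u v ->
  z.1 ^+ 2 + z.2 ^+ 2 < r ^+ 2 -> z.2 != 0 ->
  segint 0 (2 * pi) (fun s => poisson r z s * u (polar r s)) = 2 * pi * u z.
Proof.
move=> r0 cuv Huv zr z2.
pose G := [set w | [/\ w.1 ^+ 2 + w.2 ^+ 2 <= r ^+ 2, w.2 != 0 & w != z]].
have [a [b Gab]] := Huv.
have [Uz Vz _ _] := Gab z (conj (ltW zr) z2).
have Hq : CR_on G (quotient_re u v z) (quotient_im u v z).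
  have H1 : CR_on G (fun w => u w + - u z) (fun w => v w + - v z).
    by apply: CR_on_addc; apply: sub_CR_on Huv => w [].
  have H2 := CR_onV (CR_on_affine G 1 0 (- z.1) (- z.2)).
  have {}H2 := H2 _; apply: near_CR_on (CR_onM H1 (H2 _)).
  - move=> w [_ _ wz]; have : \forall y \near w, (y.1 - z.1) ^+ 2 + (y.2 - z.2) ^+ 2 != 0.
      by apply: cvgr_neq0 (@sqdist_continuous w z) _; rewrite sqdist_eq0.
    apply: filterS => y; rewrite sqdist_eq0 => yz; rewrite /quotient_re (negPf yz).
    rewrite !mul1r !mul0r !oppr0 !mul0r !addr0 !add0r.
    by ring.
  - move=> w [_ _ wz]; have : \forall y \near w, (y.1 - z.1) ^+ 2 + (y.2 - z.2) ^+ 2 != 0.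
      by apply: cvgr_neq0 (@sqdist_continuous w z) _; rewrite sqdist_eq0.
    apply: filterS => y; rewrite sqdist_eq0 => yz; rewrite /quotient_im (negPf yz).
    rewrite !mul1r !mul0r !oppr0 !mul0r !addr0 !add0r.
    by ring.
  - move=> w [_ _ wz].
    by rewrite !mul1r !mul0r oppr0 !mul0r !addr0 !add0r sqdist_eq0.
have HL := CR_on_frac (r ^+ 2 - (z.1 ^+ 2 + z.2 ^+ 2)) 0 zr.
have HK := CR_onM Hq (sub_CR_on (fun w Gw => let: And3 h _ _ := Gw in h) HL).
(* On rays inside the line [w.2 = 0] or through [z] the product is only known to be continuous. *)
have [E HE] := angle_exists z.1 z2.
have Gt t s : 0 < t <= r -> 0 < s < 2 * pi -> s \notin E -> G (polar t s).
  move=> tr s2 /(HE _ s2)[s0 sz]; have t0 : t != 0 by case/andP: tr => /gt_eqF ->.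
  split; first exact: polar_in_disc.
    by rewrite /polar/= mulf_neq0.
  apply: contra_neq sz => <-; rewrite /polar/=; ring.
have I0 := mean_value_CR r0 _ HK Gt.
have {}I0 := I0 _; rewrite frac1_0 frac2_0 !mulr0 subr0 mulr0 in I0.
have E0 s : quotient_re u v z (polar r s) *
    frac1 r z (r ^+ 2 - (z.1 ^+ 2 + z.2 ^+ 2)) 0 (polar r s) + - (
    quotient_im u v z (polar r s) *
    frac2 r z (r ^+ 2 - (z.1 ^+ 2 + z.2 ^+ 2)) 0 (polar r s)) =
    poisson r z s * u (polar r s) + - u z * poisson r z s.
  have [N0 DDE] := polar_D s zr r0.
  have wz : (polar r s == z) = false.
    by apply/negbTE; rewrite -sqdist_eq0.
  rewrite /quotient_re /quotient_im wz /poisson /frac1 /frac2 /num1 /num2 DDE.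
  have e := polar_sqr r s.
  set U := u (polar r s); set V := v (polar r s).
  rewrite /Dre /Dim /polar/= in e *.
  have r00 : r ^+ 2 != 0 by rewrite sqrf_eq0 gt_eqF.
  move: r00 N0; rewrite -e; set x := r * cos s; set y := r * sin s => r00 N0.
  by field; rewrite r00 N0.
have rr : 0 < r <= r by rewrite r0/=.
have c1 : continuous_on_segment 0 (2 * pi) (fun s => poisson r z s * u (polar r s)).
  apply: continuous_on_segmentM => s _; first exact: continuous_poisson.
  apply: continuous_polar_angle.
  by have [] := cuv (polar r s) (polar_in_disc s rr).
have c2 : continuous_on_segment 0 (2 * pi) (poisson r z).
  by move=> s _; exact: continuous_poisson.
have c3 : continuous_on_segment 0 (2 * pi) (fun s => - u z * poisson r z s).
  by apply: continuous_on_segmentM => //; exact: continuous_on_segment_cst.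
rewrite (eq_segint (fun s _ => E0 s)) segintD// segintZ// segint_poisson// in I0.
apply/eqP; rewrite -subr_eq0 -mulNr [- _ * _](_ : _ = - u z * (2 * pi)).
  2: by ring.
apply/eqP; apply: I0 => w wr.
have [q1 q2] := quotient_continuous (cuv w wr).1 (cuv w wr).2 Uz Vz.
have [d1 d2] := CR_on_continuous HL wr.
by split; [apply: cvgB|apply: cvgD]; apply: cvgM.
Qed.

Theorem poisson_formula u v (c : R * R) r z : 0 < r ->
  (forall w, (w.1 - c.1) ^+ 2 + (w.2 - c.2) ^+ 2 <= r ^+ 2 ->
    {for w, continuous u} /\ {for w, continuous v}) ->
  CR_on [set w | (w.1 - c.1) ^+ 2 + (w.2 - c.2) ^+ 2 <= r ^+ 2 /\ w.2 != c.2] u v ->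
  (z.1 - c.1) ^+ 2 + (z.2 - c.2) ^+ 2 < r ^+ 2 -> z.2 != c.2 ->
  segint 0 (2 * pi) (fun s => poisson r (z - c) s * u (c + polar r s)) = 2 * pi * u z.
Proof.
move=> r0 cuv [p [q Huv]] zr z2.
have ct (f : R * R -> R) w : {for c + w, continuous f} ->
    {for w, continuous (fun w => f (c + w))}.
  move=> cf; apply: (@continuous_comp _ _ _ (fun w => c + w) f) => //.
  by apply: cvgD; [exact: cvg_cst|exact: cvg_id].
have gt (f : R * R -> R) a b w : has_gradient f a b (c + w) ->
    has_gradient (fun w => f (c + w)) a b w.
  move=> [df ef].
  have [dl el] : differentiable (fun w => c + w) w /\ forall h, 'd (fun w => c + w) w h = h.
    have dl : is_diff w (cst c + id) (0 + id) by exact: is_diffD.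
    split; first exact: (@ex_diff _ _ _ _ _ _ _ dl).
    move=> h; have -> : (fun w => c + w) = cst c + id by [].
    by rewrite (@diff_val _ _ _ _ _ _ _ dl) fctE/= add0r.
  split; first exact: (differentiable_comp dl).
  by move=> h; rewrite (diff_comp dl)//= el ef.
have := @poisson_formula0 (fun w => u (c + w)) (fun w => v (c + w)) r (z - c) r0.
rewrite /= (_ : c + (z - c) = z); last by rewrite addrC subrK.
apply.
- move=> w wr; have [|cu cv] := cuv (c + w); first by rewrite /= !(addrC c.1, addrC c.2) !addrK.
  by split; exact: ct.
- exists (fun w => p (c + w)), (fun w => q (c + w)) => w [wr w2].
  have [|U V P Q] := Huv (c + w).
    rewrite /= (addrC c.1) (addrC c.2) !addrK; split => //.
    by rewrite -subr_eq0 addrK.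
  by split; [exact: gt|exact: gt|exact: ct|exact: ct].
- exact: zr.
- by rewrite /= subr_eq0.
Qed.

End poisson.

(** * Functions smooth in prescribed directions *)

Lemma is_derive_line (R : realType) (V W : normedModType R) (f : V -> W)
    (x v : V) (y : R) (d : W) :
  is_derive (y *: v + x) v f d <-> is_derive y 1 (fun s : R => f (s *: v + x)) d.
Proof.
have E : (fun h : R => h^-1 *: ((f \o shift (y *: v + x)) (h *: v) - f (y *: v + x))) =
    (fun h => h^-1 *: (((fun s => f (s *: v + x)) \o shift y) (h *: 1) - f (y *: v + x))).
  apply/funext => h /=; congr (_ *: (f _ - _)).
  by rewrite [h *: 1 in RHS]mulr1 scalerDl addrA.
by split=> -[d1 d2]; apply: DeriveDef; move: d1 d2; rewrite /derivable /derive E.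
Qed.

Lemma is_derive_line0 (R : realType) (V W : normedModType R) (f : V -> W)
    (x v : V) (d : W) :
  is_derive x v f d <-> is_derive (0 : R) 1 (fun s : R => f (s *: v + x)) d.
Proof.
by have := is_derive_line f x v 0 d; rewrite scale0r add0r.
Qed.

Lemma line_continuous (R : realType) (V : normedModType R) (x v : V) :
  continuous (fun s : R => s *: v + x).
Proof.
move=> s; apply: cvgD; last exact: cvg_cst.
by apply: cvgZr_tmp; exact: cvg_id.
Qed.

Section smooth.
Variable R : realType.

(* Functions of class C^k in the directions of S, uniformly in a real
   parameter: all iterated directional derivatives are jointly continuous. *)
Fixpoint smooth (V : normedModType R) (k : nat) (S D : set V)
    (g : R -> V -> R) : Prop :=
  (forall t x, D x -> {for (t, x), continuous (fun p : R * V => g p.1 p.2)}) /\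
  if k is k'.+1 then forall v, S v ->
    (forall t x, D x -> derivable (g t) x v) /\
    smooth k' S D (fun t => 'D_v (g t))
  else True.

Variable V : normedModType R.
Implicit Types (k : nat) (S D : set V) (g h : R -> V -> R).

Lemma smooth_continuous k S D g : smooth k S D g -> forall t x, D x ->
  {for (t, x), continuous (fun p : R * V => g p.1 p.2)}.
Proof. by case: k => [|k] []. Qed.

Lemma smooth_continuousr k S D g : smooth k S D g -> forall t x, D x ->
  {for x, continuous (g t)}.
Proof.
move=> sg t x Dx; apply: (@continuous_comp _ _ _ (fun x => (t, x)) (fun p : R * V => g p.1 p.2)).
  exact: pair_cst_continuous.
exact: smooth_continuous sg _ _ Dx.
Qed.

Lemma smooth_continuousl k S D g : smooth k S D g -> forall t x, D x ->
  {for t, continuous (g^~ x)}.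
Proof.
move=> sg t x Dx; apply: (@continuous_comp _ _ _ (fun t => (t, x)) (fun p : R * V => g p.1 p.2)).
  by apply: pair_continuous; [exact: cvg_id|exact: cvg_cst].
exact: smooth_continuous sg _ _ Dx.
Qed.

Lemma smooth_sub k S S' D D' g : S' `<=` S -> D' `<=` D ->
  smooth k S D g -> smooth k S' D' g.
Proof.
move=> SS DD; elim: k g => [|k IH] g /= [cg dg]; split=> //.
- by move=> t x /DD; exact: cg.
- by move=> t x /DD; exact: cg.
- move=> v /SS/dg[d1 d2]; split; last exact: IH.
  by move=> t x /DD; exact: d1.
Qed.

Lemma smoothW k S D g : smooth k.+1 S D g -> smooth k S D g.
Proof.
elim: k g => [|k IH] g; first by case.
move=> [cg dg]; split=> // v Sv; have [d1 d2] := dg v Sv.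
by split=> //; exact: IH.
Qed.

Lemma smooth_leq k k' S D g : (k' <= k)%N -> smooth k S D g -> smooth k' S D g.
Proof.
move=> /subnK <-; elim: (k - k')%N => [//|m IH].
by rewrite addSn => /smoothW.
Qed.

Lemma eq_smooth k S D g h : open D -> (forall t x, D x -> g t x = h t x) ->
  smooth k S D g -> smooth k S D h.
Proof.
move=> oD; elim: k g h => [|k IH] g h gh /= [cg dg].
  split=> // t x Dx; have cgx := cg t x Dx.
  rewrite /prop_for /continuous_at -gh//.
  apply: cvg_trans cgx; apply: near_eq_cvg; near=> p.
  by rewrite gh//; near: p; exact: (cvg_snd (open_nbhs_nbhs (conj oD Dx))).
have near_gh t x : D x -> \forall y \near x, g t y = h t y.
  by move=> Dx; apply: filterS (open_nbhs_nbhs (conj oD Dx)) => y; exact: gh.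
split.
  move=> t x Dx; have cgx := cg t x Dx.
  rewrite /prop_for /continuous_at -gh//.
  apply: cvg_trans cgx; apply: near_eq_cvg; near=> p.
  by rewrite gh//; near: p; exact: (cvg_snd (open_nbhs_nbhs (conj oD Dx))).
move=> v Sv; have [d1 d2] := dg v Sv; split.
  by move=> t x Dx; apply: near_eq_derivable (d1 t x Dx); exact: near_gh.
apply: IH d2 => t x Dx; apply: near_eq_derive; exact: near_gh.
Unshelve. all: end_near. Qed.

Lemma smooth_fct k S D (c : R -> R) : continuous c ->
  smooth k S D (fun t _ => c t).
Proof.
have cc (c' : R -> R) : continuous c' -> forall t x, D x ->
    {for (t, x), continuous (fun p : R * V => c' p.1)}.
  by move=> cc t x _; apply: continuous_comp; [exact: cvg_fst|exact: cc].
elim: k c => [|k IH] c ctc; split=> //=; try exact: cc.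
move=> v _; split; first by move=> t x _; exact: derivable_cst.
rewrite (_ : (fun t => _) = (fun t _ => (fun=> 0) t)); last first.
  by apply/funext => t; apply/funext => x; rewrite derive_cst.
by apply: IH => t; exact: cvg_cst.
Qed.

Lemma smooth_cst k S D (c : R) : smooth k S D (fun _ _ => c).
Proof. by apply: (@smooth_fct k S D (fun=> c)) => t; exact: cvg_cst. Qed.

Lemma smoothD k S D g h : open D -> smooth k S D g -> smooth k S D h ->
  smooth k S D (fun t x => g t x + h t x).
Proof.
move=> oD; elim: k g h => [|k IH] g h [cg dg] [ch dh]; split=> //.
- by move=> t x Dx; apply: cvgD; [exact: cg|exact: ch].
- by move=> t x Dx; apply: cvgD; [exact: cg|exact: ch].
- move=> v Sv; have [d1 d2] := dg v Sv; have [e1 e2] := dh v Sv; split.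
    by move=> t x Dx; apply: derivableD; [exact: d1|exact: e1].
  apply: eq_smooth (IH _ _ d2 e2) => // t x Dx.
  by rewrite -deriveD//; [exact: d1|exact: e1].
Qed.

Lemma smoothM k S D g h : open D -> smooth k S D g -> smooth k S D h ->
  smooth k S D (fun t x => g t x * h t x).
Proof.
move=> oD; elim: k g h => [|k IH] g h sg sh;
  have [cg dg] := sg; have [ch dh] := sh; split=> //.
- by move=> t x Dx; apply: cvgM; [exact: cg|exact: ch].
- by move=> t x Dx; apply: cvgM; [exact: cg|exact: ch].
- move=> v Sv; have [d1 d2] := dg v Sv; have [e1 e2] := dh v Sv; split.
    by move=> t x Dx; apply: derivableM; [exact: d1|exact: e1].
  apply: eq_smooth (smoothD oD (IH _ _ (smoothW sg) e2) (IH _ _ (smoothW sh) d2)) => // t x Dx.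
  by rewrite [RHS]deriveM//; [exact: d1|exact: e1].
Qed.

Lemma smoothN k S D g : open D -> smooth k S D g ->
  smooth k S D (fun t x => - g t x).
Proof.
move=> oD sg; apply: eq_smooth (smoothM oD (smooth_cst k S D (-1)) sg) => // t x _.
by rewrite mulN1r.
Qed.

Lemma smoothB k S D g h : open D -> smooth k S D g -> smooth k S D h ->
  smooth k S D (fun t x => g t x - h t x).
Proof. by move=> oD sg sh; apply: smoothD => //; exact: smoothN. Qed.

Lemma smoothX k S D g m : open D -> smooth k S D g ->
  smooth k S D (fun t x => g t x ^+ m).
Proof.
move=> oD sg; elim: m => [|m IH]; first exact: smooth_cst.
by apply: eq_smooth (smoothM oD sg IH) => // t x _; rewrite exprS.
Qed.

Lemma smooth_sum k S D m (g : 'I_m -> R -> V -> R) : open D ->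
  (forall i, smooth k S D (g i)) -> smooth k S D (fun t x => \sum_(i < m) g i t x).
Proof.
move=> oD; elim: m g => [|m IH] g sg.
  by apply: eq_smooth (smooth_cst k S D 0) => // t x _; rewrite big_ord0.
apply: eq_smooth (smoothD oD (IH (fun i => g (widen_ord (leqnSn m) i)) _) (sg ord_max)) => // t x _.
by rewrite big_ord_recr.
Qed.

Lemma smoothV k S D g : open D -> (forall t x, D x -> g t x != 0) ->
  smooth k S D g -> smooth k S D (fun t x => (g t x)^-1).
Proof.
move=> oD g0; elim: k g g0 => [|k IH] g g0 sg; have [cg dg] := sg; split=> //.
- by move=> t x Dx; apply: cvgV; [exact: g0|exact: cg].
- by move=> t x Dx; apply: cvgV; [exact: g0|exact: cg].
- move=> v Sv; have [d1 d2] := dg v Sv; split.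
    by move=> t x Dx; apply: derivableV; [exact: g0|exact: d1].
  have sV := IH g g0 (smoothW sg).
  apply: eq_smooth (smoothN oD (smoothM oD (smoothM oD sV sV) d2)) => // t x Dx.
  rewrite deriveV ?g0//; last exact: d1.
  by rewrite /GRing.scale/= mulNr expr2 invfM.
Qed.

Lemma smooth_sqrt k S D g : open D -> (forall t x, D x -> 0 < g t x) ->
  smooth k S D g -> smooth k S D (fun t x => Num.sqrt (g t x)).
Proof.
move=> oD g0; elim: k g g0 => [|k IH] g g0 sg; have [cg dg] := sg; split=> //.
- by move=> t x Dx; apply: continuous_comp; [exact: cg|exact: sqrt_continuous].
- by move=> t x Dx; apply: continuous_comp; [exact: cg|exact: sqrt_continuous].
- move=> v Sv; have [d1 d2] := dg v Sv.
  have dS t x : D x ->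
      is_derive x v (fun x => Num.sqrt (g t x)) ('D_v (g t) x * (2 * Num.sqrt (g t x))^-1).
    move=> Dx.
    have /is_derive_line0 dg0 : is_derive x v (g t) ('D_v (g t) x).
      by apply: DeriveDef => //; exact: d1.
    apply/is_derive_line0.
    have dS : is_derive (g t (0 *: v + x)) 1 Num.sqrt (2 * Num.sqrt (g t x))^-1.
      by rewrite scale0r add0r; apply: is_derive1_sqrt; exact: g0.
    by apply: is_derive_eq (is_derive1_comp dS dg0) _; rewrite mulrC.
  split; first by move=> t x Dx; apply: ex_derive; exact: dS.
  have s2 : smooth k S D (fun t x => (2 * Num.sqrt (g t x))^-1).
    apply: smoothV => // [t x Dx|]; first by rewrite mulf_neq0 ?sqrtr_eq0 -?ltNge ?g0.
    by apply: smoothM; [by []|exact: smooth_cst|exact: IH (smoothW sg)].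
  apply: eq_smooth (smoothM oD d2 s2) => // t x Dx.
  by rewrite (@derive_val _ _ _ _ _ _ _ (dS t x Dx)).
Qed.

(** The parameter of [smooth] is the integration variable: its joint continuity with [x] lets each
    directional derivative pass under the integral. Restriction to the lines [s *: v + x] reduces
    this to one real variable. *)
Lemma smooth_segint k S D g a b : a <= b -> open D -> smooth k S D g ->
  smooth k S D (fun _ x => segint a b (g^~ x)).
Proof.
move=> ab oD; elim: k g => [|k IH] g sg; have [cg dg] := sg;
  have cont t x : D x -> {for (t, x), continuous (fun p : R * V => segint a b (g^~ p.2))}.
- move=> Dx; apply: (@continuous_comp _ _ _ (@snd R V) (fun x => segint a b (g^~ x))).
    exact: cvg_snd.
  apply: (@segint_param_continuous R V a b (fun x t => g t x)) => //.
    apply: filterS (open_nbhs_nbhs (conj oD Dx)) => y Dy s _.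
    exact: (smooth_continuousl sg).
  move=> s _; apply: (@continuous_comp _ _ _ (fun p : V * R => (p.2, p.1))
    (fun p : R * V => g p.1 p.2)); last exact: cg.
  by apply: pair_continuous; [exact: cvg_snd|exact: cvg_fst].
- by split=> // t x; exact: cont.
- move=> Dx; apply: (@continuous_comp _ _ _ (@snd R V) (fun x => segint a b (g^~ x))).
    exact: cvg_snd.
  apply: (@segint_param_continuous R V a b (fun x t => g t x)) => //.
    apply: filterS (open_nbhs_nbhs (conj oD Dx)) => y Dy s _.
    exact: (smooth_continuousl sg).
  move=> s _; apply: (@continuous_comp _ _ _ (fun p : V * R => (p.2, p.1))
    (fun p : R * V => g p.1 p.2)); last exact: cg.
  by apply: pair_continuous; [exact: cvg_snd|exact: cvg_fst].
split=> // v Sv; have [d1 d2] := dg v Sv.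
have dI x : D x -> is_derive x v (fun x => segint a b (g^~ x)) (segint a b (fun t => 'D_v (g t) x)).
  move=> Dx; apply/is_derive_line0.
  have [d /= d0 dD] : \forall s \near (0 : R), D (s *: v + x).
    have : {for 0, continuous (fun s : R => s *: v + x)} by exact: line_continuous.
    by apply; rewrite scale0r add0r; exact: open_nbhs_nbhs.
  have dD' (y : R) : `|y - 0| < d -> D (y *: v + x).
    by rewrite subr0 => yd; apply: dD; rewrite /= sub0r normrN.
  have := @segint_param_is_derive R a b (fun s t => g t (s *: v + x))
    (fun s t => 'D_v (g t) (s *: v + x)) 0 d ab d0.
  rewrite scale0r add0r => /= H; apply: H.
  - move=> y t yd _; apply/(@is_derive_line _ _ _ (g t) x v y).
    by apply: DeriveDef; [apply: d1; exact: dD'|by []].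
  - move=> y yd t _; have Dy := dD' y yd.
    exact: (smooth_continuousl sg).
  - move=> t _; have D0 : D (0 *: v + x) by rewrite scale0r add0r.
    have c1 : {for (0, t), continuous (fun p : R * R => (p.2, p.1 *: v + x))}.
      apply: (@pair_continuous _ _ _ snd (fun p : R * R => p.1 *: v + x)).
        exact: cvg_snd.
      apply: (@continuous_comp _ _ _ fst (fun s : R => s *: v + x)).
        exact: cvg_fst.
      exact: line_continuous.
    apply: (@continuous_comp _ _ _ (fun p : R * R => (p.2, p.1 *: v + x))
      (fun p : R * V => 'D_v (g p.1) p.2) (0, t) c1).
    exact: (smooth_continuous d2 D0).
split; first by move=> _ x Dx; apply: ex_derive; exact: dI.
apply: eq_smooth (IH _ d2) => // _ x Dx.
by rewrite (@derive_val _ _ _ _ _ _ _ (dI x Dx)).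
Qed.

End smooth.

Section smooth_comp.
Variables (R : realType) (V W : normedModType R).

(** [T t] is affine along the directions of [S], with a linear part [P] independent of [t]. Hence
    the derivative of [g t (T t x)] along [v] is that of [g t] along [P v], taken at [T t x], and it
    is zero for directions killed by [P]. In [t], joint continuity is enough, which admits
    substitution of a curve for a coordinate. *)
Lemma smooth_comp k (S D : set V) (S' D' : set W) (T : R -> V -> W) (P : V -> W)
    (g : R -> W -> R) : open D ->
  (forall t x, D x -> {for (t, x), continuous (fun p : R * V => T p.1 p.2)}) ->
  (forall t x v (h : R), S v -> T t (h *: v + x) = h *: P v + T t x) ->
  (forall v, S v -> P v = 0 \/ S' (P v)) ->
  (forall t x, D x -> D' (T t x)) ->
  smooth k S' D' g -> smooth k S D (fun t x => g t (T t x)).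
Proof.
move=> oD cT lT SP DT.
elim: k g => [|k IH] g sg; have [cg dg] := sg.
  split=> // t x Dx.
  apply: (@continuous_comp _ _ _ (fun p : R * V => (p.1, T p.1 p.2)) (fun p : R * W => g p.1 p.2)).
    by apply: pair_continuous; [exact: cvg_fst|exact: cT].
  by apply: cg; exact: DT.
split.
  move=> t x Dx.
  apply: (@continuous_comp _ _ _ (fun p : R * V => (p.1, T p.1 p.2)) (fun p : R * W => g p.1 p.2)).
    by apply: pair_continuous; [exact: cvg_fst|exact: cT].
  by apply: cg; exact: DT.
move=> v Sv.
have [P0|SPv] := SP v Sv.
  have dI t x : is_derive x v (fun x => g t (T t x)) 0.
    apply/is_derive_line0; rewrite [X in is_derive _ _ X](_ : _ = fun=> g t (T t x)).
      exact: is_derive_cst.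
    by apply/funext => h; rewrite lT// P0 scaler0 add0r.
  split; first by move=> t x _; apply: ex_derive; exact: dI.
  apply: eq_smooth (smooth_cst k S D 0) => // t x _.
  by rewrite (@derive_val _ _ _ _ _ _ _ (dI t x)).
have [d1 d2] := dg _ SPv.
have dI t x : D x -> is_derive x v (fun x => g t (T t x)) ('D_(P v) (g t) (T t x)).
  move=> Dx; apply/is_derive_line0.
  have /is_derive_line0 : is_derive (T t x) (P v) (g t) ('D_(P v) (g t) (T t x)).
    by apply: DeriveDef => //; apply: d1; exact: DT.
  rewrite (_ : (fun s => g t (s *: P v + T t x)) = fun h => g t (T t (h *: v + x)))//.
  by apply/funext => h; rewrite lT.
split; first by move=> t x Dx; apply: ex_derive; exact: dI.
apply: eq_smooth (IH _ d2) => // t x Dx.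
by rewrite (@derive_val _ _ _ _ _ _ _ (dI t x Dx)).
Qed.

End smooth_comp.

Lemma sum_continuous (R : realType) (T : topologicalType) (V : normedModType R)
    (I : finType) (F : I -> T -> V) (x : T) :
  (forall i, {for x, continuous (F i)}) ->
  {for x, continuous (fun y => \sum_i F i y)}.
Proof.
move=> cF; rewrite (_ : (fun y => _) = \sum_i F i); last first.
  by apply/funext => y; rewrite fct_sumE.
elim/big_ind: _ => [|g h cg ch|i _]; last exact: cF.
- exact: cvg_cst.
- exact: cvgD.
Qed.

(** * Continuous partial derivatives imply differentiability *)

Section matrix_differentiable.
Variables (R : realType) (m n : nat).
Implicit Types (x h : 'M[R]_(m, n)) (f : 'M[R]_(m, n) -> R).

Lemma mx_norm_leP x (e : R) : 0 <= e -> `|x| <= e <-> forall i j, `|x i j| <= e.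
Proof.
move=> e0; have -> : `|x| = \big[Num.max/0]_ij `|x ij.1 ij.2| := mx_normrE x.
split=> [xe i j|xe]; last by apply: bigmax_le => // ij _; exact: xe.
by apply: le_trans xe; exact: (@le_bigmax _ _ _ _ (fun ij => `|x ij.1 ij.2|) (i, j)).
Qed.

Lemma mx_entry_le x i j : `|x i j| <= `|x|.
Proof. by have /mx_norm_leP := lexx `|x|; apply. Qed.

Lemma near_segment_MVT (g g' : R -> R) (b d e : R) :
  (forall t : R, `|t| <= `|b| -> is_derive t 1 g (g' t)) ->
  (forall t, `|t| <= `|b| -> `|g' t - d| <= e) ->
  `|g b - g 0 - b * d| <= e * `|b|.
Proof.
move=> dg g'd.
have cg t : `|t| <= `|b| -> {for t, continuous g}.
  by move=> /dg ?; apply: differentiable_continuous; exact/derivable1_diffP.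
have [b0|b0] := leP 0 b.
- have dg' t : t \in `]0, b[%R -> is_derive t 1 g (g' t).
    rewrite in_itv/= => /andP[t0 tb]; apply: dg.
    by rewrite !ger0_norm// ltW.
  have cg' : {within `[0, b], continuous g}.
    apply/continuous_in_subspaceT => t /set_mem/=; rewrite in_itv/= => /andP[t0 tb].
    by apply: cg; rewrite !ger0_norm.
  have [t + ->] := MVT_segment b0 dg' cg'.
  rewrite in_itv/= => /andP[t0 tb]; rewrite subr0 mulrC -mulrBr normrM mulrC.
  by rewrite ler_wpM2r//; apply: g'd; rewrite !ger0_norm.
- have dg' t : t \in `]b, 0[%R -> is_derive t 1 g (g' t).
    rewrite in_itv/= => /andP[t0 tb]; apply: dg.
    by rewrite !ltr0_norm// lerN2 ltW.
  have cg' : {within `[b, 0], continuous g}.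
    apply/continuous_in_subspaceT => t /set_mem/=; rewrite in_itv/= => /andP[t0 tb].
    by apply: cg; rewrite !ler0_norm ?lerN2// ltW.
  have [t + e'] := MVT_segment (ltW b0) dg' cg'.
  rewrite in_itv/= => /andP[t0 tb].
  rewrite (_ : g b - g 0 = g' t * b); last by rewrite -opprB e'; ring.
  rewrite mulrC -mulrBr normrM mulrC.
  by rewrite ler_wpM2r//; apply: g'd; rewrite !ler0_norm ?lerN2// ltW.
Qed.

Definition mx_proj (s : seq ('I_m * 'I_n)) h : 'M[R]_(m, n) :=
  \matrix_(i, j) (if (i, j) \in s then h i j else 0).

(** The increment is built one entry at a time, [mx_proj s h] being [h] cut down to the entries in
    [s]. The mean value theorem controls each new entry by the continuity at [x] of its partial
    derivative. *)
Lemma continuous_partials_differentiable (D : set 'M[R]_(m, n)) f x :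
  open D -> D x ->
  (forall i j y, D y -> derivable f y (delta_mx i j)) ->
  (forall i j, {for x, continuous ('D_(delta_mx i j) f)}) ->
  differentiable f x /\
  forall h, 'd f x h = \sum_i \sum_j h i j * 'D_(delta_mx i j) f x.
Proof.
move=> oD Dx df cf.
pose d ij := 'D_(delta_mx ij.1 ij.2) f x : R.
have step (s : seq ('I_m * 'I_n)) : uniq s -> forall e, 0 < e ->
    \forall h \near (0 : 'M[R]_(m, n)),
    `|f (mx_proj s h + x) - f x - \sum_(ij <- s) h ij.1 ij.2 * d ij| <= e * `|h|.
  elim: s => [|[i j] s IH] /= => [_ e e0|/andP[ijs us] e e0].
    near=> h; rewrite big_nil (_ : mx_proj [::] h = 0) ?add0r ?subrr ?subr0 ?normr0.
      by rewrite mulr_ge0// ltW.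
    by apply/matrixP => i j; rewrite !mxE.
  have e2 : 0 < e / 2 by rewrite divr_gt0.
  have : \forall y \near x, D y /\ `|'D_(delta_mx i j) f y - d (i, j)| <= e / 2.
    have /cvgrPdist_le/(_ _ e2) := cf i j.
    apply: filterS2 (open_nbhs_nbhs (conj oD Dx)) => y Dy.
    by rewrite distrC.
  move=> /nbhs_ballP[r /= r0 rP].
  near=> h.
  have hr : `|h| < r.
    by near: h; apply/nbhs_ballP; exists r => //= y; rewrite -ball_normE/= sub0r normrN.
  (* In the sup norm every intermediate point stays within [|h|] of [x]. *)
  have Pn (t : R) : `|t| <= `|h i j| -> `|t *: delta_mx i j + mx_proj s h| <= `|h|.
    move=> th; apply/mx_norm_leP => // i' j'; rewrite !mxE.
    have [/andP[/eqP -> /eqP ->]|] := boolP ((i' == i) && (j' == j)).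
      by rewrite (negPf ijs) mulr1 addr0 (le_trans th)// mx_entry_le.
    by rewrite mulr0 add0r; case: ifP => _ _; rewrite ?normr0// mx_entry_le.
  have inD (t : R) : `|t| <= `|h i j| -> D (t *: delta_mx i j + (mx_proj s h + x)) /\
      `|'D_(delta_mx i j) f (t *: delta_mx i j + (mx_proj s h + x)) - d (i, j)| <= e / 2.
    move=> /Pn th; apply: rP; rewrite -ball_normE/= addrA distrC addrK.
    exact: le_lt_trans hr.
  have := @near_segment_MVT (fun t => f (t *: delta_mx i j + (mx_proj s h + x)))
    (fun t => 'D_(delta_mx i j) f (t *: delta_mx i j + (mx_proj s h + x)))
    (h i j) (d (i, j)) (e / 2).
  move=> /(_ _ (fun t th => (inD t th).2)) H1.
  have {}H1 := H1 (fun t th => (is_derive_line _ _ _ _ _).1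
    (DeriveDef (df _ _ _ (inD t th).1) erefl)).
  have H2 : `|f (mx_proj s h + x) - f x - \sum_(ij <- s) h ij.1 ij.2 * d ij| <= e / 2 * `|h|.
    by near: h; exact: IH.
  have -> : mx_proj ((i, j) :: s) h = h i j *: delta_mx i j + mx_proj s h.
    apply/matrixP => i' j'; rewrite !mxE inE xpair_eqE.
    have [/andP[/eqP -> /eqP ->]|] := boolP ((i' == i) && (j' == j)).
      by rewrite (negPf ijs) mulr1 addr0.
    by rewrite mulr0 add0r.
  rewrite big_cons /= -[h i j *: _ + _ + x]addrA.
  rewrite /= scale0r add0r in H1.
  set a := f (_ + (_ + x)) in H1 *; set b := f (_ + x) in H1 H2 *.
  rewrite (_ : a - f x - _ = (a - b - h i j * d (i, j)) +
    (b - f x - \sum_(ij <- s) h ij.1 ij.2 * d ij)); last by ring.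
  apply: le_trans (ler_normD _ _) _; rewrite [e]splitr mulrDl lerD//.
  by apply: le_trans H1 _; rewrite ler_wpM2l ?mx_entry_le// ltW.
pose l h : R := \sum_i \sum_j h i j * 'D_(delta_mx i j) f x.
have linl : linear l.
  move=> a u v; rewrite /l scaler_sumr -big_split/=; apply: eq_bigr => i _.
  rewrite scaler_sumr -big_split/=; apply: eq_bigr => j _.
  by rewrite !mxE mulrDl -mulrA.
pose L : {linear 'M[R]_(m, n) -> R} := HB.pack l (GRing.isLinear.Build _ _ _ _ l linl).
apply: (differentiable_epsP (l := L)) => [h|e e0].
  apply: sum_continuous => i; apply: sum_continuous => j.
  apply: (@cvgM R _ (nbhs h) _ (fun k : 'M[R]_(m, n) => k i j) (fun=> 'D_(delta_mx i j) f x)).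
    exact: coord_continuous.
  exact: cvg_cst.
have us : uniq (enum {: 'I_m * 'I_n}) by exact: enum_uniq.
apply: filterS (step _ us e e0) => h.
rewrite (_ : mx_proj _ h = h); last first.
  by apply/matrixP => i j; rewrite !mxE mem_enum.
by rewrite /= /l pair_bigA/= big_enum.
Unshelve. all: end_near. Qed.

End matrix_differentiable.

(** * The operators on quaternionic functions *)

Section quaternion_algebra.
Variable R : realType.
Implicit Types (x y z d : quat R) (a b : R).

Lemma quat_oppE x l : (- x) 0 l = - x 0 l. Proof. exact: mxE. Qed.
Lemma quat_0E l : (0 : quat R) 0 l = 0. Proof. exact: mxE. Qed.
Lemma quat_mulE x y : x * y = quat_mul x y. Proof. by []. Qed.

Definition quatE := (quat_mulE, quat_1E, mkquatE, quat_addE, quat_oppE,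
  quat_scaleE, quat_0E).

Lemma qIm0 x : qIm x 0 0 = 0.
Proof. by rewrite /qIm /qconj !quatE subrr mulr0. Qed.
Lemma qIm1 x : qIm x 0 1 = x 0 1.
Proof. by rewrite /qIm /qconj !quatE; lra. Qed.
Lemma qIm2 x : qIm x 0 2 = x 0 2.
Proof. by rewrite /qIm /qconj !quatE; lra. Qed.
Lemma qIm3 x : qIm x 0 3 = x 0 3.
Proof. by rewrite /qIm /qconj !quatE; lra. Qed.
Definition qImE := (qIm0, qIm1, qIm2, qIm3).

Lemma quat_unitE x : (x \is a GRing.unit) = (x != 0).
Proof. by []. Qed.

Lemma quat_mul2 x : 2 * x = 2 *: x.
Proof. by rewrite mulr_natl scaler_nat. Qed.

Lemma quat_inv_scale a x : a != 0 -> (a *: x)^-1 = a^-1 *: x^-1.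
Proof.
move=> a0; have [->|x0] := eqVneq x 0.
  by rewrite scaler0 invr0 scaler0.
have ax0 : a *: x != 0 by rewrite scaler_eq0 negb_or a0.
apply: (mulrI (x := a *: x)); first by rewrite quat_unitE.
have ux : x \is a GRing.unit by rewrite quat_unitE.
have uax : a *: x \is a GRing.unit by rewrite quat_unitE.
by rewrite divrr// -scalerAl -scalerAr scalerA divff// scale1r divrr.
Qed.

Lemma quat_inv2 x : (2 * x)^-1 = 2^-1 *: x^-1.
Proof. by rewrite quat_mul2 quat_inv_scale ?pnatr_eq0. Qed.

Lemma mkquatD (a b c d a' b' c' d' : R) : mkquat a b c d + mkquat a' b' c' d' =
  mkquat (a + a') (b + b') (c + c') (d + d').
Proof. by apply: quatP; rewrite !quatE. Qed.

Lemma mkquatN (a b c d : R) : - mkquat a b c d = mkquat (- a) (- b) (- c) (- d).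
Proof. by apply: quatP; rewrite !quatE. Qed.

Lemma mkquatZ (k a b c d : R) : k *: mkquat a b c d = mkquat (k * a) (k * b) (k * c) (k * d).
Proof. by apply: quatP; rewrite !quatE. Qed.

Lemma mkquatM (a b c d a' b' c' d' : R) : mkquat a b c d * mkquat a' b' c' d' =
  mkquat (a * a' - b * b' - c * c' - d * d') (a * b' + b * a' + c * d' - d * c')
    (a * c' - b * d' + c * a' + d * b') (a * d' + b * c' - c * b' + d * a').
Proof. by apply: quatP; rewrite !quatE. Qed.

Lemma qIm_mkquat (a b c d : R) : qIm (mkquat a b c d) = mkquat 0 b c d.
Proof. by apply: quatP; rewrite !(qImE, quatE). Qed.

Lemma qconj_mkquat (a b c d : R) : qconj (mkquat a b c d) = mkquat a (- b) (- c) (- d).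
Proof. by rewrite /qconj !mkquatE. Qed.

Lemma quatW (P : quat R -> Prop) : (forall a b c e : R, P (mkquat a b c e)) -> forall x, P x.
Proof.
move=> H x; rewrite (_ : x = mkquat (x 0 0) (x 0 1) (x 0 2) (x 0 3))//.
by apply: quatP; rewrite mkquatE.
Qed.

Definition mkquatDE := (mkquatD, mkquatN, mkquatZ, mkquatM, qIm_mkquat, qconj_mkquat).

(** The Fueter operator as [vartheta_bar] minus the Gamma-step, at one point, with [d0], ..., [d3]
    standing for the partial derivatives. Multiplication by [Im x] clears the inverses and leaves a
    polynomial identity in the components. *)
Lemma CRF_algebra x d0 d1 d2 d3 : qIm x != 0 ->
  2^-1 *: (d0 + qi * d1 + qj * d2 + qk * d3) =
  2^-1 *: (d0 - (qIm x)^-1 * (x 0 1 *: d1 + x 0 2 *: d2 + x 0 3 *: d3)) -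
  (2 * qIm x)^-1 * (- qi * (x 0 2 *: d3 - x 0 3 *: d2) +
    qj * (x 0 1 *: d3 - x 0 3 *: d1) - qk * (x 0 1 *: d2 - x 0 2 *: d1)).
Proof.
move=> y0; rewrite quat_inv2 -[(_ *: _^-1) * _]scalerAl -scalerBr.
congr (_ *: _); apply: (mulrI (x := qIm x)); first by rewrite quat_unitE.
rewrite !mulrBr !mulVKr ?quat_unitE//; move: {y0} x d0 d1 d2 d3.
do 5 elim/quatW => ? ? ? ?.
by rewrite /qi /qj /qk !mkquatE !mkquatDE !mkquatE; congr mkquat; ring.
Qed.

(** The terms such as [qi * g + x * d1] are the partial derivatives of [x g]. Since
    [x_1 i + x_2 j + x_3 k = Im x], the terms in [g] cancel; as [x] commutes with [Im x], it moves
    to the front. So [vartheta_bar] commutes with left multiplication by [x]. *)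
Lemma vartheta_algebra x g d0 d1 d2 d3 : qIm x != 0 ->
  2^-1 *: (g + x * d0 - (qIm x)^-1 * (x 0 1 *: (qi * g + x * d1) +
    x 0 2 *: (qj * g + x * d2) + x 0 3 *: (qk * g + x * d3))) =
  x * (2^-1 *: (d0 - (qIm x)^-1 * (x 0 1 *: d1 + x 0 2 *: d2 + x 0 3 *: d3))).
Proof.
move=> y0; rewrite -[x * (_ *: _)]scalerAr; congr (_ *: _).
apply: (mulrI (x := qIm x)); first by rewrite quat_unitE.
have yx z : qIm x * (x * z) = x * (qIm x * z).
  rewrite !mulrA; congr (_ * _); move: {y0 d0 d1 d2 d3} x.
  by elim/quatW => ? ? ? ?; rewrite !mkquatDE; congr mkquat; ring.
rewrite !mulrBr [in RHS]yx [qIm x * (x * ((qIm x)^-1 * _))]yx !mulVKr ?quat_unitE//.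
move: {y0 yx} x g d0 d1 d2 d3; do 6 elim/quatW => ? ? ? ?.
by rewrite /qi /qj /qk !mkquatE !mkquatDE ?mkquatE; congr mkquat; ring.
Qed.

(** Leibniz rule for the Gamma-step applied to [x g]. It makes [g] recoverable from two Gamma-steps,
    as that of [x g] minus [conj x] times that of [g]. *)
Lemma Gamma_algebra x g d1 d2 d3 : qIm x != 0 ->
  let G e1 e2 e3 := (2 * qIm x)^-1 * (- qi * (x 0 2 *: e3 - x 0 3 *: e2) +
    qj * (x 0 1 *: e3 - x 0 3 *: e1) - qk * (x 0 1 *: e2 - x 0 2 *: e1)) in
  G (qi * g + x * d1) (qj * g + x * d2) (qk * g + x * d3) =
  g + qconj x * G d1 d2 d3.
Proof.
move=> y0 G; rewrite /G quat_inv2 -![(_ *: (qIm x)^-1) * _]scalerAl -[qconj x * (_ *: _)]scalerAr.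
apply: (scalerI (a := 2)); first by rewrite pnatr_eq0.
rewrite [in RHS]scalerDr !scalerA divff ?pnatr_eq0// !scale1r.
apply: (mulrI (x := qIm x)); first by rewrite quat_unitE.
have yx z : qIm x * (qconj x * z) = qconj x * (qIm x * z).
  rewrite !mulrA; congr (_ * _); move: {y0 d1 d2 d3 G} x.
  by elim/quatW => ? ? ? ?; rewrite !mkquatDE; congr mkquat; ring.
rewrite [in RHS]mulrDr yx !mulVKr ?quat_unitE//.
move: {y0 yx G} x g d1 d2 d3; do 5 elim/quatW => ? ? ? ?.
by rewrite /qi /qj /qk !mkquatE !mkquatDE ?mkquatE; congr mkquat; ring.
Qed.

Lemma qIm_eq0 x : (qIm x == 0) = [&& x 0 1 == 0, x 0 2 == 0 & x 0 3 == 0].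
Proof.
apply/eqP/and3P => [/rowP h|[/eqP h1 /eqP h2 /eqP h3]].
  by split; apply/eqP; [rewrite -qIm1|rewrite -qIm2|rewrite -qIm3]; rewrite h mxE.
by apply: quatP; rewrite !(qImE, quat_0E).
Qed.

Lemma realA a : (a%:A : quat R) = mkquat a 0 0 0.
Proof. by apply: quatP; rewrite !quatE ?mulr1 ?mulr0. Qed.

Lemma qIm_realP x : qIm x = 0 <-> exists a, x = a%:A.
Proof.
split=> [/eqP|[a ->]].
  rewrite qIm_eq0 => /and3P[/eqP h1 /eqP h2 /eqP h3]; exists (x 0 0).
  by rewrite realA; apply: quatP; rewrite !mkquatE.
by apply: quatP; rewrite !(qImE, realA, quatE).
Qed.

End quaternion_algebra.

Lemma ord4_ind (P : 'I_4 -> Prop) : P 0 -> P 1 -> P 2 -> P 3 -> forall l, P l.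
Proof.
move=> p0 p1 p2 p3 [[|[|[|[|l]]]] hl] //.
- by rewrite (_ : Ordinal hl = 0)//; exact/val_inj.
- by rewrite (_ : Ordinal hl = 1)//; exact/val_inj.
- by rewrite (_ : Ordinal hl = 2)//; exact/val_inj.
- by rewrite (_ : Ordinal hl = 3)//; exact/val_inj.
Qed.

Section quaternion_derivative.
Variables (R : realType) (V : normedModType R).
Implicit Types (f g : V -> quat R) (x v : V).

Lemma is_derive_quatP f x v (d : quat R) :
  is_derive x v f d <-> forall l, is_derive x v (fun z => f z 0 l) (d 0 l).
Proof.
split=> [df l|df].
  have /derivable_mxP dm : derivable f x v by exact: ex_derive.
  apply: DeriveDef; first exact: dm.
  have <- : 'D_v f x = d by exact: derive_val.
  by rewrite (@derive_mx R V 1 4 f x v) ?mxE//; exact/derivable_mxP.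
have dm : derivable f x v.
  apply/(@derivable_mxP R V 1 4) => i l; rewrite (ord1 i); apply: ex_derive; exact: df.
apply: DeriveDef => //; rewrite (@derive_mx R V 1 4 f x v)//.
apply/rowP => l; rewrite mxE; exact: derive_val.
Qed.

Lemma quat_continuousP (T : topologicalType) (f : T -> quat R) (x : T) :
  {for x, continuous f} <-> forall l, {for x, continuous (fun z => f z 0 l)}.
Proof.
split=> [cf l|cf].
  apply: (@continuous_comp _ _ _ f (fun y : quat R => y 0 l)) => //.
  exact: (@coord_continuous R 1 4 0 l).
have E : f = fun z => \sum_(l < 4) f z 0 l *: (delta_mx 0 l : quat R).
  apply/funext => z; rewrite [LHS](@row_sum_delta R 4).
  by apply: eq_bigr.
rewrite E; apply: (@sum_continuous R T (quat R)) => l.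
apply: (@cvgZr_tmp R (quat R) _ (nbhs x) _ (fun z => f z 0 l)); exact: cf.
Qed.

Lemma is_derive_quatM f g x v (df dg : quat R) :
  is_derive x v f df -> is_derive x v g dg ->
  is_derive x v (fun z => f z * g z) (df * g x + f x * dg).
Proof.
move=> /is_derive_quatP hf /is_derive_quatP hg; apply/is_derive_quatP.
have M l l' : is_derive x v (fun z => f z 0 l * g z 0 l')
    (df 0 l * g x 0 l' + f x 0 l * dg 0 l').
  apply: is_derive_eq (is_deriveM (hf l) (hg l')) _.
  by rewrite /GRing.scale /= addrC [g x _ _ * _]mulrC.
have E l : (fun z => (f z * g z) 0 l) = (fun z => quat_mul (f z) (g z) 0 l) by [].
apply: ord4_ind; rewrite E; under eq_fun do rewrite mkquatE.
- apply: is_derive_eq (is_deriveB (is_deriveB (is_deriveB (M _ _) (M _ _)) (M _ _)) (M _ _)) _.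
  by rewrite quat_addE !quat_mulE !mkquatE; ring.
- apply: is_derive_eq (is_deriveB (is_deriveD (is_deriveD (M _ _) (M _ _)) (M _ _)) (M _ _)) _.
  by rewrite quat_addE !quat_mulE !mkquatE; ring.
- apply: is_derive_eq (is_deriveD (is_deriveD (is_deriveB (M _ _) (M _ _)) (M _ _)) (M _ _)) _.
  by rewrite quat_addE !quat_mulE !mkquatE; ring.
- apply: is_derive_eq (is_deriveD (is_deriveB (is_deriveD (M _ _) (M _ _)) (M _ _)) (M _ _)) _.
  by rewrite quat_addE !quat_mulE !mkquatE; ring.
Qed.

End quaternion_derivative.

Section quaternion_smooth.
Variables (R : realType) (n : nat).
Implicit Types (f g : 'M[R]_(n, 4) -> quat R) (x : 'M[R]_(n, 4))
  (D : set 'M[R]_(n, 4)) (i : 'I_n) (c l : 'I_4).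

Definition coord_dirs (S : set 'I_n) : set 'M[R]_(n, 4) :=
  [set v | exists2 i, S i & exists c, v = delta_mx i c].

Definition qsmooth k D f :=
  forall l, smooth k (coord_dirs setT) D (fun _ x => f x 0 l).

Lemma qsmooth_continuous k D f : qsmooth k D f ->
  forall x, D x -> {for x, continuous f}.
Proof.
move=> sf x Dx; apply/quat_continuousP => l.
exact: (smooth_continuousr (sf l) (t := 0)).
Qed.

Lemma qsmooth_is_derive k D f : qsmooth k.+1 D f -> forall x i c, D x ->
  is_derive x (delta_mx i c) f (pderiv i c f x).
Proof.
move=> sf x i c Dx; apply: DeriveDef => //.
apply/(@derivable_mxP R _ 1 4) => j l; rewrite (ord1 j).
have [_ /(_ (delta_mx i c)) []] := sf l; first by exists i => //; exists c.
by move=> /(_ 0 x Dx).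
Qed.

Lemma pderivE f i c x l : derivable f x (delta_mx i c) ->
  pderiv i c f x 0 l = 'D_(delta_mx i c) (fun z => f z 0 l) x.
Proof.
by move=> df; rewrite /pderiv (@derive_mx R _ 1 4)// mxE.
Qed.

Lemma pderiv_val f i c x (d : quat R) : is_derive x (delta_mx i c) f d ->
  pderiv i c f x = d.
Proof. by move=> df; exact: (@derive_val _ _ _ _ _ _ _ df). Qed.

Lemma qsmooth_pderiv k D f i c : open D -> qsmooth k.+1 D f ->
  qsmooth k D (pderiv i c f).
Proof.
move=> oD sf l; have [_ /(_ (delta_mx i c)) []] := sf l.
  by exists i => //; exists c.
move=> _; apply: eq_smooth => // _ x Dx; apply/esym/pderivE.
by apply: ex_derive; exact: (qsmooth_is_derive sf).
Qed.

Lemma qsmoothW k k' D D' f : (k' <= k)%N -> D' `<=` D -> qsmooth k D f ->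
  qsmooth k' D' f.
Proof.
move=> kk DD sf l; apply: (@smooth_sub _ _ _ (coord_dirs setT) _ D) => //.
exact: smooth_leq (sf l).
Qed.

(** [Ck] iterates derivatives of quaternion-valued functions, [smooth] those of real functions with
    a parameter, here a dummy one. Through this equivalence the closure properties of [smooth] serve
    for [Ck]. *)
Lemma Ck_qsmoothP k D f : open D -> Ck k D f <-> qsmooth k D f.
Proof.
have cp (h : 'M[R]_(n, 4) -> quat R) (t : R) x l : {for x, continuous h} ->
    {for (t, x), continuous (fun q : R * 'M[R]_(n, 4) => h q.2 0 l)}.
  move=> ch; apply: (@continuous_comp _ _ _ (fun q : R * 'M[R]_(n, 4) => q.2) (fun x => h x 0 l)).
    exact: cvg_snd.
  by have /quat_continuousP := ch; exact.
move=> oD; split.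
  elim: k f => [|k IH] f [cf df] l.
    by split=> // t x Dx; apply: cp; exact: cf.
  split=> [t x Dx|v [i _ [c ->]]]; first by apply: cp; exact: cf.
  have [d1 d2] := df i c; split.
    by move=> _ x Dx; have /(@derivable_mxP R _ 1 4) := d1 x Dx; exact.
  by apply: eq_smooth (IH _ d2 l) => // _ x Dx; rewrite pderivE//; exact: d1.
elim: k f => [|k IH] f sf; split=> //; try exact: qsmooth_continuous sf.
move=> i c; split; last by apply: IH; exact: qsmooth_pderiv.
by move=> x Dx; apply: ex_derive; exact: (qsmooth_is_derive sf).
Qed.

Lemma eq_qsmooth k D f g : open D -> (forall x, D x -> f x = g x) ->
  qsmooth k D f -> qsmooth k D g.
Proof.
by move=> oD fg sf l; apply: eq_smooth (sf l) => // _ x Dx; rewrite fg.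
Qed.

Lemma qsmooth_cst k D (a : quat R) : qsmooth k D (fun=> a).
Proof. by move=> l; exact: smooth_cst. Qed.

Lemma qsmoothD k D f g : open D -> qsmooth k D f -> qsmooth k D g ->
  qsmooth k D (fun x => f x + g x).
Proof.
move=> oD sf sg l; apply: eq_smooth (smoothD oD (sf l) (sg l)) => // _ x _.
by rewrite quat_addE.
Qed.

Lemma qsmoothM k D f g : open D -> qsmooth k D f -> qsmooth k D g ->
  qsmooth k D (fun x => f x * g x).
Proof.
move=> oD sf sg.
have M l l' := smoothM oD (sf l) (sg l').
have E l (h : R -> 'M[R]_(n, 4) -> R) : smooth k (coord_dirs setT) D h ->
    (forall x, h 0 x = quat_mul (f x) (g x) 0 l) -> (forall t x, h t x = h 0 x) ->
    smooth k (coord_dirs setT) D (fun _ x => (f x * g x) 0 l).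
  by move=> sh h1 h2; apply: eq_smooth sh => // t x _; rewrite h2 h1.
apply: ord4_ind.
- apply: E (smoothB oD (smoothB oD (smoothB oD (M _ _) (M _ _)) (M _ _)) (M _ _)) _ _ => //.
  by move=> x; rewrite mkquatE.
- apply: E (smoothB oD (smoothD oD (smoothD oD (M _ _) (M _ _)) (M _ _)) (M _ _)) _ _ => //.
  by move=> x; rewrite mkquatE.
- apply: E (smoothD oD (smoothD oD (smoothB oD (M _ _) (M _ _)) (M _ _)) (M _ _)) _ _ => //.
  by move=> x; rewrite mkquatE.
- apply: E (smoothD oD (smoothB oD (smoothD oD (M _ _) (M _ _)) (M _ _)) (M _ _)) _ _ => //.
  by move=> x; rewrite mkquatE.
Qed.

Lemma qsmoothN k D f : open D -> qsmooth k D f -> qsmooth k D (fun x => - f x).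
Proof.
move=> oD sf; apply: eq_qsmooth (qsmoothM oD (qsmooth_cst k D (-1)) sf) => // x _.
by rewrite mulN1r.
Qed.

Lemma qsmoothB k D f g : open D -> qsmooth k D f -> qsmooth k D g ->
  qsmooth k D (fun x => f x - g x).
Proof. by move=> oD sf sg; apply: qsmoothD => //; exact: qsmoothN. Qed.

Lemma smooth_coord k (S : set 'M[R]_(n, 4)) D i c : open D ->
  smooth k S D (fun _ x => x i c).
Proof.
have cc (t : R) x : {for (t, x), continuous (fun q : R * 'M[R]_(n, 4) => q.2 i c)}.
  apply: (@continuous_comp _ _ _ (fun q : R * 'M[R]_(n, 4) => q.2) (fun x => x i c)).
    exact: cvg_snd.
  exact: coord_continuous.
move=> oD; case: k => [|k]; first by split=> // t x _; exact: cc.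
split=> [t x _|v _]; first exact: cc.
have d x : is_derive x v (fun z : 'M[R]_(n, 4) => z i c) (v i c).
  apply/is_derive_line0.
  have -> : (fun s : R => (s *: v + x) i c) = fun s => s * v i c + x i c.
    by apply/funext => s; rewrite !mxE.
  apply: is_derive_eq (is_deriveD (is_deriveM (is_derive_id (0 : R) 1)
    (is_derive_cst (v i c) (0 : R) 1)) (is_derive_cst (x i c) (0 : R) 1)) _.
  by rewrite /GRing.scale /= mul0r add0r mulr1 addr0.
split; first by move=> _ x _; exact: (@ex_derive _ _ _ _ _ _ _ (d x)).
apply: eq_smooth (smooth_cst k S D (v i c)) => // _ x _.
by apply/esym; exact: (@derive_val _ _ _ _ _ _ _ (d x)).
Qed.

Lemma qsmooth_scale k D (a : 'M[R]_(n, 4) -> R) f : open D ->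
  smooth k (coord_dirs setT) D (fun _ x => a x) -> qsmooth k D f ->
  qsmooth k D (fun x => a x *: f x).
Proof.
move=> oD sa sf l; apply: eq_smooth (smoothM oD sa (sf l)) => // _ x _.
by rewrite quat_scaleE.
Qed.

Lemma qcoordE x i l : qcoord x i 0 l = x i l.
Proof. exact: mxE. Qed.

Lemma qsmooth_qcoord k D i : open D -> qsmooth k D (fun x => qcoord x i).
Proof.
move=> oD l; apply: eq_smooth (smooth_coord k _ i l oD) => // _ x _.
by rewrite qcoordE.
Qed.

Lemma qsmooth_qIm k D f : open D -> qsmooth k D f -> qsmooth k D (fun x => qIm (f x)).
Proof.
move=> oD sf; apply: ord4_ind.
- by apply: eq_smooth (smooth_cst k _ D 0) => // _ x _; rewrite qIm0.
- by apply: eq_smooth (sf 1) => // _ x _; rewrite qIm1.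
- by apply: eq_smooth (sf 2) => // _ x _; rewrite qIm2.
- by apply: eq_smooth (sf 3) => // _ x _; rewrite qIm3.
Qed.

Lemma qsmoothV k D f : open D -> (forall x, D x -> f x != 0) ->
  qsmooth k D f -> qsmooth k D (fun x => (f x)^-1).
Proof.
move=> oD f0 sf.
have sN : smooth k (coord_dirs setT) D (fun _ x => quat_sqnorm (f x)).
  by do 3! [apply: smoothD => //; last exact: smoothX]; exact: smoothX.
have sV : smooth k (coord_dirs setT) D (fun _ x => (quat_sqnorm (f x))^-1).
  by apply: smoothV => // _ x Dx; rewrite quat_sqnorm_eq0; exact: f0.
apply: (@qsmooth_scale k D (fun x => (quat_sqnorm (f x))^-1) (fun x => qconj (f x))) => //.
apply: ord4_ind.
- by apply: eq_smooth (sf 0) => // _ x _; rewrite mkquatE.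
- by apply: eq_smooth (smoothN oD (sf 1)) => // _ x _; rewrite mkquatE.
- by apply: eq_smooth (smoothN oD (sf 2)) => // _ x _; rewrite mkquatE.
- by apply: eq_smooth (smoothN oD (sf 3)) => // _ x _; rewrite mkquatE.
Qed.

End quaternion_smooth.

(** * Leibniz rules and recursion for the operators *)

Section operators.
Variables (R : realType) (n : nat).
Implicit Types (f g : 'M[R]_(n, 4) -> quat R) (x : 'M[R]_(n, 4))
  (U D : set 'M[R]_(n, 4)) (i : 'I_n) (c l : 'I_4) (K : {set 'I_n}).

Lemma is_derive_coord x v i c :
  is_derive x v (fun z : 'M[R]_(n, 4) => z i c) (v i c).
Proof.
apply/is_derive_line0.
have -> : (fun s : R => (s *: v + x) i c) = fun s => s * v i c + x i c.
  by apply/funext => s; rewrite !mxE.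
apply: is_derive_eq (is_deriveD (is_deriveM (@is_derive_id _ _ (0 : R) 1)
  (is_derive_cst (v i c) (0 : R) 1)) (is_derive_cst (x i c) (0 : R) 1)) _.
by rewrite /GRing.scale/= mul0r add0r mulr1 addr0.
Qed.

Lemma is_derive_qcoord x v i :
  is_derive x v (fun z : 'M[R]_(n, 4) => qcoord z i) (qcoord v i).
Proof.
apply/is_derive_quatP => l; rewrite qcoordE.
have -> : (fun z : 'M[R]_(n, 4) => qcoord z i 0 l) = fun z => z i l.
  by apply/funext => z; rewrite qcoordE.
exact: is_derive_coord.
Qed.

Definition qe c : quat R := delta_mx 0 c.

Lemma qcoord_delta i c : qcoord (delta_mx i c : 'M[R]_(n, 4)) i = qe c.
Proof. by apply/rowP => l; rewrite !mxE !eqxx. Qed.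

Lemma qeE : [/\ qe 0 = 1, qe 1 = qi, qe 2 = qj & qe 3 = qk].
Proof.
by split; apply: quatP; rewrite ?quat_1E /qi /qj /qk ?mkquatE mxE.
Qed.

Lemma pderiv_qcoordM g x i c d : is_derive x (delta_mx i c) g d ->
  pderiv i c (fun z => qcoord z i * g z) x = qe c * g x + qcoord x i * d.
Proof.
move=> dg; apply: pderiv_val; rewrite -(qcoord_delta i c).
by apply: is_derive_quatM => //; exact: is_derive_qcoord.
Qed.

Lemma eq_pderiv D f g i c x : open D -> (forall x, D x -> f x = g x) -> D x ->
  pderiv i c f x = pderiv i c g x.
Proof.
move=> oD fg Dx; apply: near_eq_derive.
by apply: filterS (open_nbhs_nbhs (conj oD Dx)) => y; exact: fg.
Qed.

Lemma sum_ord4_neq0 (F : 'I_4 -> quat R) :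
  \sum_(c < 4 | c != 0) F c = F 1 + F 2 + F 3.
Proof.
rewrite (bigD1 1)//= (bigD1 2)//= (bigD1 3)//= big1 => [|l]; last first.
  by move: l; apply: ord4_ind.
by rewrite addr0 !addrA.
Qed.

Lemma vartheta_barE i f x : vartheta_bar i f x = 2^-1 *: (pderiv i 0 f x -
  (qIm (qcoord x i))^-1 * (qcoord x i 0 1 *: pderiv i 1 f x +
    qcoord x i 0 2 *: pderiv i 2 f x + qcoord x i 0 3 *: pderiv i 3 f x)).
Proof. by rewrite /vartheta_bar sum_ord4_neq0 !qcoordE. Qed.

Definition Gamma_step i f x : quat R := (2 * qIm (qcoord x i))^-1 * Gamma_op i f x.

Lemma Gamma_stepE i f x : Gamma_step i f x = (2 * qIm (qcoord x i))^-1 *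
  (- qi * (qcoord x i 0 2 *: pderiv i 3 f x - qcoord x i 0 3 *: pderiv i 2 f x) +
    qj * (qcoord x i 0 1 *: pderiv i 3 f x - qcoord x i 0 3 *: pderiv i 1 f x) -
    qk * (qcoord x i 0 1 *: pderiv i 2 f x - qcoord x i 0 2 *: pderiv i 1 f x)).
Proof. by rewrite /Gamma_step /Gamma_op /L_op !qcoordE. Qed.

Lemma CRF_vartheta i f x : qIm (qcoord x i) != 0 ->
  CRF i f x = vartheta_bar i f x - Gamma_step i f x.
Proof. by move=> y0; rewrite vartheta_barE Gamma_stepE -CRF_algebra. Qed.

Lemma expr_false i f : (fun z => qcoord z i ^+ false * f z) = f.
Proof. by apply/funext => z; rewrite expr0 mul1r. Qed.

Lemma vartheta_barM D i f x (b : bool) : open D -> qsmooth 1 D f -> D x ->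
  qIm (qcoord x i) != 0 ->
  vartheta_bar i (fun z => qcoord z i ^+ b * f z) x = qcoord x i ^+ b * vartheta_bar i f x.
Proof.
move=> oD sf Dx y0; case: b; last first.
  by rewrite expr_false expr0 mul1r.
rewrite !vartheta_barE !expr1.
have E c : pderiv i c (fun z => qcoord z i ^+ 1 * f z) x =
    qe c * f x + qcoord x i * pderiv i c f x.
  exact/pderiv_qcoordM/(qsmooth_is_derive sf).
rewrite !E; have [-> -> -> ->] := qeE.
by rewrite mul1r vartheta_algebra.
Qed.

Lemma Gamma_stepM D i f x : open D -> qsmooth 1 D f -> D x ->
  qIm (qcoord x i) != 0 ->
  Gamma_step i (fun z => qcoord z i * f z) x =
  f x + qconj (qcoord x i) * Gamma_step i f x.
Proof.
move=> oD sf Dx y0; rewrite !Gamma_stepE.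
have E c : pderiv i c (fun z => qcoord z i * f z) x =
    qe c * f x + qcoord x i * pderiv i c f x.
  exact/pderiv_qcoordM/(qsmooth_is_derive sf).
rewrite !E; have [_ -> -> ->] := qeE.
exact: Gamma_algebra.
Qed.

Lemma GammaS i K f : Gamma i.+1 K f =
  Gamma_step i (fun z => qcoord z i ^+ (i \in K) * Gamma i (K :\ i)%SET f z).
Proof. by rewrite /= valK. Qed.

Lemma A_opS i K f : A_op i.+1 K f = fun x =>
  - CRF i (fun z => qcoord z i ^+ (i \in K) * A_op i (K :\ i)%SET f z) x.
Proof. by rewrite /= valK. Qed.

Lemma qsmooth_expb k D i (b : bool) f : open D -> qsmooth k D f ->
  qsmooth k D (fun z => qcoord z i ^+ b * f z).
Proof.
move=> oD sf; apply: qsmoothM => //; case: b; last exact: qsmooth_cst.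
exact: qsmooth_qcoord.
Qed.

Lemma qsmooth_CRF k D i f : open D -> qsmooth k.+1 D f -> qsmooth k D (CRF i f).
Proof.
move=> oD sf; have sd c := qsmooth_pderiv i c oD sf.
have sM (a : quat R) c : qsmooth k D (fun x => a * pderiv i c f x).
  by apply: qsmoothM => //; exact: qsmooth_cst.
apply: (@qsmooth_scale _ _ k D (fun=> 2^-1)) => //; first exact: smooth_cst.
by do 3! apply: qsmoothD => //.
Qed.

Lemma qsmooth_scale_coord k D i c f : open D -> qsmooth k D f ->
  qsmooth k D (fun x => x i c *: f x).
Proof. by move=> oD sf; apply: qsmooth_scale => //; exact: smooth_coord. Qed.

Lemma qsmooth_Gamma_step k D i f : open D ->
  (forall x, D x -> qIm (qcoord x i) != 0) -> qsmooth k.+1 D f ->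
  qsmooth k D (Gamma_step i f).
Proof.
move=> oD y0 sf; have sd c := qsmooth_pderiv i c oD sf.
have sL p q : qsmooth k D (L_op i p q f).
  by apply: qsmoothB => //; exact: qsmooth_scale_coord.
have sM (a : quat R) p q : qsmooth k D (fun x => a * L_op i p q f x).
  by apply: qsmoothM => //; exact: qsmooth_cst.
apply: qsmoothM => //.
  apply: qsmoothV => //.
    by move=> x Dx; rewrite quat_mul2 scaler_eq0 negb_or pnatr_eq0 y0.
  apply: qsmoothM => //; first exact: qsmooth_cst.
  by apply: qsmooth_qIm => //; exact: qsmooth_qcoord.
by apply: qsmoothB => //; apply: qsmoothD => //.
Qed.

(** Each step of the recursion uses up one derivative. *)
Lemma qsmooth_Gamma D f m K : open D ->
  (forall x i, D x -> qIm (qcoord x i) != 0) -> qsmooth n D f -> (m <= n)%N ->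
  qsmooth (n - m) D (Gamma m K f).
Proof.
move=> oD y0 sf; elim: m K => [|m IH] K mn; first by rewrite subn0.
rewrite -[m]/(val (Ordinal mn)) GammaS; apply: qsmooth_Gamma_step => //.
  by move=> x; exact: y0.
by apply: qsmooth_expb => //; rewrite /= subnSK//; apply: IH; exact: ltnW.
Qed.

Lemma qsmooth_A_op D f m K : open D -> qsmooth n D f -> (m <= n)%N ->
  qsmooth (n - m) D (A_op m K f).
Proof.
move=> oD sf; elim: m K => [|m IH] K mn; first by rewrite subn0.
rewrite -[m]/(val (Ordinal mn)) A_opS; apply: qsmoothN => //; apply: qsmooth_CRF => //.
by apply: qsmooth_expb => //; rewrite /= subnSK//; apply: IH; exact: ltnW.
Qed.

(** [Gamma_stepM] rearranged: the last step acts on [x_i] times [Gamma i K f] if [i] belongs to the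
    index set, and on [Gamma i K f] itself otherwise. *)
Lemma Gamma_decomp D f i K x : open D ->
  (forall x i, D x -> qIm (qcoord x i) != 0) -> qsmooth n D f -> D x ->
  i \notin K ->
  Gamma i K f x = Gamma i.+1 (i |: K)%SET f x +
    - qconj (qcoord x i) * Gamma i.+1 K f x.
Proof.
move=> oD y0 sf Dx iK.
have sG : qsmooth 1 D (Gamma i K f).
  apply: (qsmoothW (k := (n - i)%N) (D := D)) => //; first by rewrite subn_gt0.
  by apply: qsmooth_Gamma => //; exact: ltnW.
have K1 : (K :\ i = K)%SET.
  by apply/setP => j; rewrite !inE; case: eqP => // ->; rewrite (negPf iK).
rewrite !GammaS setU11 (negPf iK) setU1K// K1.
have -> : (fun z => qcoord z i ^+ true * Gamma i K f z) =
  fun z => qcoord z i * Gamma i K f z by [].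
rewrite expr_false.
by rewrite (Gamma_stepM oD sG Dx) ?y0// mulNr addrK.
Qed.

End operators.

(** * Imaginary units and slices *)

Section imaginary_units.
Variable R : realType.
Implicit Types (x I : quat R).

Lemma imag_unitsP I : imag_units I <->
  I 0 0 = 0 /\ I 0 1 ^+ 2 + I 0 2 ^+ 2 + I 0 3 ^+ 2 = 1.
Proof.
rewrite /imag_units /=; move: I; elim/quatW => a b c e; rewrite !mkquatE expr2.
split=> [h|[a0 h]]; last first.
  rewrite mkquatM quat_1E mkquatN a0; congr mkquat; try ring.
  by rewrite -h; ring.
move: h; rewrite mkquatM quat_1E mkquatN => h.
have := congr1 (fun x : quat R => x 0 0) h; have := congr1 (fun x : quat R => x 0 1) h.
have := congr1 (fun x : quat R => x 0 2) h; have := congr1 (fun x : quat R => x 0 3) h.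
rewrite !mkquatE oppr0 => h3 h2 h1 h0.
have a0 : a = 0.
  apply/eqP/negPn/negP => a0.
  have b0 : b = 0 by apply: (mulfI a0); lra.
  have c0 : c = 0 by apply: (mulfI a0); lra.
  have e0 : e = 0 by apply: (mulfI a0); lra.
  by have := sqr_ge0 a; move: h0; rewrite b0 c0 e0 expr2; lra.
by split => //; move: h0; rewrite a0 !expr2; lra.
Qed.

Lemma quat_sqnorm_ge0 x : 0 <= quat_sqnorm x.
Proof. by rewrite /quat_sqnorm !addr_ge0 ?sqr_ge0. Qed.

Lemma quat_sqnorm_qIm x : quat_sqnorm (qIm x) = x 0 1 ^+ 2 + x 0 2 ^+ 2 + x 0 3 ^+ 2.
Proof. by rewrite /quat_sqnorm !qImE expr0n add0r. Qed.

Definition im_norm x : R := Num.sqrt (quat_sqnorm (qIm x)).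

Lemma im_norm_gt0 x : qIm x != 0 -> 0 < im_norm x.
Proof.
by rewrite -quat_sqnorm_eq0 sqrtr_gt0 lt_neqAle eq_sym quat_sqnorm_ge0 andbT.
Qed.

Lemma sqr_im_norm x : im_norm x ^+ 2 = x 0 1 ^+ 2 + x 0 2 ^+ 2 + x 0 3 ^+ 2.
Proof. by rewrite sqr_sqrtr ?quat_sqnorm_ge0// quat_sqnorm_qIm. Qed.

Definition im_dir x : quat R := (im_norm x)^-1 *: qIm x.

Lemma im_dir_unit x : qIm x != 0 -> imag_units (im_dir x).
Proof.
move=> x0; have n0 := im_norm_gt0 x0.
have E l : im_dir x 0 l = (im_norm x)^-1 * qIm x 0 l by exact: quat_scaleE.
apply/imag_unitsP; rewrite !E !qImE mulr0; split => //.
by rewrite !exprMn -!mulrDr -sqr_im_norm exprVn mulVf// sqrf_eq0 gt_eqF.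
Qed.

Lemma slice_pointE I (a b : R) : a%:A + I * b%:A = a%:A + b *: I.
Proof. by rewrite mulr_algr. Qed.

Lemma im_dirE x : qIm x != 0 -> x = (x 0 0)%:A + im_dir x * (im_norm x)%:A.
Proof.
move=> x0; have n0 := im_norm_gt0 x0.
rewrite slice_pointE /im_dir scalerA divff ?gt_eqF// scale1r.
move: {x0 n0} x; elim/quatW => a b c e.
by rewrite realA !mkquatE !mkquatDE addr0 !add0r.
Qed.

Lemma slice_point0 I (a b : R) : imag_units I -> (a%:A + I * b%:A) 0 0 = a.
Proof.
by move=> /imag_unitsP[I0 _]; rewrite slice_pointE quat_addE quat_scaleE I0 realA mkquatE mulr0 addr0.
Qed.

Lemma slice_point_im I (a b : R) l : l != 0 -> (a%:A + I * b%:A) 0 l = b * I 0 l.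
Proof.
rewrite slice_pointE quat_addE quat_scaleE realA => l0.
by rewrite (_ : mkquat a 0 0 0 0 l = 0) ?add0r//; move: l l0; apply: ord4_ind => //; rewrite mkquatE.
Qed.

Lemma qIm_slice_point I (a b : R) : imag_units I ->
  qIm (a%:A + I * b%:A) = b *: I.
Proof.
move=> uI; have /imag_unitsP[I0 _] := uI.
by apply: quatP; rewrite qImE ?quat_scaleE ?I0 ?mulr0// slice_point_im.
Qed.

Lemma imag_unit_neq0 I : imag_units I -> I != 0.
Proof.
rewrite /imag_units/= => h; apply/eqP => I0; move: h.
by rewrite I0 expr0n/= => /esym/eqP; rewrite oppr_eq0 oner_eq0.
Qed.

Lemma imag_unit_inv I : imag_units I -> I^-1 = - I.
Proof.
move=> uI; have I0 := imag_unit_neq0 uI.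
apply: (mulrI (x := I)); first by rewrite quat_unitE.
rewrite divrr ?quat_unitE// mulrN -expr2; move: uI; rewrite /imag_units/= => ->.
by rewrite opprK.
Qed.

End imaginary_units.

(** * Restriction of one coordinate to a slice *)

Section slices.
Variables (R : realType) (n : nat).
Implicit Types (f g : 'M[R]_(n, 4) -> quat R) (x y : 'M[R]_(n, 4))
  (U D : set 'M[R]_(n, 4)) (i : 'I_n) (c l : 'I_4) (K : {set 'I_n}) (I : quat R).

Lemma nonrealP x : ~ @real_points R n x <-> forall i, qIm (qcoord x i) != 0.
Proof.
split=> [nx i|nx [i [a xa]]].
  by apply/eqP => /qIm_realP[a xa]; apply: nx; exists i, a.
by have /eqP := nx i; apply; apply/qIm_realP; exists a.
Qed.

Lemma coord_sqnorm_continuous i :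
  continuous (fun x : 'M[R]_(n, 4) => quat_sqnorm (qIm (qcoord x i))).
Proof.
move=> x; have c l : {for x, continuous (fun x : 'M[R]_(n, 4) => x i l ^+ 2)}.
  have -> : (fun x : 'M[R]_(n, 4) => x i l ^+ 2) = fun x => x i l * x i l.
    by apply/funext => z; rewrite expr2.
  have cl : {for x, continuous (fun x : 'M[R]_(n, 4) => x i l)} by exact: coord_continuous.
  exact: (cvgM cl cl).
have -> : (fun x : 'M[R]_(n, 4) => quat_sqnorm (qIm (qcoord x i))) =
    fun x => x i 1 ^+ 2 + x i 2 ^+ 2 + x i 3 ^+ 2.
  by apply/funext => z; rewrite quat_sqnorm_qIm !qcoordE.
exact: (cvgD (cvgD (c 1) (c 2)) (c 3)).
Qed.

Lemma open_nonreal U : open U -> open (U `\` @real_points R n).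
Proof.
move=> oU; apply: openI => //; rewrite openE => x /nonrealP nx.
have : \forall y \near x, forall i, quat_sqnorm (qIm (qcoord y i)) != 0.
  apply: (@filter_forall _ _ (fun i y => quat_sqnorm (qIm (qcoord y i)) != 0) (nbhs x)) => i.
  by apply: cvgr_neq0 (@coord_sqnorm_continuous i x) _; rewrite quat_sqnorm_eq0.
apply: filterS => y h; apply/nonrealP => i.
by have := h i; rewrite quat_sqnorm_eq0.
Qed.

Lemma row_subst_coord y i (a : quat R) : qcoord (subst_coord y i a) i = a.
Proof. by apply/rowP => l; rewrite !mxE eqxx. Qed.

Lemma row_subst_coord_neq y i j (a : quat R) : j != i ->
  qcoord (subst_coord y i a) j = qcoord y j.
Proof. by move=> /negPf ji; apply/rowP => l; rewrite !mxE ji. Qed.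

Lemma subst_coord_id x i : subst_coord x i (qcoord x i) = x.
Proof. by apply/matrixP => j l; rewrite !mxE; case: eqP => // ->. Qed.

Let dir i I : 'M[R]_(n, 4) := \sum_c I 0 c *: delta_mx i c.

Let addE (A B : 'M[R]_(n, 4)) j l : (A + B) j l = A j l + B j l.
Proof. exact: mxE. Qed.

Let scaleE a (A : 'M[R]_(n, 4)) j l : (a *: A) j l = a * A j l.
Proof. exact: mxE. Qed.

Let deltaE i c j l : (delta_mx i c : 'M[R]_(n, 4)) j l = ((j == i) && (l == c))%:R.
Proof. exact: mxE. Qed.

Let substE x i a j l : subst_coord x i a j l = if j == i then a 0 l else x j l.
Proof. exact: mxE. Qed.

Let dirE i I j l : dir i I j l = (j == i)%:R * I 0 l.
Proof.
rewrite /dir summxE (bigD1 l)//= big1 ?addr0; last first.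
  by move=> c cl; rewrite scaleE deltaE [l == c]eq_sym (negPf cl) andbF mulr0.
by rewrite scaleE deltaE eqxx andbT mulrC.
Qed.

Lemma subst_coord_slice x i I (p : R * R) :
  subst_coord x i (p.1%:A + I * p.2%:A) =
  p.1 *: delta_mx i 0 + p.2 *: dir i I + subst_coord x i 0.
Proof.
apply/matrixP => j l; rewrite !addE !scaleE deltaE dirE !substE.
case: eqP => /= _; last by rewrite !mul0r !mulr0 !add0r.
rewrite slice_pointE realA quat_addE quat_scaleE quat_0E addr0 mul1r.
by congr (_ + _); move: l; apply: ord4_ind; rewrite mkquatE ?mulr1 ?mulr0.
Qed.

Lemma slice_gradient (phi : 'M[R]_(n, 4) -> R) U x i I (p : R * R) :
  open U -> smooth 1 (coord_dirs setT) U (fun _ => phi) ->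
  let y := subst_coord x i (p.1%:A + I * p.2%:A) in U y ->
  has_gradient (fun p => phi (subst_coord x i (p.1%:A + I * p.2%:A)))
    ('D_(delta_mx i 0) phi y) (\sum_c I 0 c * 'D_(delta_mx i c) phi y) p.
Proof.
move=> oU sphi y Uy.
have dirS j c : coord_dirs setT (delta_mx j c : 'M[R]_(n, 4)) by exists j => //; exists c.
have [_ dphi] := sphi.
have [||dy ey] := @continuous_partials_differentiable R n 4 U phi y oU Uy.
- by move=> j c z Uz; have [/(_ 0 z Uz)] := dphi _ (dirS j c).
- move=> j c; have [_] := dphi _ (dirS j c).
  rewrite -/(smooth 0 (coord_dirs setT) U (fun _ => 'D_(delta_mx j c) phi)) => s0.
  by have := smooth_continuousr s0 (t := 0) Uy.
pose l (h : R * R) : 'M[R]_(n, 4) := h.1 *: delta_mx i 0 + h.2 *: dir i I.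
have linl : linear l.
  move=> a u v; rewrite /l /= !scalerDl !scalerDr !scalerA.
  by rewrite addrACA.
pose L : {linear (R * R)%type -> 'M[R]_(n, 4)} := HB.pack l (GRing.isLinear.Build _ _ _ _ l linl).
have cL : continuous L.
  move=> h; apply: cvgD.
    by apply: (@cvgZr_tmp _ _ _ (nbhs h) _ (@fst R R)); exact: cvg_fst.
  by apply: (@cvgZr_tmp _ _ _ (nbhs h) _ (@snd R R)); exact: cvg_snd.
pose T (p : R * R) : 'M[R]_(n, 4) := subst_coord x i (p.1%:A + I * p.2%:A).
have [dT eT] : differentiable T p /\ forall h, 'd T p h = L h.
  apply: differentiable_epsP => // e e0; apply: filterE => h.
  rewrite /T !subst_coord_slice [X in `|X|](_ : _ = 0) ?normr0 ?mulr_ge0 ?(ltW e0)//.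
  rewrite -[L h]/(l h) /l /= !scalerDl opprD addrACA subrr addr0.
  by rewrite [X in X - _ - _]addrACA addrK subrr.
split; first exact: (differentiable_comp dT dy).
move=> h; rewrite (diff_comp dT dy)/= ey eT.
have Lsum : forall j c, l h j c = (j == i)%:R * (h.1 * (c == 0)%:R + h.2 * I 0 c).
  move=> j c; rewrite /l addE !scaleE deltaE dirE.
  by case: (j == i); rewrite /= ?mul1r ?mul0r ?mulr0 ?addr0.
rewrite (bigD1 i)//= [X in _ + X]big1 ?addr0 => [|j ji]; last first.
  by rewrite big1// => c _; rewrite Lsum (negPf ji) !mul0r.
rewrite (eq_bigr (fun c => h.1 * ((c == 0)%:R * 'D_(delta_mx i c) phi y) +
    h.2 * (I 0 c * 'D_(delta_mx i c) phi y))); last first.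
  by move=> c _; rewrite Lsum eqxx mul1r mulrDl !mulrA.
rewrite big_split/= -!mulr_sumr mulrC [X in _ + X]mulrC; congr (_ * _ + _).
by rewrite (bigD1 0)//= mul1r big1 ?addr0// => c /negPf ->; rewrite mul0r.
Qed.

(** Chain rule for the slice through coordinate [i]. The result is expressed by partial derivatives,
    so it also holds where the slice meets the real axis and can be extended there by continuity. *)
Lemma slice_derivative g U x i I (al be : R) : open U -> qsmooth 1 U g ->
  let y := subst_coord x i (al%:A + I * be%:A) in U y ->
  differentiable (fun p : R * R => g (subst_coord x i (p.1%:A + I * p.2%:A))) (al, be) /\
  derive1 (fun a : R => g (subst_coord x i (a%:A + I * be%:A))) al +
  I * derive1 (fun b : R => g (subst_coord x i (al%:A + I * b%:A))) be =
  pderiv i 0 g y + I * \sum_c I 0 c *: pderiv i c g y.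
Proof.
move=> oU sg y Uy.
have G l := @slice_gradient (fun z => g z 0 l) U x i I (al, be) oU (sg l) Uy.
pose H (p : R * R) := g (subst_coord x i (p.1%:A + I * p.2%:A)).
split.
  rewrite -/H; have -> : H = \sum_(l < 4) (fun p => H p 0 l *: (delta_mx 0 l : quat R)).
    apply/funext => p; rewrite fct_sumE [LHS](@row_sum_delta R 4).
    by apply: eq_bigr.
  apply: differentiable_sum => l.
  apply: (@differentiableZl R _ (quat R) (fun p => H p 0 l)).
  by have [] := G l.
have pE c l : pderiv i c g y 0 l = 'D_(delta_mx i c) (fun z => g z 0 l) y.
  by apply: pderivE; apply: ex_derive; exact: (qsmooth_is_derive sg).
have sumE l : (\sum_c I 0 c *: pderiv i c g y) 0 l =
    \sum_c I 0 c * 'D_(delta_mx i c) (fun z => g z 0 l) y.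
  rewrite summxE; apply: eq_bigr => c _; rewrite -pE; exact: mxE.
have id1 (t : R) : is_derive t 1 id (1 : R) by exact: is_derive_id.
have c0 (t c : R) : is_derive t 1 (fun=> c) (0 : R) by exact: is_derive_cst.
rewrite (_ : derive1 _ al = pderiv i 0 g y);
  first rewrite (_ : derive1 _ be = \sum_c I 0 c *: pderiv i c g y)//; last first.
- rewrite derive1E; apply: derive_val; apply/is_derive_quatP => l; rewrite pE.
  apply: is_derive_eq (has_gradient_comp (g1 := id) (g2 := fun=> be) (id1 al) (c0 al be) (G l)) _.
  by rewrite mulr1 mulr0 addr0.
- rewrite derive1E; apply: derive_val; apply/is_derive_quatP => l; rewrite sumE.
  apply: is_derive_eq (has_gradient_comp (g1 := fun=> al) (g2 := id) (c0 be al) (id1 be) (G l)) _.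
  by rewrite mulr1 mulr0 add0r.
Qed.

(** On the slice of [I] one has [Im(x_i)^-1 = - be^-1 I], and the imaginary coordinates of [x_i] are
    [be] times those of [I]: the factors [be] cancel, and the slice Cauchy-Riemann operator is twice
    [vartheta_bar]. *)
Lemma vartheta_slice g x i I (al be : R) : imag_units I -> be != 0 ->
  qcoord x i = al%:A + I * be%:A ->
  pderiv i 0 g x + I * \sum_c I 0 c *: pderiv i c g x = 2 *: vartheta_bar i g x.
Proof.
move=> uI b0 xE; rewrite vartheta_barE scalerA divff ?pnatr_eq0// scale1r.
have /imag_unitsP[I0 _] := uI.
have -> : \sum_c I 0 c *: pderiv i c g x = I 0 1 *: pderiv i 1 g x +
    I 0 2 *: pderiv i 2 g x + I 0 3 *: pderiv i 3 g x.
  rewrite (bigD1 0)//= I0 scale0r add0r.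
  exact: (sum_ord4_neq0 (fun c => I 0 c *: pderiv i c g x)).
have -> : (qIm (qcoord x i))^-1 = - (be^-1 *: I).
  by rewrite xE qIm_slice_point// quat_inv_scale// imag_unit_inv// scalerN.
rewrite xE (slice_point_im _ _ _ (l := 1))// (slice_point_im _ _ _ (l := 2))//
  (slice_point_im _ _ _ (l := 3))//.
move: (pderiv i 0 g x) (pderiv i 1 g x) (pderiv i 2 g x) (pderiv i 3 g x) => d0 d1 d2 d3.
rewrite -!scalerA -!scalerDr; move: (_ + _ + _) => d.
by rewrite mulNr opprK -scalerAl -scalerAr scalerA mulVf// scale1r.
Qed.

End slices.

(** * Comparison of [A_op] and [Gamma] off the real points *)

Section regular_operators.
Variables (R : realType) (n : nat).
Implicit Types (f g : 'M[R]_(n, 4) -> quat R) (x y : 'M[R]_(n, 4))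
  (U D : set 'M[R]_(n, 4)) (i : 'I_n) (c l : 'I_4) (K : {set 'I_n}) (I : quat R).

Lemma eq_CRF D f g i x : open D -> (forall x, D x -> f x = g x) -> D x ->
  CRF i f x = CRF i g x.
Proof. by move=> oD fg Dx; rewrite /CRF !(eq_pderiv _ _ oD fg Dx). Qed.

Lemma eq_vartheta_bar D f g i x : open D -> (forall x, D x -> f x = g x) -> D x ->
  vartheta_bar i f x = vartheta_bar i g x.
Proof. by move=> oD fg Dx; rewrite !vartheta_barE !(eq_pderiv _ _ oD fg Dx). Qed.

Lemma subset_first_coordsS i K : K \subset first_coords n i.+1 ->
  (K :\ i)%SET \subset first_coords n i.
Proof.
move=> /fintype.subsetP KS; apply/fintype.subsetP => j; rewrite !inE => /andP[ji /KS].
rewrite inE ltnS leq_eqVlt => /orP[/eqP/val_inj jE|//].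
by rewrite jE eqxx in ji.
Qed.

(** The hypothesis is a disjunction because the two directions of the theorem supply different
    halves: slice regularity gives the first, the vanishing of [theta_bar] the second. In the
    induction both say the same, since [A_op] and [Gamma] already agree at the previous step. *)
Lemma A_op_Gamma D f : open D -> (forall x i, D x -> qIm (qcoord x i) != 0) ->
  qsmooth n D f ->
  (forall i K x, K \subset first_coords n i -> D x ->
    vartheta_bar i (A_op i K f) x = 0 \/ vartheta_bar i (Gamma i K f) x = 0) ->
  forall m K x, (m <= n)%N -> K \subset first_coords n m -> D x ->
    A_op m K f x = Gamma m K f x.
Proof.
move=> oD y0 sf V0; elim=> [//|m IH] K x mn KS Dx.
pose i := Ordinal mn; rewrite -[m]/(val i) in KS IH *.
have KiS := subset_first_coordsS KS.
have IH' z : D z -> A_op i (K :\ i)%SET f z = Gamma i (K :\ i)%SET f z.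
  by move=> Dz; apply: IH => //; exact: ltnW.
have sG : qsmooth 1 D (Gamma i (K :\ i)%SET f).
  apply: (qsmoothW (k := (n - i)%N) (D := D)) => //; first by rewrite subn_gt0.
  by apply: qsmooth_Gamma => //; exact: ltnW.
rewrite A_opS GammaS (eq_CRF (g := fun z => qcoord z i ^+ (i \in K) * Gamma i (K :\ i)%SET f z) i oD _ Dx).
  2: by move=> z Dz; rewrite IH'.
rewrite CRF_vartheta ?y0// (vartheta_barM (i \in K) oD sG Dx) ?y0//.
have -> : vartheta_bar i (Gamma i (K :\ i)%SET f) x = 0.
  have [e|//] := V0 i _ x KiS Dx.
  by rewrite -(eq_vartheta_bar i oD IH' Dx).
by rewrite mulr0 sub0r opprK.
Qed.

Lemma SR_slice_vartheta U f i K x : open U -> qsmooth n U f -> SR_slice U f ->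
  K \subset first_coords n i -> U x -> qIm (qcoord x i) != 0 ->
  vartheta_bar i (A_op i K f) x = 0.
Proof.
move=> oU sf SRf KS Ux y0.
have xE := im_dirE y0; have uI := im_dir_unit y0.
have n0 := im_norm_gt0 y0.
have sA : qsmooth 1 U (A_op i K f).
  apply: (qsmoothW (k := (n - i)%N) (D := U)) => //; first by rewrite subn_gt0.
  by apply: qsmooth_A_op => //; exact: ltnW.
set al := qcoord x i 0 0 in xE; set be := im_norm _ in xE n0; set I := im_dir _ in xE uI.
have Uy : U (subst_coord x i (al%:A + I * be%:A)) by rewrite -xE subst_coord_id.
have [|_ e] := SRf x i K I Ux KS uI _ al be Uy.
  by exists (al%:A + I * be%:A); split => //; exists al, be.
have [_ e'] := slice_derivative oU sA Uy.
have := vartheta_slice (A_op i K f) uI _ xE; rewrite gt_eqF// => /(_ isT).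
rewrite -[in LHS](subst_coord_id x i) xE -e' [LHS]e => /esym/eqP.
by rewrite scaler_eq0 pnatr_eq0/= => /eqP.
Qed.

(** The sum defining [theta_bar] vanishes term by term: each summand contains [vartheta_bar] of
    [Gamma i K f], which equals that of [A_op i K f] and is killed by holomorphy on slices. *)
Lemma SR_theta_bar U f : open U -> Ck n U f -> SR_slice U f ->
  forall i x, (U `\` @real_points R n) x -> theta_bar i f x = 0.
Proof.
move=> oU /(Ck_qsmoothP n f oU) sf SRf i x Dx.
pose D := U `\` @real_points R n.
have oD : open D by exact: open_nonreal.
have DU : D `<=` U by move=> z [].
have y0 z j : D z -> qIm (qcoord z j) != 0 by move=> [_ /nonrealP].
have sfD : qsmooth n D f by exact: qsmoothW sf.
have V0 (j : 'I_n) K z : K \subset first_coords n j -> D z -> vartheta_bar j (A_op j K f) z = 0.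
  by move=> KS Dz; apply: (SR_slice_vartheta oU) => //; [exact: DU|exact: y0].
have AG := A_op_Gamma oD y0 sfD (fun j K z KS Dz => or_introl (V0 j K z KS Dz)).
rewrite /theta_bar big1// => K; rewrite powersetE => KS.
rewrite -(eq_vartheta_bar (f := A_op i K f) i oD _ Dx) => [|z Dz].
  by rewrite V0// mulr0.
by rewrite AG// ltnW.
Qed.

End regular_operators.

(** * Spheres and boxes *)

Section spheres.
Variable R : realType.
Implicit Types (a b p u v w : quat R).

Lemma qsphereP a b : qsphere a b <->
  a 0 0 = b 0 0 /\ quat_sqnorm (qIm a) = quat_sqnorm (qIm b).
Proof.
have sqn J (al be : R) : imag_units J ->
    quat_sqnorm (qIm (al%:A + J * be%:A)) = be ^+ 2.
  move=> uJ; have /imag_unitsP[J0 J1] := uJ.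
  rewrite qIm_slice_point// /quat_sqnorm !quat_scaleE J0 !exprMn.
  by rewrite expr0n mulr0 add0r -!mulrDr J1 mulr1.
split=> [[al [be [J [I [uJ uI -> ->]]]]]|[ab0 ab]].
  by rewrite !slice_point0// !sqn.
have [a0|a0] := eqVneq (qIm a) 0.
  have b0 : qIm b = 0 by apply/eqP; rewrite -quat_sqnorm_eq0 -ab quat_sqnorm_eq0 a0.
  have uqi : imag_units (qi : quat R).
    by apply/imag_unitsP; rewrite !mkquatE; split => //; ring.
  have [[x xE] [y yE]] := ((qIm_realP a).1 a0, (qIm_realP b).1 b0).
  exists x, 0, qi, qi; split => //; rewrite scale0r mulr0 addr0//.
  by rewrite yE; move: ab0; rewrite xE yE !realA !mkquatE => ->.
have b0 : qIm b != 0 by rewrite -quat_sqnorm_eq0 -ab quat_sqnorm_eq0.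
exists (a 0 0), (im_norm a), (im_dir a), (im_dir b); split.
- exact: im_dir_unit.
- exact: im_dir_unit.
- exact: im_dirE.
- by rewrite ab0 /im_norm ab; exact: im_dirE.
Qed.

Definition im_dot a b : R := a 0 1 * b 0 1 + a 0 2 * b 0 2 + a 0 3 * b 0 3.

Lemma sqnormB_dot u p : quat_sqnorm (u - p) = (u 0 0 - p 0 0) ^+ 2 +
  (quat_sqnorm (qIm u) + quat_sqnorm (qIm p) - 2 * im_dot u p).
Proof.
by rewrite !quat_sqnorm_qIm /quat_sqnorm !quat_addE !quat_oppE /im_dot; ring.
Qed.

(** The segment from [qIm u] to [qIm v], pushed radially onto the sphere of [u]. *)
Definition sphere_path u v (t : R) : quat R :=
  let w : quat R := (1 - t) *: qIm u + t *: qIm v in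
  (u 0 0)%:A + (im_norm u / Num.sqrt (quat_sqnorm w)) *: w.

Let sphere_mid u v (t : R) : quat R := (1 - t) *: qIm u + t *: qIm v.

Let sphere_midE u v t l : l != 0 -> sphere_mid u v t 0 l = (1 - t) * u 0 l + t * v 0 l.
Proof.
move=> l0; rewrite /sphere_mid quat_addE !(quat_scaleE _ (qIm _)).
by congr (_ * _ + _ * _); move: l l0; apply: ord4_ind => // _; rewrite qImE.
Qed.

Let sphere_mid0 u v t : sphere_mid u v t 0 0 = 0.
Proof. by rewrite /sphere_mid quat_addE !(quat_scaleE _ (qIm _)) !qImE !mulr0 addr0. Qed.

Lemma quat_sqnorm_scale (k : R) w : quat_sqnorm (k *: w) = k ^+ 2 * quat_sqnorm w.
Proof. by rewrite /quat_sqnorm !quat_scaleE !exprMn; ring. Qed.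

Let sphere_path_comp u v t l : l != 0 -> sphere_path u v t 0 l =
  im_norm u / Num.sqrt (quat_sqnorm (sphere_mid u v t)) * sphere_mid u v t 0 l.
Proof.
move=> l0; rewrite /sphere_path quat_addE quat_scaleE realA.
by rewrite (_ : mkquat _ _ _ _ 0 l = 0) ?add0r//; move: l l0; apply: ord4_ind => //; rewrite mkquatE.
Qed.

Lemma sphere_path0 u v t : sphere_path u v t 0 0 = u 0 0.
Proof.
rewrite /sphere_path quat_addE quat_scaleE -/(sphere_mid u v t) sphere_mid0.
by rewrite mulr0 addr0 realA mkquatE.
Qed.

Lemma qIm_sphere_path u v t : qIm (sphere_path u v t) =
  (im_norm u / Num.sqrt (quat_sqnorm (sphere_mid u v t))) *: sphere_mid u v t.
Proof.
by apply: quatP; rewrite qImE quat_scaleE ?sphere_path_comp// sphere_mid0 mulr0.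
Qed.

Lemma sphere_path_sqnorm u v t : sphere_mid u v t != 0 ->
  quat_sqnorm (qIm (sphere_path u v t)) = quat_sqnorm (qIm u).
Proof.
move=> w0; have n0 : quat_sqnorm (sphere_mid u v t) != 0 by rewrite quat_sqnorm_eq0.
rewrite qIm_sphere_path quat_sqnorm_scale exprMn exprVn (sqr_sqrtr (quat_sqnorm_ge0 (sphere_mid u v t))).
by rewrite -mulrA mulVf// mulr1 sqr_im_norm quat_sqnorm_qIm.
Qed.

(* Euclidean balls centred at a real point, or whose closure avoids the reals
   in the sense below, meet every 2-sphere in a path connected cap. *)
Lemma sphere_path_ball p u v (t r : R) : (qIm p != 0 -> r ^+ 2 <= quat_sqnorm (qIm p)) ->
  u 0 0 = v 0 0 -> quat_sqnorm (qIm u) = quat_sqnorm (qIm v) ->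
  quat_sqnorm (u - p) < r ^+ 2 -> quat_sqnorm (v - p) < r ^+ 2 ->
  0 <= t <= 1 -> sphere_mid u v t != 0 ->
  quat_sqnorm (sphere_path u v t - p) < r ^+ 2.
Proof.
move=> pr uv0 uv up vp /andP[t0 t1] w0.
set w := sphere_mid u v t in w0.
have n0 : 0 < quat_sqnorm w by rewrite lt_neqAle eq_sym quat_sqnorm_eq0 w0 quat_sqnorm_ge0.
have s0 : 0 < Num.sqrt (quat_sqnorm w) by rewrite sqrtr_gt0.
rewrite sqnormB_dot sphere_path_sqnorm// sphere_path0.
set K := (u 0 0 - p 0 0) ^+ 2 + (quat_sqnorm (qIm u) + quat_sqnorm (qIm p)).
have uK : K - 2 * im_dot u p < r ^+ 2 by move: up; rewrite sqnormB_dot /K addrA.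
have vK : K - 2 * im_dot v p < r ^+ 2 by move: vp; rewrite sqnormB_dot /K uv uv0 addrA.
rewrite addrA -/K.
have dotE : im_dot (sphere_path u v t) p = im_norm u / Num.sqrt (quat_sqnorm w) *
    ((1 - t) * im_dot u p + t * im_dot v p).
  by rewrite /im_dot !sphere_path_comp// !sphere_midE//; ring.
have wn : quat_sqnorm w <= quat_sqnorm (qIm u).
  rewrite quat_sqnorm_qIm /quat_sqnorm /w sphere_mid0 !sphere_midE// expr0n add0r.
  move: uv; rewrite !quat_sqnorm_qIm => uv.
  have tt : 0 <= t * (1 - t) by rewrite mulr_ge0// subr_ge0.
  have P : 0 <= t * (1 - t) * ((u 0 1 - v 0 1) ^+ 2 + (u 0 2 - v 0 2) ^+ 2 + (u 0 3 - v 0 3) ^+ 2).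
    by rewrite mulr_ge0// !addr_ge0 ?sqr_ge0.
  rewrite -subr_ge0; apply: le_trans P _; rewrite le_eqVlt; apply/orP; left; apply/eqP.
  transitivity (t * (u 0 1 ^+ 2 + u 0 2 ^+ 2 + u 0 3 ^+ 2) +
    (1 - t) * (u 0 1 ^+ 2 + u 0 2 ^+ 2 + u 0 3 ^+ 2) -
    (((1 - t) * u 0 1 + t * v 0 1) ^+ 2 + ((1 - t) * u 0 2 + t * v 0 2) ^+ 2 +
     ((1 - t) * u 0 3 + t * v 0 3) ^+ 2)); last by ring.
  by rewrite [in t * (u 0 1 ^+ 2 + _ + _)]uv; ring.
(* The chord lies inside the sphere, so pushing it out multiplies it by a factor at least [1]. *)
have s1 : 1 <= im_norm u / Num.sqrt (quat_sqnorm w).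
  by rewrite ler_pdivlMr// mul1r; apply: ler_wsqrtr.
(* The radius condition makes both products with [Im p] nonnegative, so that factor can only lower
   [K - 2 * im_dot], the squared distance to [p]. *)
have m0 : 0 <= im_dot u p /\ 0 <= im_dot v p.
  have [p0|p0] := eqVneq (qIm p) 0.
    move/eqP: p0; rewrite qIm_eq0 => /and3P[/eqP p1 /eqP p2 /eqP p3].
    by rewrite /im_dot p1 p2 p3 !mulr0 !addr0.
  have := pr p0 => rp; have h1 := quat_sqnorm_ge0 (qIm u).
  have h2 := sqr_ge0 (u 0 0 - p 0 0).
  by move: uK vK; rewrite /K => uK vK; split; lra.
case: m0 => du dv; rewrite dotE.
have t1' : 0 <= 1 - t by rewrite subr_ge0.
set m := (1 - t) * _ + _.
have m0 : 0 <= m by rewrite addr_ge0// mulr_ge0.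
apply: (@le_lt_trans _ _ (K - 2 * m)).
  by rewrite lerB// ler_wpM2l// ler_peMl.
have -> : K - 2 * m = (1 - t) * (K - 2 * im_dot u p) + t * (K - 2 * im_dot v p).
  by rewrite /m; ring.
have [->|tn0] := eqVneq t 0; first by rewrite subr0 mul1r mul0r addr0.
have tp : 0 < t by rewrite lt_neqAle eq_sym tn0.
have -> : r ^+ 2 = (1 - t) * r ^+ 2 + t * r ^+ 2 by ring.
by apply: ler_ltD; [rewrite ler_wpM2l// ltW|rewrite ltr_pM2l].
Qed.

Lemma sphere_path_start u v : qIm u != 0 -> sphere_path u v 0 = u.
Proof.
move=> u0; rewrite /sphere_path subr0 scale1r scale0r addr0 -/(im_norm u).
rewrite divff ?gt_eqF ?im_norm_gt0// scale1r.
move: {u0} u; elim/quatW => a b c e.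
by rewrite realA !mkquatE !mkquatDE addr0 !add0r.
Qed.

Lemma sphere_path_end u v : qIm u != 0 -> u 0 0 = v 0 0 ->
  quat_sqnorm (qIm u) = quat_sqnorm (qIm v) -> sphere_path u v 1 = v.
Proof.
move=> u0 uv0 uv; have v0 : qIm v != 0 by rewrite -quat_sqnorm_eq0 -uv quat_sqnorm_eq0.
rewrite /sphere_path subrr scale0r add0r scale1r uv0 /im_norm uv -/(im_norm v).
rewrite divff ?gt_eqF ?im_norm_gt0// scale1r.
move: {u0 v0 uv0 uv} v; elim/quatW => a b c e.
by rewrite realA !mkquatE !mkquatDE addr0 !add0r.
Qed.

Lemma sphere_path_continuous u v t : sphere_mid u v t != 0 ->
  {for t, continuous (sphere_path u v)}.
Proof.
move=> w0; have cl (a b : R) : {for t, continuous (fun s : R => (1 - s) * a + s * b)}.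
  have c1 : {for t, continuous (fun s : R => 1 - s)}.
    by apply: cvgB; [exact: cvg_cst|exact: cvg_id].
  apply: cvgD; apply: cvgM; (try exact: cvg_cst); [exact: c1|exact: cvg_id].
have cm l : {for t, continuous (fun t => sphere_mid u v t 0 l)}.
  have -> : (fun t => sphere_mid u v t 0 l) = fun t => (1 - t) * qIm u 0 l + t * qIm v 0 l.
    by apply/funext => s; rewrite /sphere_mid quat_addE !(quat_scaleE _ (qIm _)).
  exact: cl.
have cN : {for t, continuous (fun t => quat_sqnorm (sphere_mid u v t))}.
  have cs l : {for t, continuous (fun t => sphere_mid u v t 0 l ^+ 2)}.
    have -> : (fun t => sphere_mid u v t 0 l ^+ 2) = fun t => sphere_mid u v t 0 l * sphere_mid u v t 0 l.
      by apply/funext => s; rewrite expr2.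
    exact: (cvgM (cm l) (cm l)).
  exact: (cvgD (cvgD (cvgD (cs 0) (cs 1)) (cs 2)) (cs 3)).
have cS : {for t, continuous (fun t => (Num.sqrt (quat_sqnorm (sphere_mid u v t)))^-1)}.
  apply: cvgV.
    by rewrite gt_eqF// sqrtr_gt0 lt_neqAle eq_sym quat_sqnorm_eq0 w0 quat_sqnorm_ge0.
  apply: (@continuous_comp _ _ _ (fun t => quat_sqnorm (sphere_mid u v t)) Num.sqrt) => //.
  exact: sqrt_continuous.
apply/quat_continuousP => l.
have -> : (fun z => sphere_path u v z 0 l) = fun z => ((u 0 0)%:A : quat R) 0 l +
    im_norm u * (Num.sqrt (quat_sqnorm (sphere_mid u v z)))^-1 * sphere_mid u v z 0 l.
  by apply/funext => s; rewrite /sphere_path quat_addE quat_scaleE.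
apply: cvgD; first exact: cvg_cst.
by apply: cvgM; [apply: cvgM => //; exact: cvg_cst|exact: cm].
Qed.

(* The straight segment between two points of a sphere meets the centre only
   for antipodal points. *)
Lemma sphere_mid_neq0 u v t : qIm u != 0 ->
  quat_sqnorm (qIm u) = quat_sqnorm (qIm v) -> qIm v != - qIm u ->
  sphere_mid u v t != 0.
Proof.
move=> u0 uv vu; apply: contra_neq vu => /(congr1 (fun x : quat R => x)) w0.
have E l : l != 0 -> (1 - t) * u 0 l + t * v 0 l = 0.
  by move=> l0; rewrite -sphere_midE// w0 quat_0E.
(* With equal norms the segment can pass through [0] only at its midpoint, and then the end points
   are antipodal. *)
have N : (1 - t) ^+ 2 = t ^+ 2.
  have n0 : quat_sqnorm (qIm u) != 0 by rewrite quat_sqnorm_eq0.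
  apply: (mulIf n0); rewrite {2}uv !quat_sqnorm_qIm !mulrDr -!exprMn.
  have e l : l != 0 -> ((1 - t) * u 0 l) ^+ 2 = (t * v 0 l) ^+ 2.
    by move=> /E/eqP; rewrite addr_eq0 => /eqP ->; rewrite sqrrN.
  by rewrite !e.
have t2 : t = 2^-1.
  have e : 1 - 2 * t = (1 - t) ^+ 2 - t ^+ 2 by ring.
  by move: e; rewrite N subrr => e; lra.
have V l : l != 0 -> v 0 l = - u 0 l.
  by move=> /E; rewrite t2 => e; lra.
apply: quatP; rewrite quat_oppE !qImE ?oppr0 ?V//.
Qed.

End spheres.

(** The target of [g] carries no structure, so the real indicator [h] of the condition
    [g (gamma t) = g (gamma 0)] is used: it is locally constant along the path, hence has zero
    derivative. *)
Lemma locally_constant_path (R : realType) (T : topologicalType) (W : Type)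
    (g : T -> W) (A : set T) (gamma : R -> T) :
  (forall t : R, 0 <= t <= 1 -> {for t, continuous gamma}) ->
  (forall t : R, 0 <= t <= 1 -> \forall s \near t, A (gamma s)) ->
  locally_constant_on A g -> g (gamma 0) = g (gamma 1).
Proof.
move=> cg Ag lg; pose h t : R := if `[< g (gamma t) = g (gamma 0) >] then 1 else 0.
have hn (t : R) : 0 <= t <= 1 -> \forall s \near t, h s = h t.
  move=> t01; have At := nbhs_singleton (Ag t t01).
  have gn : \forall s \near t, A (gamma s) -> g (gamma s) = g (gamma t).
    exact: cg t t01 _ (lg _ At).
  by apply: filterS2 (Ag t t01) gn => s As /(_ As) e; rewrite /h e.
have dh (t : R) : 0 <= t <= 1 -> is_derive t 1 h 0.
  move=> t01; apply: (@near_eq_is_derive _ _ _ (fun=> h t)).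
    by apply: filterS (hn t t01) => s ->.
have h01 : h 0 = h 1.
  apply: (@is_derive0_outside_seq_cst _ _ [::]) => //; last first.
    by move=> x /andP[x0 x1] _; apply: dh; rewrite !ltW.
  apply/continuous_in_subspaceT => t /set_mem/=; rewrite in_itv => /dh dt.
  by apply: differentiable_continuous; exact/derivable1_diffP.
move: h01; rewrite /h; case: asboolP => // _; case: asboolP => [e _|_ /eqP].
  by rewrite e.
by rewrite oner_eq0.
Qed.

(** * Products of Euclidean balls *)

Section boxes.
Variables (R : realType) (n : nat).
Implicit Types (f g : 'M[R]_(n, 4) -> quat R) (p x y : 'M[R]_(n, 4))
  (U D : set 'M[R]_(n, 4)) (i : 'I_n) (c l : 'I_4) (K : {set 'I_n}) (r : R).

(** Not a ball of the sup norm of matrices: [sphere_path_ball] needs a Euclidean ball in each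
    quaternionic coordinate. *)
Definition ebox p r : set 'M[R]_(n, 4) :=
  [set x | forall i, quat_sqnorm (qcoord x i - qcoord p i) < r ^+ 2].

(** Each factor of the box is either centred on the real axis or disjoint from it. *)
Definition good_radius p r := 0 < r /\
  forall i, qIm (qcoord p i) != 0 -> r ^+ 2 <= quat_sqnorm (qIm (qcoord p i)).

Lemma quat_sqnorm_ge_coord (a : quat R) l : a 0 l ^+ 2 <= quat_sqnorm a.
Proof.
have := sqr_ge0 (a 0 0); have := sqr_ge0 (a 0 1); have := sqr_ge0 (a 0 2).
have := sqr_ge0 (a 0 3); rewrite /quat_sqnorm.
by move: l; apply: ord4_ind; lra.
Qed.

Lemma ebox_center p r : 0 < r -> ebox p r p.
Proof.
move=> r0 i; rewrite subrr (_ : quat_sqnorm 0 = 0) ?exprn_gt0//.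
by apply/eqP; rewrite quat_sqnorm_eq0.
Qed.

Lemma quat_sqnorm_continuous (a : quat R) : {for a, continuous (@quat_sqnorm R)}.
Proof.
have c l : {for a, continuous (fun a : quat R => a 0 l ^+ 2)}.
  have -> : (fun a : quat R => a 0 l ^+ 2) = fun a => a 0 l * a 0 l.
    by apply/funext => z; rewrite expr2.
  have cl : {for a, continuous (fun a : quat R => a 0 l)}.
    exact: (@coord_continuous R 1 4 0 l).
  exact: (cvgM cl cl).
exact: (cvgD (cvgD (cvgD (c 0) (c 1)) (c 2)) (c 3)).
Qed.

Lemma qcoord_continuous i x : {for x, continuous (fun z : 'M[R]_(n, 4) => qcoord z i)}.
Proof.
apply/quat_continuousP => l.
have -> : (fun z : 'M[R]_(n, 4) => qcoord z i 0 l) = fun z => z i l.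
  by apply/funext => z; rewrite qcoordE.
exact: coord_continuous.
Qed.

Lemma open_ebox p r : open (ebox p r).
Proof.
rewrite openE => x xp; rewrite /interior.
apply: (@filter_forall _ _ (fun i y => quat_sqnorm (qcoord y i - qcoord p i) < r ^+ 2) (nbhs x)) => i.
have c : {for x, continuous (fun y : 'M[R]_(n, 4) => quat_sqnorm (qcoord y i - qcoord p i))}.
  apply: (@continuous_comp _ _ _ (fun y : 'M[R]_(n, 4) => qcoord y i - qcoord p i) (@quat_sqnorm R)).
    exact: (@cvgB R (quat R) _ (nbhs x) _ (fun y => qcoord y i) (fun=> qcoord p i) _ _
      (@qcoord_continuous i x) (cvg_cst _)).
  exact: quat_sqnorm_continuous.
exact: (cvgr_lt _ c _ (xp i)).
Qed.

Lemma ebox_norm p r x : 0 < r -> ebox p r x -> `|x - p| <= r.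
Proof.
move=> r0 xp; apply/mx_norm_leP => [|i l]; first exact: ltW.
rewrite -ler_sqr ?nnegrE ?(ltW r0)// real_normK ?num_real//.
apply: ltW; apply: le_lt_trans (xp i); apply: le_trans (quat_sqnorm_ge_coord _ l).
by rewrite quat_addE quat_oppE !qcoordE !mxE.
Qed.

Lemma exists_good_radius U p (r0 : R) : open U -> U p -> 0 < r0 ->
  exists r, [/\ good_radius p r, r <= r0 & ebox p r `<=` U].
Proof.
move=> oU Up r00.
have [d /= d0 dU] : exists2 d : R, 0 < d & forall x, `|x - p| < d -> U x.
  have /nbhs_ballP[d /= d0 dU] := open_nbhs_nbhs (conj oU Up).
  by exists d => // x xd; apply: dU; rewrite -ball_normE/= distrC.
have [e e0 eP] : exists2 e : R, 0 < e &
    forall i, qIm (qcoord p i) != 0 -> e <= im_norm (qcoord p i).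
  exists (\big[Num.min/1]_(i < n | qIm (qcoord p i) != 0) im_norm (qcoord p i)).
    by apply: lt_bigmin => // i; exact: im_norm_gt0.
  by move=> i pi; exact: bigmin_le_cond.
pose r := Num.min r0 (Num.min (d / 2) e).
have r_gt0 : 0 < r by rewrite !lt_min r00 e0 divr_gt0.
have [rr0 [rd re]] : r <= r0 /\ r <= d / 2 /\ r <= e.
  by rewrite /r !ge_min !lexx /= !orbT.
exists r; split => //.
- split => // i pi; rewrite quat_sqnorm_qIm -sqr_im_norm ler_sqr ?nnegrE ?(ltW r_gt0) ?(ltW (im_norm_gt0 pi))//.
  by apply: le_trans re _; exact: eP.
- move=> x /(ebox_norm r_gt0) xr; apply: dU; apply: le_lt_trans xr _.
  by apply: le_lt_trans rd _; rewrite ltr_pdivrMr// ltr_pMr// ltr1n.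
Qed.

Lemma polysphereP m x y : polysphere m y x <->
  (forall i, (i < m)%N -> qcoord y i 0 0 = qcoord x i 0 0 /\
     quat_sqnorm (qIm (qcoord y i)) = quat_sqnorm (qIm (qcoord x i))) /\
  (forall i, (m <= i)%N -> qcoord x i = qcoord y i).
Proof.
split=> [h|[h1 h2] i].
  by split=> i im; have := h i; [rewrite im => /qsphereP|rewrite ltnNge im].
by case: ifPn => [/h1/qsphereP//|]; rewrite -leqNgt => /h2.
Qed.

Lemma subst_coord_continuous x i : continuous (fun a : quat R => subst_coord x i a).
Proof.
move=> a.
have E : (fun a : quat R => subst_coord x i a) =
    fun a => subst_coord x i 0 + \sum_c a 0 c *: (delta_mx i c : 'M[R]_(n, 4)).
  apply/funext => b; apply/matrixP => j l.
  have sE (b' : quat R) : subst_coord x i b' j l = if j == i then b' 0 l else x j l by exact: mxE.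
  have dE c : (b 0 c *: (delta_mx i c : 'M[R]_(n, 4))) j l = b 0 c * ((j == i) && (l == c))%:R.
    by rewrite !mxE.
  rewrite sE [RHS]mxE summxE (bigD1 l)//= big1 ?addr0 => [|c cl]; last first.
    by rewrite dE [l == c]eq_sym (negPf cl) andbF mulr0.
  rewrite dE sE eqxx andbT; case: eqP => _; rewrite ?mulr1 ?mulr0 ?addr0//.
  by rewrite quat_0E add0r.
have sc : {for a, continuous (fun b : quat R => \sum_c b 0 c *: (delta_mx i c : 'M[R]_(n, 4)))}.
  apply: (@sum_continuous R (quat R) 'M[R]_(n, 4)) => c.
  apply: (@cvgZr_tmp R 'M[R]_(n, 4) _ (nbhs a) _ (fun b : quat R => b 0 c)).
  exact: (@coord_continuous R 1 4 0 c).
rewrite E.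
exact: (@cvgD R 'M[R]_(n, 4) _ (nbhs a) _ (fun=> subst_coord x i 0) _ _ _ (cvg_cst _) sc).
Qed.

Lemma ebox_subst p r x i (a : quat R) : ebox p r x ->
  quat_sqnorm (a - qcoord p i) < r ^+ 2 -> ebox p r (subst_coord x i a).
Proof.
move=> xp ap j; have [->|ji] := eqVneq j i; first by rewrite row_subst_coord.
by rewrite row_subst_coord_neq//; exact: xp.
Qed.

(** The two values of coordinate [i] are joined inside the box by a path on their sphere, along
    which [g] is locally constant. [sphere_path] degenerates between antipodal points; these are
    joined through a third point. *)
Lemma locally_constant_one_coord (W : Type) (g : 'M[R]_(n, 4) -> W) U p r m x i (a : quat R) :
  open U -> good_radius p r -> ebox p r `<=` U -> locally_constant_on (polysphere m x `&` U) g ->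
  (i < m)%N -> qIm (qcoord x i) != 0 -> ebox p r x -> ebox p r (subst_coord x i a) ->
  qcoord x i 0 0 = a 0 0 -> quat_sqnorm (qIm (qcoord x i)) = quat_sqnorm (qIm a) ->
  g x = g (subst_coord x i a).
Proof.
move=> oU [r0 gr] BU lg im; set u := qcoord x i => u0 xB aB ua0 ua.
have up : quat_sqnorm (u - qcoord p i) < r ^+ 2 by exact: xB.
have ap : quat_sqnorm (a - qcoord p i) < r ^+ 2.
  by have := aB i; rewrite row_subst_coord.
have poly (b : quat R) : b 0 0 = u 0 0 -> quat_sqnorm (qIm b) = quat_sqnorm (qIm u) ->
    polysphere m x (subst_coord x i b).
  move=> b0 bu; apply/polysphereP; split=> j jm.
    by have [->|ji] := eqVneq j i; rewrite ?row_subst_coord ?row_subst_coord_neq.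
  by rewrite row_subst_coord_neq//; apply: contraTneq jm => ->; rewrite -ltnNge.
have key (v v' : quat R) : v 0 0 = u 0 0 -> quat_sqnorm (qIm v) = quat_sqnorm (qIm u) ->
    v' 0 0 = u 0 0 -> quat_sqnorm (qIm v') = quat_sqnorm (qIm u) ->
    quat_sqnorm (v - qcoord p i) < r ^+ 2 -> quat_sqnorm (v' - qcoord p i) < r ^+ 2 ->
    qIm v' != - qIm v -> g (subst_coord x i v) = g (subst_coord x i v').
  move=> v0 vu v'0 v'u vp v'p vv'.
  have vn0 : qIm v != 0 by rewrite -quat_sqnorm_eq0 vu quat_sqnorm_eq0.
  have e1 : v 0 0 = v' 0 0 by rewrite v0 v'0.
  have e2 : quat_sqnorm (qIm v) = quat_sqnorm (qIm v') by rewrite vu v'u.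
  have w0 t := @sphere_mid_neq0 R v v' t vn0 e2 vv'.
  have cp t : {for t, continuous (fun t => subst_coord x i (sphere_path v v' t))}.
    apply: (@continuous_comp _ _ _ (sphere_path v v') (fun a => subst_coord x i a)).
      exact: sphere_path_continuous.
    exact: subst_coord_continuous.
  have := @locally_constant_path R _ _ g _ (fun t => subst_coord x i (sphere_path v v' t)) _ _ lg.
  rewrite sphere_path_start// sphere_path_end//; apply; first by move=> t _; exact: cp.
  move=> t t01.
  have Bt : ebox p r (subst_coord x i (sphere_path v v' t)).
    apply: ebox_subst => //; apply: sphere_path_ball => //; exact: gr.
  have : \forall s \near t, ebox p r (subst_coord x i (sphere_path v v' s)).
    exact: (cp t _ (open_nbhs_nbhs (conj (@open_ebox p r) Bt))).
  apply: filterS => s Bs; split; last exact: BU.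
  by apply: poly; rewrite ?sphere_path0// sphere_path_sqnorm.
rewrite -{1}(subst_coord_id x i) -/u.
have [au|au] := eqVneq (qIm a) (- qIm u); last exact: key.
have [e [e0 eu ep [eu1 eu2]]] : exists e : quat R, [/\ e 0 0 = u 0 0,
    quat_sqnorm (qIm e) = quat_sqnorm (qIm u), quat_sqnorm (e - qcoord p i) < r ^+ 2
    & qIm e != - qIm u /\ qIm a != - qIm e].
  have A l : l != 0 -> a 0 l = - u 0 l.
    have := congr1 (fun q : quat R => q 0 l) au; rewrite quat_oppE.
    by move: l; apply: ord4_ind => //; rewrite !qImE.
  (* Two antipodal points lie in the ball only if its centre is real, and then the ball contains
     their whole sphere. *)
  have pi0 : qIm (qcoord p i) = 0.
    apply/eqP/negPn/negP => pi0; have rp := gr i pi0.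
    have h1 := quat_sqnorm_ge0 (qIm u); have h2 := sqr_ge0 (u 0 0 - qcoord p i 0 0).
    have da : im_dot a (qcoord p i) = - im_dot u (qcoord p i).
      by rewrite /im_dot !A//; ring.
    by move: up ap; rewrite !sqnormB_dot -ua0 -ua da; lra.
  have ball (e : quat R) : e 0 0 = u 0 0 -> quat_sqnorm (qIm e) = quat_sqnorm (qIm u) ->
      quat_sqnorm (e - qcoord p i) < r ^+ 2.
    move=> e0 eu; move: up; rewrite !sqnormB_dot e0 eu.
    move/eqP: pi0; rewrite qIm_eq0 => /and3P[/eqP p1 /eqP p2 /eqP p3].
    by rewrite /im_dot p1 p2 p3 !mulr0.
  have neg (e : quat R) : qIm e != qIm u -> qIm a != - qIm e.
    by rewrite au eqr_opp eq_sym.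
  have nz : ~ [/\ u 0 1 = 0, u 0 2 = 0 & u 0 3 = 0].
    by case=> h1 h2 h3; move/negP: u0; apply; rewrite qIm_eq0 h1 h2 h3 eqxx.
  have ne (e f : quat R) l : l != 0 -> e 0 l != f 0 l -> qIm e != qIm f.
    move=> l0; apply: contra_neq => /(congr1 (fun q : quat R => q 0 l)).
    by move: l l0; apply: ord4_ind => //; rewrite !qImE.
  pose mu := - u.
  have muE : - qIm u = qIm mu.
    by apply: quatP; rewrite quat_oppE !qImE ?oppr0// /mu quat_oppE.
  (* The third point must differ from [u] and from its antipode. A cyclic shift of the imaginary
     components does, unless they are all equal; then one sign is flipped. *)
  have [/andP[/eqP u12 /eqP u23]|] := boolP ((u 0 1 == u 0 2) && (u 0 2 == u 0 3)).
    have u30 : u 0 3 != 0.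
      by apply/eqP => u3; apply: nz; rewrite u12 u23 u3.
    pose e := mkquat (u 0 0) (u 0 1) (u 0 2) (- u 0 3).
    have e0 : e 0 0 = u 0 0 by rewrite mkquatE.
    have eu : quat_sqnorm (qIm e) = quat_sqnorm (qIm u).
      by rewrite !quat_sqnorm_qIm !mkquatE sqrrN.
    exists e; split => //; first exact: ball.
    rewrite muE; split; last apply: neg.
      apply: (@ne _ _ 1) => //; rewrite mkquatE /mu quat_oppE.
      by rewrite u12 u23 -subr_eq0 opprK -mulr2n mulrn_eq0.
    apply: (@ne _ _ 3) => //; rewrite mkquatE.
    by rewrite eq_sym -subr_eq0 opprK -mulr2n mulrn_eq0.
  rewrite negb_and => u123.
  pose e := mkquat (u 0 0) (u 0 2) (u 0 3) (u 0 1).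
  have e0 : e 0 0 = u 0 0 by rewrite mkquatE.
  have eu : quat_sqnorm (qIm e) = quat_sqnorm (qIm u).
    by rewrite !quat_sqnorm_qIm !mkquatE; ring.
  exists e; split => //; first exact: ball.
  rewrite muE; split.
    apply/negP => /eqP E; apply: nz.
    have E1 := congr1 (fun q : quat R => q 0 1) E.
    have E2 := congr1 (fun q : quat R => q 0 2) E.
    have E3 := congr1 (fun q : quat R => q 0 3) E.
    move: E1 E2 E3; rewrite /= !qImE !mkquatE /mu !quat_oppE => E1 E2 E3.
    by split; lra.
  apply: neg; case/orP: u123 => h.
    by apply: (@ne _ _ 1) => //; rewrite mkquatE eq_sym.
  by apply: (@ne _ _ 2) => //; rewrite mkquatE eq_sym.
transitivity (g (subst_coord x i e)); first exact: key.
exact: key.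
Qed.

End boxes.

(** * Slice functions on boxes *)

Section slice_boxes.
Variables (R : realType) (n : nat).
Implicit Types (f g : 'M[R]_(n, 4) -> quat R) (p x y : 'M[R]_(n, 4))
  (U D W : set 'M[R]_(n, 4)) (i : 'I_n) (c l : 'I_4) (K : {set 'I_n}) (r : R).

(** A common form of the two slice conditions: strongly slice functions satisfy it on all of [U],
    locally strongly slice ones on every good box inside [U]. *)
Definition slice_on W f := forall m K x x', (m <= n)%N ->
  K \subset first_coords n m -> W x -> W x' ->
  (forall i, qIm (qcoord x i) != 0) -> polysphere m x x' ->
  Gamma m K f x = Gamma m K f x'.

(** A good box meets a polysphere in a product of caps, so coordinates can be moved one at a time.
    The intermediate point [z k] has the first [k] coordinates of [x'] and the others of [x]. *)
Lemma slice_on_ebox U p r f : open U -> locally_strongly_slice U f ->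
  good_radius p r -> ebox p r `<=` U -> slice_on (ebox p r) f.
Proof.
move=> oU [_ _ lf] gr BU m K x x' mn KS xB x'B nx /polysphereP[h1 h2].
case: m => [|m] in mn KS h1 h2 *.
  congr (Gamma _ _ _ _); apply/row_matrixP => i; exact/esym/h2.
pose z k : 'M[R]_(n, 4) := \matrix_(l, c) if (l < k)%N then x' l c else x l c.
have zE k i : qcoord (z k) i = if (i < k)%N then qcoord x' i else qcoord x i.
  by apply/rowP => l; rewrite !mxE; case: ifP; rewrite !mxE.
have zB k : ebox p r (z k) by move=> i; rewrite zE; case: ifP => _; [exact: x'B|exact: xB].
suff H k : (k <= m.+1)%N -> Gamma m.+1 K f x = Gamma m.+1 K f (z k).
  rewrite (H m.+1)//; congr (Gamma _ _ _ _); apply/row_matrixP => i.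
  rewrite -/(qcoord _ _) zE; case: ltnP => // mi; exact/esym/h2.
elim: k => [_|k IH km].
  congr (Gamma _ _ _ _); apply/row_matrixP => i.
  by rewrite -!/(qcoord _ _) zE.
rewrite IH ?(ltnW km)//.
have kn : (k < n)%N by exact: leq_trans km mn.
pose i := Ordinal kn.
have zk : qcoord (z k) i = qcoord x i by rewrite zE ltnn.
have -> : z k.+1 = subst_coord (z k) i (qcoord x' i).
  apply/row_matrixP => j; rewrite -!/(qcoord _ _) zE.
  have [->|ji] := eqVneq j i; first by rewrite row_subst_coord ltnSn.
  by rewrite row_subst_coord_neq// zE ltnS leq_eqVlt (_ : (val j == val i) = false)//; exact: negPf.
have nz : (U `\` @real_points R n) (z k).
  split; first exact: BU.
  apply/nonrealP => j; rewrite zE; case: ifP => jk //.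
  have [_ e] := h1 j (leq_trans jk (ltnW km)).
  by rewrite -quat_sqnorm_eq0 -e quat_sqnorm_eq0.
have [e1 e2] := h1 i km.
apply: (@locally_constant_one_coord R n _ (Gamma m.+1 K f) U p r m.+1) => //.
- exact: lf.
- by rewrite zk.
- by apply: ebox_subst => //; exact: x'B.
- by rewrite zk.
- by rewrite zk.
Qed.

Lemma sum_powerset_first_coords (V : nmodType) i (F : {set 'I_n} -> V) :
  \sum_(K in powerset (first_coords n i.+1)) F K =
  \sum_(K in powerset (first_coords n i)) (F (i |: K)%SET + F K).
Proof.
have iN (K : {set 'I_n}) : K \subset first_coords n i -> i \notin K.
  by move=> /fintype.subsetP KS; apply/negP => /KS; rewrite inE ltnn.
rewrite big_split/= (bigID (fun K : {set 'I_n} => i \in K))/=; congr (_ + _).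
- rewrite (reindex_onto (fun K => i |: K)%SET (fun K => K :\ i)%SET)/=.
    by apply: eq_bigl => K; rewrite !powersetE setU11 andbT;
      apply/andP/idP => [[KS /eqP <-]|KS];
      [exact: subset_first_coordsS|rewrite finset.setU1K ?iN// eqxx; split=> //;
      apply/fintype.subsetP => j; rewrite !inE => /orP[/eqP ->//|/(fintype.subsetP KS)];
      rewrite inE => /ltnW].
  by move=> K /andP[_ iK]; rewrite finset.setD1K.
- apply: eq_bigl => K; rewrite !powersetE.
  apply/andP/idP => [[KS iK]|KS].
    have := subset_first_coordsS KS.
    by rewrite (_ : (K :\ i = K)%SET)//; apply/setP => j; rewrite !inE; case: eqP => // ->; rewrite (negPf iK).
  split; last exact: iN.
  apply: (fintype.subset_trans KS); apply/fintype.subsetP => j.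
  by rewrite !inE => /ltnW.
Qed.

(** The factors of [neg_conj_prod] do not commute, so positions matter: [i] is the largest index of
    [H] and stands last. Both lists are strictly sorted and have the same elements. *)
Lemma enum_first_coordsS i (H : {set 'I_n}) : i \in H -> H \subset first_coords n i.+1 ->
  enum H = rcons (enum (H :\ i)%SET) i.
Proof.
move=> iH HS.
pose e := fun a b : 'I_n => (a < b)%N.
have etr : transitive e by move=> b a c; exact: ltn_trans.
have srt (A : {set 'I_n}) : sorted e (enum A).
  rewrite /enum_mem -enumT; apply: sorted_filter => //.
  by have := iota_ltn_sorted 0 n; rewrite -val_enum_ord sorted_map.
apply: (irr_sorted_eq etr) => //; first by move=> a; rewrite /e ltnn.
  rewrite sorted_pairwise// pairwise_rcons -sorted_pairwise// srt andbT.
  apply/allP => j; rewrite mem_enum => jH.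
  have /fintype.subsetP/(_ _ jH) := subset_first_coordsS HS.
  by rewrite inE.
move=> j; rewrite mem_rcons !inE !mem_enum !inE.
by case: eqP => // ->.
Qed.

Lemma neg_conj_prodS i (H : {set 'I_n}) x : i \in H -> H \subset first_coords n i.+1 ->
  neg_conj_prod H x = neg_conj_prod (H :\ i)%SET x * - qconj (qcoord x i).
Proof.
move=> iH HS; rewrite /neg_conj_prod (enum_first_coordsS iH HS) -cats1 big_cat/=.
by rewrite big_seq1.
Qed.

Lemma eq_neg_conj_prod (H : {set 'I_n}) x y :
  (forall i, i \in H -> qcoord x i = qcoord y i) ->
  neg_conj_prod H x = neg_conj_prod H y.
Proof.
by move=> xy; apply: eq_big_seq => i; rewrite mem_enum => /xy ->.
Qed.

Lemma first_coordsSD i K : K \subset first_coords n i ->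
  [/\ (first_coords n i.+1 :\: (i |: K) = first_coords n i :\: K)%SET,
      i \in (first_coords n i.+1 :\: K)%SET &
      ((first_coords n i.+1 :\: K) :\ i = first_coords n i :\: K)%SET].
Proof.
move=> /fintype.subsetP KS.
have iK : i \notin K by apply/negP => /KS; rewrite inE ltnn.
have lt (j : 'I_n) : (j < i.+1)%N = (j == i) || (j < i)%N by rewrite ltnS leq_eqVlt.
split; [apply/setP => j|by rewrite !inE ltnSn iK|apply/setP => j].
  rewrite !inE negb_or lt.
  by case: (eqVneq j i) => [->|] //=; rewrite ltnn andbF.
rewrite !inE lt.
by case: (eqVneq j i) => [->|] //=; rewrite ltnn andbF.
Qed.

Lemma sum_neg_conj_prodS i (F : {set 'I_n} -> quat R) x :
  \sum_(K in powerset (first_coords n i.+1))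
    neg_conj_prod (first_coords n i.+1 :\: K)%SET x * F K =
  \sum_(K in powerset (first_coords n i))
    neg_conj_prod (first_coords n i :\: K)%SET x *
    (F (i |: K)%SET + - qconj (qcoord x i) * F K).
Proof.
rewrite sum_powerset_first_coords; apply: eq_bigr => K; rewrite powersetE => KS.
have [-> iS e] := first_coordsSD KS.
rewrite (neg_conj_prodS x iS) ?e; last by apply/fintype.subsetP => j; rewrite !inE => /andP[].
by rewrite mulrDr mulrA.
Qed.

Lemma first_coords0 : first_coords n 0 = finset.set0.
Proof. by apply/setP => j; rewrite !inE. Qed.

Lemma sum_neg_conj_prod0 (F : {set 'I_n} -> quat R) x :
  \sum_(K in powerset (first_coords n 0))
    neg_conj_prod (first_coords n 0 :\: K)%SET x * F K = F finset.set0.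
Proof.
rewrite first_coords0 powerset0 big_set1 finset.set0D /neg_conj_prod.
by rewrite (_ : enum _ = [::]) ?big_nil ?mul1r//; exact: enum_set0.
Qed.

Lemma qconj_inj : injective (@qconj R).
Proof.
move=> a b ab; have e l := congr1 (fun q : quat R => q 0 l) ab.
have := e 0; have := e 1; have := e 2; have := e 3.
rewrite /= /qconj !mkquatE => e3 e2 e1 e0.
by apply: quatP; [|apply: oppr_inj|apply: oppr_inj|apply: oppr_inj].
Qed.

Lemma qconjB (a b : quat R) : qconj (a - b) = qconj a - qconj b.
Proof. by apply: quatP; rewrite /qconj !quatE ?opprD. Qed.

(* The product representation determines its coefficients: two values of each
   coordinate suffice to separate them, one variable at a time. *)
Lemma neg_conj_prod_coefficients (T : Type) (CC : (T -> quat R) -> Prop) (m : nat)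
    (c : {set 'I_n} -> T -> quat R) x (b : 'I_n -> quat R) :
  (forall f g : T -> quat R, CC f -> CC g -> CC (fun t => f t - g t)) ->
  (forall (a : quat R) (f : T -> quat R), CC f -> CC (fun t => a * f t)) ->
  (m <= n)%N -> (forall i, b i != qcoord x i) ->
  (forall z, (forall i, qcoord z i = qcoord x i \/ qcoord z i = b i) ->
    CC (fun t => \sum_(K in powerset (first_coords n m))
      neg_conj_prod (first_coords n m :\: K)%SET z * c K t)) ->
  forall K, K \subset first_coords n m -> CC (c K).
Proof.
(* [CC] is any property stable under differences and left multiplication; it serves both for
   vanishing and for having a continuous extension. *)
move=> CB CM; elim: m c => [|m IH] c mn bx h K KS.
  have := h x (fun i => or_introl erefl).
  move: KS; rewrite first_coords0 finset.subset0 => /eqP ->.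
  by congr CC; apply/funext => t; rewrite -first_coords0 sum_neg_conj_prod0 first_coords0.
pose i := Ordinal mn; rewrite -[m]/(val i) in h KS IH *.
have key w : w = qcoord x i \/ w = b i -> forall K, K \subset first_coords n i ->
    CC (fun t => c (i |: K)%SET t + - qconj w * c K t).
  move=> wE; apply: IH => //; first exact: ltnW.
  move=> z zE; have := h (subst_coord z i w) _.
  rewrite (_ : (fun t => _) = fun t => \sum_(K in powerset (first_coords n i))
      neg_conj_prod (first_coords n i :\: K)%SET z * (c (i |: K)%SET t + - qconj w * c K t)).
    apply=> j; have [->|ji] := eqVneq j i; first by rewrite row_subst_coord.
    by rewrite row_subst_coord_neq.
  apply/funext => t; rewrite sum_neg_conj_prodS; apply: eq_bigr => L _.
  rewrite row_subst_coord; congr (_ * _); apply: eq_neg_conj_prod => j.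
  rewrite !inE => /andP[_ ji]; rewrite row_subst_coord_neq//.
  by apply: contraTneq ji => ->; rewrite ltnn.
(* For [L] without [i], the two instances of [key] differ by [d * c L], where [d] is the conjugate
   of [b i - qcoord x i] and hence invertible. *)
have low (L : {set 'I_n}) : L \subset first_coords n i -> CC (c L).
  move=> LS; have := CB _ _ (key _ (or_introl erefl) L LS) (key _ (or_intror erefl) L LS).
  pose d := qconj (b i - qcoord x i).
  have d0 : d != 0.
    apply: contra_neq (bx i) => d0; apply/eqP; rewrite -subr_eq0; apply/eqP/qconj_inj.
    by rewrite -/d d0; apply: quatP; rewrite /qconj !quatE ?oppr0.
  move=> /(CM d^-1); congr CC; apply/funext => t.
  rewrite opprD addrACA subrr add0r -mulrBl -opprD.
  rewrite (_ : - (qconj (qcoord x i) - qconj (b i)) = d); last first.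
    by rewrite opprB /d qconjB.
  by rewrite mulKr ?quat_unitE.
have [iK|iK] := boolP (i \in K); last first.
  apply: low; have := subset_first_coordsS KS.
  by rewrite (_ : (K :\ i = K)%SET)//; apply/setP => j; rewrite !inE; case: eqP => // ->; rewrite (negPf iK).
have LS := subset_first_coordsS KS; set L := (K :\ i)%SET in LS.
have KE : K = (i |: L)%SET by rewrite finset.setD1K.
have := CB _ _ (key _ (or_introl erefl) L LS) (CM (- qconj (qcoord x i)) _ (low L LS)).
by congr CC; apply/funext => t; rewrite addrK KE.
Qed.

Lemma Gamma_sum D f m x : open D -> (forall x i, D x -> qIm (qcoord x i) != 0) ->
  qsmooth n D f -> (m <= n)%N -> D x ->
  f x = \sum_(K in powerset (first_coords n m))
    neg_conj_prod (first_coords n m :\: K)%SET x * Gamma m K f x.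
Proof.
move=> oD y0 sf mn Dx; elim: m mn => [|m IH] mn; first by rewrite sum_neg_conj_prod0.
pose i := Ordinal mn; rewrite -[m]/(val i) in IH *.
rewrite sum_neg_conj_prodS IH; last exact: ltnW.
apply: eq_bigr => K; rewrite powersetE => KS; congr (_ * _).
apply: (Gamma_decomp oD) => //; apply/negP; move/fintype.subsetP: KS => KS /KS.
by rewrite inE ltnn.
Qed.

End slice_boxes.

(** * Small rotations of the imaginary part *)

Section rotations.
Variable R : realType.
Implicit Types (a b : quat R) (c s e : R).

Definition rot1 c s a : quat R :=
  mkquat (a 0 0) (a 0 1) (c * a 0 2 - s * a 0 3) (s * a 0 2 + c * a 0 3).
Definition rot2 c s a : quat R :=
  mkquat (a 0 0) (c * a 0 1 + s * a 0 3) (a 0 2) (- s * a 0 1 + c * a 0 3).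
Definition rot3 c s a : quat R :=
  mkquat (a 0 0) (c * a 0 1 - s * a 0 2) (s * a 0 1 + c * a 0 2) (a 0 3).

Lemma small_rotation e : 0 < e -> exists c s,
  [/\ c ^+ 2 + s ^+ 2 = 1, s != 0, c != 1 & 0 <= 2 - 2 * c < e].
Proof.
(* Rational parametrisation of the circle by [m]. The quantity [2 - 2 * c] is a squared chord
   length, and the choice of [m] bounds it by [4 * m ^+ 2 <= e / 2]. *)
move=> e0; pose m := Num.min 1 (e / 8).
have m0 : 0 < m by rewrite lt_min ltr01 divr_gt0.
have m1 : m <= 1 by rewrite ge_min lexx.
have me : m <= e / 8 by rewrite ge_min lexx orbT.
have d0 : 0 < 1 + m ^+ 2 by rewrite ltr_pwDl// sqr_ge0.
have dn0 : 1 + m ^+ 2 != 0 by rewrite gt_eqF.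
have mm : m ^+ 2 <= m by rewrite expr2 ler_piMr// ltW.
have m2 : 0 < m ^+ 2 by rewrite exprn_gt0.
have cE : 2 - 2 * ((1 - m ^+ 2) / (1 + m ^+ 2)) = 4 * m ^+ 2 / (1 + m ^+ 2) by field.
exists ((1 - m ^+ 2) / (1 + m ^+ 2)), (2 * m / (1 + m ^+ 2)); split.
- by field.
- by rewrite !mulf_neq0 ?invr_eq0 ?gt_eqF.
- rewrite -subr_eq0 (_ : _ - 1 = - (2 * m ^+ 2 / (1 + m ^+ 2))); last by field.
  by rewrite oppr_eq0 !mulf_neq0 ?invr_eq0 ?gt_eqF.
- rewrite cE divr_ge0 ?ltW//= ?mulr_gt0//.
  rewrite ltr_pdivrMr//; apply: (@le_lt_trans _ _ (e / 2)).
    by apply: (@le_trans _ _ (4 * m)); [rewrite ler_pM2l|]; lra.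
  by have := mulr_gt0 e0 m2; lra.
Qed.

Lemma rotation_sphere c s a : c ^+ 2 + s ^+ 2 = 1 ->
  [/\ quat_sqnorm (qIm (rot1 c s a)) = quat_sqnorm (qIm a),
      quat_sqnorm (qIm (rot2 c s a)) = quat_sqnorm (qIm a) &
      quat_sqnorm (qIm (rot3 c s a)) = quat_sqnorm (qIm a)].
Proof.
move=> cs; rewrite !quat_sqnorm_qIm !mkquatE.
have E (x y : R) : x ^+ 2 + y ^+ 2 = (c ^+ 2 + s ^+ 2) * (x ^+ 2 + y ^+ 2) by rewrite cs mul1r.
split.
- by rewrite -!addrA; congr (_ + _); rewrite [RHS]E; ring.
- rewrite addrAC [RHS]addrAC; congr (_ + _); rewrite [RHS]E; ring.
- congr (_ + _); rewrite [RHS]E; ring.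
Qed.

Lemma rotation_dist c s a : c ^+ 2 + s ^+ 2 = 1 ->
  [/\ quat_sqnorm (rot1 c s a - a) = (2 - 2 * c) * (a 0 2 ^+ 2 + a 0 3 ^+ 2),
      quat_sqnorm (rot2 c s a - a) = (2 - 2 * c) * (a 0 1 ^+ 2 + a 0 3 ^+ 2) &
      quat_sqnorm (rot3 c s a - a) = (2 - 2 * c) * (a 0 1 ^+ 2 + a 0 2 ^+ 2)].
Proof.
move=> cs.
rewrite /quat_sqnorm !quat_addE !quat_oppE !mkquatE.
have E (x y : R) : (c * x - s * y - x) ^+ 2 + (s * x + c * y - y) ^+ 2 =
    (1 + (c ^+ 2 + s ^+ 2) - 2 * c) * (x ^+ 2 + y ^+ 2) by ring.
have E1 : 1 + (c ^+ 2 + s ^+ 2) - 2 * c = 2 - 2 * c by rewrite cs; ring.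
by rewrite -E1; split; ring.
Qed.

(** Rotation about [k] moves [a], unless its [i]- and [j]-components vanish; then rotation about [i]
    does. The result is the second value of a coordinate that separating coefficients requires. *)
Lemma exists_near_on_sphere a e : 0 < e -> qIm a != 0 -> exists b : quat R,
  [/\ b != a, b 0 0 = a 0 0, quat_sqnorm (qIm b) = quat_sqnorm (qIm a) &
      quat_sqnorm (b - a) < e].
Proof.
move=> e0 a0; have N0 : 0 < quat_sqnorm (qIm a).
  by rewrite lt_neqAle eq_sym quat_sqnorm_eq0 a0 quat_sqnorm_ge0.
have [c [s [cs s0 c1 /andP[c2 c3]]]] := small_rotation (divr_gt0 e0 N0).
have [r1 _ r3] := rotation_sphere a cs; have [d1 _ d3] := rotation_dist a cs.
have c20 : 2 - 2 * c != 0.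
  by apply: contra_neq c1 => h; lra.
move: c3; rewrite ltr_pdivlMr// quat_sqnorm_qIm => c3.
have s1 := sqr_ge0 (a 0 1); have s2 := sqr_ge0 (a 0 2); have s3 := sqr_ge0 (a 0 3).
have ne (b : quat R) : quat_sqnorm (b - a) != 0 -> b != a.
  by rewrite quat_sqnorm_eq0 subr_eq0.
have [h|h] := eqVneq (a 0 1 ^+ 2 + a 0 2 ^+ 2) 0.
  exists (rot1 c s a); split; [|by rewrite mkquatE|by rewrite r1 quat_sqnorm_qIm|].
    apply: ne; rewrite d1 mulf_neq0//; apply: contraTneq N0 => h'.
    by rewrite quat_sqnorm_qIm -leNgt; lra.
  by rewrite d1; apply: le_lt_trans c3; rewrite ler_wpM2l//; lra.
exists (rot3 c s a); split; [|by rewrite mkquatE|by rewrite r3 quat_sqnorm_qIm|].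
  by apply: ne; rewrite d3 mulf_neq0.
by rewrite d3; apply: le_lt_trans c3; rewrite ler_wpM2l//; lra.
Qed.

End rotations.

(** * From [theta_bar] to [vartheta_bar] of each [Gamma] *)

Section theta_to_vartheta.
Variables (R : realType) (n : nat).
Implicit Types (f g : 'M[R]_(n, 4) -> quat R) (p x y z : 'M[R]_(n, 4))
  (U D W : set 'M[R]_(n, 4)) (i : 'I_n) (c l : 'I_4) (K : {set 'I_n}) (r : R).

Lemma derive_line (f : 'M[R]_(n, 4) -> quat R) x v :
  'D_v f x = 'D_1 (fun s : R => f (s *: v + x)) 0.
Proof.
rewrite /derive.
have -> : (fun h : R => h^-1 *: (((fun s : R => f (s *: v + x)) \o shift 0) (h *: 1) -
    f (0 *: v + x))) = (fun h : R => h^-1 *: ((f \o shift x) (h *: v) - f x)); last by [].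
apply/funext => h /=; have -> : 0 *: v + x = x by rewrite scale0r add0r.
by have -> : h *: 1 + 0 = h :> R by rewrite addr0; exact: mulr1.
Qed.

(** A derivative in variable [i] moves both points along parallel lines. They stay on a common
    polysphere of order [i], because that order leaves variable [i] fixed, and [Gamma i K f] takes
    equal values along them. *)
Lemma vartheta_Gamma_const D p r f i K x x' : open D -> good_radius p r ->
  (forall x i, D x -> qIm (qcoord x i) != 0) -> slice_on (ebox p r) f ->
  K \subset first_coords n i -> ebox p r x -> ebox p r x' -> D x ->
  polysphere i x x' ->
  vartheta_bar i (Gamma i K f) x = vartheta_bar i (Gamma i K f) x'.
Proof.
move=> oD gr y0 sf KS xB x'B Dx xx'; have /polysphereP[h1 h2] := xx'.
have xi : qcoord x' i = qcoord x i by exact: h2.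
suff dE c : pderiv i c (Gamma i K f) x = pderiv i c (Gamma i K f) x'.
  by rewrite !vartheta_barE !dE xi.
rewrite /pderiv !derive_line; apply: near_eq_derive.
have near_line z (W : set 'M[R]_(n, 4)) : open W -> W z ->
    \forall s \near (0 : R), W (s *: delta_mx i c + z).
  move=> oW Wz; have : {for 0, continuous (fun s : R => s *: delta_mx i c + z)} by exact: line_continuous.
  by apply; rewrite scale0r add0r; exact: open_nbhs_nbhs.
have n1 := near_line x _ (@open_ebox R n p r) xB.
have n2 := near_line x' _ (@open_ebox R n p r) x'B.
have n3 := near_line x D oD Dx.
near=> s.
have s1 : ebox p r (s *: delta_mx i c + x) by near: s.
have s2 : ebox p r (s *: delta_mx i c + x') by near: s.
have s3 : D (s *: delta_mx i c + x) by near: s.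
have qE z j : qcoord (s *: delta_mx i c + z) j =
    s *: qcoord (delta_mx i c : 'M[R]_(n, 4)) j + qcoord z j.
  by apply/rowP => l; rewrite !mxE.
apply: sf => //; [exact: ltnW|by move=> j; exact: y0|].
apply/polysphereP; split=> j ji; last by rewrite !qE h2.
have dj : qcoord (delta_mx i c : 'M[R]_(n, 4)) j = 0.
  apply/rowP => l; rewrite !mxE (_ : j == i = false)//.
  by apply: contraTF ji => /eqP ->; rewrite ltnn.
by rewrite !qE dj scaler0 !add0r; exact: h1.
Unshelve. all: end_near. Qed.

Lemma theta_bar_vartheta U f i K x : open U -> locally_strongly_slice U f ->
  (forall m x, (U `\` @real_points R n) x -> theta_bar m f x = 0) ->
  K \subset first_coords n i -> (U `\` @real_points R n) x ->
  vartheta_bar i (Gamma i K f) x = 0.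
Proof.
move=> oU lf th KS Dx; set D := U `\` _ in Dx th.
have oD : open D by exact: open_nonreal.
have DU : D `<=` U by move=> z [].
have y0 z j : D z -> qIm (qcoord z j) != 0 by move=> [_ /nonrealP].
have [r [gr _ rD]] := exists_good_radius oD Dx ltr01.
have sB := slice_on_ebox oU lf gr (fun z zB => DU z (rD z zB)).
have [r0 _] := gr; have r2 : 0 < r ^+ 2 by rewrite exprn_gt0.
(* The second values are taken close to [x], so that all mixed points remain in a box free of real
   points on which the slice property holds. *)
have /choice[b bP] : forall j : 'I_n, exists b : quat R,
    [/\ b != qcoord x j, b 0 0 = qcoord x j 0 0,
      quat_sqnorm (qIm b) = quat_sqnorm (qIm (qcoord x j)) &
      quat_sqnorm (b - qcoord x j) < r ^+ 2].
  by move=> j; apply: exists_near_on_sphere => //; exact: y0.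
pose CC (h : unit -> quat R) := h tt = 0.
suff : CC (fun=> vartheta_bar i (Gamma i K f) x) by [].
move: K KS; apply: (@neg_conj_prod_coefficients R n unit CC i
  (fun K _ => vartheta_bar i (Gamma i K f) x) x b) => //.
- by move=> h k; rewrite /CC => -> ->; rewrite subr0.
- by move=> a h; rewrite /CC => ->; rewrite mulr0.
- exact: ltnW.
- by move=> j; have [] := bP j.
move=> z zE; rewrite /CC.
(* [theta_bar i] is evaluated at [z'], which follows [z] in the first [i] coordinates only; its
   [vartheta_bar] coefficients are then still those at [x]. *)
pose z' : 'M[R]_(n, 4) := \matrix_(l, c) (if (l < i)%N then z l c else x l c).
have z'E j : qcoord z' j = if (j < i)%N then qcoord z j else qcoord x j.
  by apply/rowP => l; rewrite !mxE; case: ifP => _; rewrite mxE.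
have xB : ebox x r x by exact: ebox_center.
have z'B : ebox x r z'.
  move=> j; rewrite z'E; case: ifP => _; last exact: xB.
  by case: (zE j) => ->; [exact: xB|have [] := bP j].
have px : polysphere i x z'.
  apply/polysphereP; split=> j ji; rewrite z'E ?ji; last by rewrite ltnNge ji.
  by case: (zE j) => -> //; have [_ -> ->] := bP j.
have E := th i z' (rD _ z'B).
suff -> : \sum_(L in powerset (first_coords n i))
    neg_conj_prod (first_coords n i :\: L)%SET z * vartheta_bar i (Gamma i L f) x =
    theta_bar i f z' by exact: E.
rewrite /theta_bar.
apply: eq_bigr => L.
rewrite powersetE.
move=> LS.
have -> : neg_conj_prod (first_coords n i :\: L)%SET z =
    neg_conj_prod (first_coords n i :\: L)%SET z'.
  apply: eq_neg_conj_prod => j.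
  by rewrite finset.in_setD inE z'E => /andP[_ ->].
by rewrite (vartheta_Gamma_const oD gr y0 sB LS xB z'B Dx px).
Qed.

End theta_to_vartheta.

(** * Reproducing kernels in one variable *)

Section reproducing_kernels.
Variable R : realType.
Implicit Types (a x y q I J : quat R) (g : quat R -> quat R) (r : R).

Lemma quat_sum_coord m (F : 'I_m -> quat R) l :
  (\sum_j F j) 0 l = \sum_j F j 0 l.
Proof. by rewrite summxE. Qed.

(* Affine coordinates of R^3 with respect to rotated copies of q, from
   [w = (w . q) q + (q x w) x q] applied to [w = I - q]. *)
Lemma affine_frame q e : imag_units q -> 0 < e ->
  exists (J : 'I_7 -> quat R) (A : 'I_7 -> R) (B : 'I_7 -> 'I_4 -> R),
  (forall l, imag_units (J l) /\ quat_sqnorm (J l - q) < e) /\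
  forall I, I 0 0 = 0 ->
    let t l := A l + B l 1 * I 0 1 + B l 2 * I 0 2 + B l 3 * I 0 3 in
    \sum_l t l = 1 /\ \sum_l t l *: J l = I.
Proof.
move=> qu e0; have /imag_unitsP[q0 qq] := qu.
have [c [s [cs s0 c1 /andP[c2 c3]]]] := small_rotation e0.
have d0 : c - 1 != 0 by rewrite subr_eq0.
(* The sum of the six rotated copies minus [6 *: q] is [4 * (c - 1)] times [q], and opposite
   rotations about an axis differ by [2 * s] times the cross product of that axis with [q]; [k] and
   [w] undo these factors. *)
pose k : R := (4 * (c - 1))^-1; pose w : R := (2 * s)^-1.
pose Js := [:: q; rot1 c s q; rot1 c (- s) q; rot2 c s q; rot2 c (- s) q;
  rot3 c s q; rot3 c (- s) q].
pose As := [:: 1 + 6 * k; - k; - k; - k; - k; - k; - k].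
pose B (l : 'I_7) (j : 'I_4) : R := nth 0 [:: - 6 * k * q 0 j;
  k * q 0 j + w * nth 0 [:: 0; 0; - q 0 3; q 0 2] j;
  k * q 0 j - w * nth 0 [:: 0; 0; - q 0 3; q 0 2] j;
  k * q 0 j + w * nth 0 [:: 0; q 0 3; 0; - q 0 1] j;
  k * q 0 j - w * nth 0 [:: 0; q 0 3; 0; - q 0 1] j;
  k * q 0 j + w * nth 0 [:: 0; - q 0 2; q 0 1; 0] j;
  k * q 0 j - w * nth 0 [:: 0; - q 0 2; q 0 1; 0] j] l.
exists (fun l => nth 0 Js l), (fun l => nth 0 As l), B; split.
  have H s' : c ^+ 2 + s' ^+ 2 = 1 ->
      [/\ imag_units (rot1 c s' q) /\ quat_sqnorm (rot1 c s' q - q) < e,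
          imag_units (rot2 c s' q) /\ quat_sqnorm (rot2 c s' q - q) < e &
          imag_units (rot3 c s' q) /\ quat_sqnorm (rot3 c s' q - q) < e].
    move=> cs'; have [r1 r2 r3] := rotation_sphere q cs'.
    have [d1 d2 d3] := rotation_dist q cs'.
    have s1 := sqr_ge0 (q 0 1); have s2 := sqr_ge0 (q 0 2); have s3 := sqr_ge0 (q 0 3).
    have K (y : quat R) z : y 0 0 = 0 -> quat_sqnorm (qIm y) = quat_sqnorm (qIm q) ->
        quat_sqnorm (y - q) = (2 - 2 * c) * z -> z <= 1 ->
        imag_units y /\ quat_sqnorm (y - q) < e.
      move=> y0 yq -> z1; split.
        by apply/imag_unitsP; split=> //; rewrite -qq -!quat_sqnorm_qIm.
      by apply: le_lt_trans c3; rewrite ler_piMr.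
    split; [apply: K r1 d1 _|apply: K r2 d2 _|apply: K r3 d3 _]; rewrite ?mkquatE//; lra.
  have [h1 h2 h3] := H s cs; have [] := H (- s); first by rewrite sqrrN.
  move=> h4 h5 h6 [[|[|[|[|[|[|[|l]]]]]]] hl] //=.
  by split=> //; rewrite subrr /quat_sqnorm !quat_0E !expr0n /= !addr0.
(* The identity is proved with an explicit factor [|q|^2] on the right, which is replaced by [1]
   afterwards; [field] thus never needs that [q] is a unit. *)
have qI (z1 z2 z3 : R) j : z1 = z2 -> z2 = j * z3 -> z3 = 1 -> z1 = j.
  by move=> -> -> ->; rewrite mulr1.
move=> I I0 t; have tE l : t l = nth 0 As l + B l 1 * I 0 1 + B l 2 * I 0 2 + B l 3 * I 0 3 by [].
have BE l j : B l j = nth 0 [:: - 6 * k * q 0 j;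
  k * q 0 j + w * nth 0 [:: 0; 0; - q 0 3; q 0 2] j;
  k * q 0 j - w * nth 0 [:: 0; 0; - q 0 3; q 0 2] j;
  k * q 0 j + w * nth 0 [:: 0; q 0 3; 0; - q 0 1] j;
  k * q 0 j - w * nth 0 [:: 0; q 0 3; 0; - q 0 1] j;
  k * q 0 j + w * nth 0 [:: 0; - q 0 2; q 0 1; 0] j;
  k * q 0 j - w * nth 0 [:: 0; - q 0 2; q 0 1; 0] j] l by [].
clearbody t B; split.
  rewrite !big_ord_recl big_ord0 !tE !BE /=; ring.
rewrite !big_ord_recl big_ord0 !tE !BE /= /rot1 /rot2 /rot3.
apply: quatP; rewrite !(quat_addE, quat_scaleE, mkquatE, quat_0E).
- by rewrite I0 q0; ring.
- by apply: (qI _ _ _ _ erefl _ qq); rewrite /k /w; field; rewrite d0 s0.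
- by apply: (qI _ _ _ _ erefl _ qq); rewrite /k /w; field; rewrite d0 s0.
- by apply: (qI _ _ _ _ erefl _ qq); rewrite /k /w; field; rewrite d0 s0.
Qed.

End reproducing_kernels.

(** * Slice-regular functions of one variable on a ball *)

Section slice_regular.
Variable R : realType.
Implicit Types (a x y q I J : quat R) (g : quat R -> quat R) (r : R) (w z : R * R).

Definition slice_pt J w : quat R := w.1%:A + J * w.2%:A.

Definition qball a r : set (quat R) := [set x | quat_sqnorm (x - a) < r ^+ 2].

(** Continuity is asked on the whole ball, the other two conditions only off the real axis. By
    [(d/dalpha + J d/dbeta) g = 0], component [l] of [- J g] is the harmonic conjugate of component
    [l] of [g]. *)
Definition slice_regular_on a r g :=
 [/\ forall x, qball a r x -> {for x, continuous g},
   exists u v : quat R -> quat R,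
     (forall x, qball a r x -> qIm x != 0 -> g x = u x + - qconj x * v x) /\
     (forall x y, qball a r x -> qball a r y -> qIm x != 0 -> x 0 0 = y 0 0 ->
       quat_sqnorm (qIm x) = quat_sqnorm (qIm y) -> u x = u y /\ v x = v y) &
   forall J l, imag_units J -> CR_on [set w | w.2 != 0 /\ qball a r (slice_pt J w)]
     (fun w => g (slice_pt J w) 0 l) (fun w => - (J * g (slice_pt J w)) 0 l)].

Lemma slice_ptE J w l : slice_pt J w 0 l = w.1 * (1 : quat R) 0 l + w.2 * J 0 l.
Proof. by rewrite /slice_pt slice_pointE quat_addE !quat_scaleE. Qed.

Lemma slice_pt_continuous J w : {for w, continuous (slice_pt J)}.
Proof.
apply/quat_continuousP => l.
have -> : (fun w => slice_pt J w 0 l) = fun w => w.1 * (1 : quat R) 0 l + w.2 * J 0 l.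
  by apply/funext => z; exact: slice_ptE.
have H1 : {for w, continuous (fun w : R * R => w.1 * (1 : quat R) 0 l)}.
  by apply: (@cvgM R _ (nbhs w) _ fst (fun=> (1 : quat R) 0 l)); [exact: cvg_fst|exact: cvg_cst].
have H2 : {for w, continuous (fun w : R * R => w.2 * J 0 l)}.
  by apply: (@cvgM R _ (nbhs w) _ snd (fun=> J 0 l)); [exact: cvg_snd|exact: cvg_cst].
exact: (@cvgD R R _ (nbhs w) _ _ _ _ _ H1 H2).
Qed.

Lemma quat_mulE_basis (b e : quat R) c :
  (b * e) 0 c = \sum_(d < 4) (b * qe R d) 0 c * e 0 d.
Proof.
rewrite {1}(_ : e = \sum_(d < 4) e 0 d *: qe R d); last exact: row_sum_delta.
by rewrite mulr_sumr quat_sum_coord; apply: eq_bigr => d _; rewrite -scalerAr quat_scaleE mulrC.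
Qed.

Lemma quat_mull_continuous (T : topologicalType) (h : T -> quat R) J (x : T) :
  {for x, continuous h} -> {for x, continuous (fun t => J * h t)}.
Proof.
move=> /quat_continuousP hc; apply/quat_continuousP => l.
have -> : (fun t => (J * h t) 0 l) = fun t => \sum_(c < 4) (J * qe R c) 0 l * h t 0 c.
  by apply/funext => t; exact: quat_mulE_basis.
apply: sum_continuous => c.
by apply: (@cvgM R _ (nbhs x) _ (fun=> (J * qe R c) 0 l) (fun t => h t 0 c)); [exact: cvg_cst|exact: hc].
Qed.

(** On a sphere [u] and [v] are constant and [- conj (al + I be) = - al + be I], so [g] is affine in
    the unit [I] and respects affine combinations of units. *)
Lemma slice_affine a r g m (J : 'I_m -> quat R) (t : 'I_m -> R) I (al be : R) :
  slice_regular_on a r g -> be != 0 -> imag_units I -> (forall l, imag_units (J l)) ->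
  \sum_l t l = 1 -> \sum_l t l *: J l = I -> qball a r (slice_pt I (al, be)) ->
  (forall l, qball a r (slice_pt (J l) (al, be))) ->
  g (slice_pt I (al, be)) = \sum_l t l *: g (slice_pt (J l) (al, be)).
Proof.
move=> [_ [u [v [gE uv]]] _] be0 Iu Ju t1 tJ IB JB.
have im K : imag_units K -> qIm (slice_pt K (al, be)) != 0.
  by move=> Ku; rewrite qIm_slice_point//= scaler_eq0 negb_or be0 imag_unit_neq0.
have sq K : imag_units K -> quat_sqnorm (qIm (slice_pt K (al, be))) = be ^+ 2.
  move=> Ku; rewrite qIm_slice_point// quat_sqnorm_scale /=.
  have /imag_unitsP[K0 K1] := Ku.
  by rewrite /quat_sqnorm K0 expr0n/= add0r K1 mulr1.
have cj K : imag_units K -> - qconj (slice_pt K (al, be)) = - al%:A + be *: K.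
  move=> Ku; have /imag_unitsP[K0 _] := Ku.
  rewrite /slice_pt slice_pointE /=; apply: quatP;
  by rewrite !quatE ?K0; ring.
rewrite gE ?im// cj//.
transitivity (\sum_l t l *: (u (slice_pt I (al, be)) +
    (- al%:A + be *: J l) * v (slice_pt I (al, be)))).
  under eq_bigr => l _ do rewrite scalerDr.
  rewrite big_split/= -scaler_suml t1 scale1r; congr (_ + _).
  under eq_bigr => l _ do rewrite scalerAl.
  rewrite -mulr_suml; congr (_ * _).
  under eq_bigr => l _ do rewrite scalerDr scalerA mulrC -scalerA.
  by rewrite big_split/= -scaler_suml t1 scale1r -scaler_sumr tJ.
apply: eq_bigr => l _; rewrite [in RHS]gE ?im// cj//.
have [-> ->] : u (slice_pt I (al, be)) = u (slice_pt (J l) (al, be)) /\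
    v (slice_pt I (al, be)) = v (slice_pt (J l) (al, be)).
  apply: uv; rewrite ?im ?sq//; have /imag_unitsP[I0 _] := Iu; have /imag_unitsP[J0 _] := Ju l.
  by rewrite !slice_ptE I0 J0 !mulr0.
by [].
Qed.

End slice_regular.

(** * Families of real reproducing kernels *)

Section reproducing.
Variable R : realType.
Implicit Types (a x y q I J : quat R) (g : quat R -> quat R) (r : R) (w z c : R * R).

Lemma slice_poisson a r g J c (rho : R) z l : slice_regular_on a r g ->
  imag_units J -> 0 < rho ->
  (forall w, (w.1 - c.1) ^+ 2 + (w.2 - c.2) ^+ 2 <= rho ^+ 2 ->
    qball a r (slice_pt J w) /\ (w.2 != c.2 -> w.2 != 0)) ->
  (z.1 - c.1) ^+ 2 + (z.2 - c.2) ^+ 2 < rho ^+ 2 -> z.2 != c.2 ->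
  segint 0 (2 * pi) (fun s => poisson rho (z - c) s *
    g (slice_pt J (c + polar rho s)) 0 l) = 2 * pi * g (slice_pt J z) 0 l.
Proof.
move=> [gc _ gCR] Ju rho0 cB zc z2.
have cont w : (w.1 - c.1) ^+ 2 + (w.2 - c.2) ^+ 2 <= rho ^+ 2 ->
    {for w, continuous (fun w => g (slice_pt J w))}.
  by move=> wc; apply: continuous_comp; [exact: slice_pt_continuous|apply: gc; have [] := cB w wc].
apply: (@poisson_formula R (fun w => g (slice_pt J w) 0 l)
  (fun w => - (J * g (slice_pt J w)) 0 l)) => // [w wc|].
  split; first by have /quat_continuousP := cont w wc; exact.
  have /quat_continuousP/(_ l) Jg := @quat_mull_continuous R _ _ J w (cont w wc).
  exact: (@cvgN _ _ _ (nbhs w) _ (fun w => (J * g (slice_pt J w)) 0 l) _ Jg).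
apply: sub_CR_on (gCR J l Ju) => w /= [wc w2]; have [wB wn] := cB w wc.
by split=> //; exact: wn.
Qed.

Lemma poisson_denominator_neq0 (r : R) z s : z.1 ^+ 2 + z.2 ^+ 2 < r ^+ 2 ->
  (r * cos s - z.1) ^+ 2 + (r * sin s - z.2) ^+ 2 != 0.
Proof.
move=> zr; apply: contraTneq zr => h.
have s1 := sqr_ge0 (r * cos s - z.1); have s2 := sqr_ge0 (r * sin s - z.2).
have /eqP : (r * cos s - z.1) ^+ 2 = 0 by lra.
rewrite sqrf_eq0 subr_eq0 => /eqP <-.
have /eqP : (r * sin s - z.2) ^+ 2 = 0 by lra.
rewrite sqrf_eq0 subr_eq0 => /eqP <-.
by have := polar_sqr r s; rewrite /polar /= => ->; rewrite ltxx.
Qed.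

Lemma im_dot_le x y : im_dot x y <= im_norm x * im_norm y.
Proof.
rewrite /im_norm -sqrtrM ?quat_sqnorm_ge0//; apply: le_trans (ler_norm _) _.
rewrite -sqrtr_sqr ler_sqrt ?mulr_ge0 ?quat_sqnorm_ge0//.
rewrite !quat_sqnorm_qIm /im_dot -subr_ge0.
rewrite (_ : _ - _ = (x 0 1 * y 0 2 - x 0 2 * y 0 1) ^+ 2 +
  (x 0 1 * y 0 3 - x 0 3 * y 0 1) ^+ 2 + (x 0 2 * y 0 3 - x 0 3 * y 0 2) ^+ 2); last by ring.
by rewrite !addr_ge0 ?sqr_ge0.
Qed.

(** By Cauchy-Schwarz, passing to [(Re x, |Im x|)] does not increase distances: a ball about [a] is
    mapped into a disc of the half-plane. *)
Lemma slice_coord_dist x a :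
  (x 0 0 - a 0 0) ^+ 2 + (im_norm x - im_norm a) ^+ 2 <= quat_sqnorm (x - a).
Proof.
have := im_dot_le x a; rewrite sqnormB_dot.
have -> : quat_sqnorm (qIm x) = im_norm x ^+ 2 by rewrite sqr_sqrtr ?quat_sqnorm_ge0.
have -> : quat_sqnorm (qIm a) = im_norm a ^+ 2 by rewrite sqr_sqrtr ?quat_sqnorm_ge0.
by move=> h; rewrite -subr_ge0; lra.
Qed.

(** The curves run in the ball of radius [r], the point [x] in a smaller one where the kernels are
    smooth. Smoothness is stated in matrix space, where it will be used. The excluded points, [x]
    real or [|Im x| = |Im a|], are those where the Poisson formula does not apply; they are reached
    later by continuity. *)
Definition reproducing a r (d : R) m (k : 'I_m -> R -> quat R -> R)
    (s : 'I_m -> R -> quat R) :=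
 [/\ forall l, continuous (s l),
   forall l t, qball a r (s l t),
   forall n (i : 'I_n) N l, smooth N (coord_dirs setT)
     [set x : 'M[R]_(n, 4) | qball a d (qcoord x i)] (fun t (x : 'M[R]_(n, 4)) => k l t (qcoord x i)) &
   forall g x (c : 'I_4), slice_regular_on a r g -> qball a d x -> qIm x != 0 ->
     quat_sqnorm (qIm x) != quat_sqnorm (qIm a) ->
     g x 0 c = \sum_l segint 0 (2 * pi) (fun t => k l t x * g (s l t) 0 c)].

Lemma reproducing_continuous a r d m (k : 'I_m -> R -> quat R -> R) s l x :
  reproducing a r d k s -> qball a d x -> continuous (k l ^~ x).
Proof.
move=> [_ _ ks _] xB t; have xE : qcoord (x : 'M[R]_(1, 4)) 0 = x by exact: row_id.
have := @smooth_continuousl _ _ _ _ _ _ (ks 1%N 0 0%N l) t (x : 'M[R]_(1, 4)).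
by rewrite /= xE; apply.
Qed.

Lemma open_qball a r : open (qball a r).
Proof.
rewrite openE => x xp; rewrite /interior.
have c : {for x, continuous (fun b : quat R => quat_sqnorm (b - a))}.
  apply: (@continuous_comp _ _ _ (fun b : quat R => b - a) (@quat_sqnorm R)).
    exact: (@cvgB R (quat R) _ (nbhs x) _ id (fun=> a) _ _ cvg_id (cvg_cst _)).
  exact: quat_sqnorm_continuous.
exact: (cvgr_lt _ c _ xp).
Qed.

Lemma open_qball_coord n (i : 'I_n) a r :
  open [set x : 'M[R]_(n, 4) | qball a r (qcoord x i)].
Proof.
apply: (@open_comp _ _ (fun x : 'M[R]_(n, 4) => qcoord x i) (qball a r)); last exact: open_qball.
by move=> x _; exact: qcoord_continuous.
Qed.

Lemma smooth_qcoord n (i : 'I_n) N S D l : open D ->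
  smooth N S D (fun _ (x : 'M[R]_(n, 4)) => qcoord x i 0 l).
Proof.
by move=> oD; apply: eq_smooth oD _ (smooth_coord N S i l oD) => t x _; rewrite qcoordE.
Qed.

Lemma slice_circle_continuous J c (rho : R) :
  continuous (fun s => slice_pt J (c + polar rho s)).
Proof.
have cM (h : R -> R) s : {for s, continuous h} -> {for s, continuous (fun s => rho * h s)}.
  by move=> hc; apply: (@cvgM R _ (nbhs s) _ (fun=> rho) h); [exact: cvg_cst|exact: hc].
move=> s; have cp : {for s, continuous (fun s => polar rho s)}.
  by apply: (@pair_continuous _ _ _ (fun s => rho * cos s) (fun s => rho * sin s));
    apply: cM; [exact: continuous_cos|exact: continuous_sin].
apply: continuous_comp; last exact: slice_pt_continuous.
exact: (@cvgD R (R * R)%type _ (nbhs s) _ (fun=> c) (fun s => polar rho s) _ _ (cvg_cst _) cp).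
Qed.

End reproducing.

(** * Kernels at a non-real centre *)

Section reproducing_exists.
Variable R : realType.
Implicit Types (a x y q I J : quat R) (g : quat R -> quat R) (r : R) (w z c : R * R).

Lemma circle_continuous a r g J c (rho : R) l : slice_regular_on a r g ->
  (forall s, qball a r (slice_pt J (c + polar rho s))) ->
  continuous (fun s => g (slice_pt J (c + polar rho s)) 0 l).
Proof.
move=> [gc _ _] cB s.
have /quat_continuousP : {for s, continuous (fun s => g (slice_pt J (c + polar rho s)))}.
  by apply: continuous_comp; [exact: slice_circle_continuous|exact: gc].
exact.
Qed.

Lemma circle_in_disc c (rho s : R) : 0 < rho ->
  let w := c + polar rho s in (w.1 - c.1) ^+ 2 + (w.2 - c.2) ^+ 2 <= rho ^+ 2.
Proof.
move=> rho0; rewrite /= [_ + rho * cos s]addrC [_ + rho * sin s]addrC !addrK.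
by rewrite -(polar_sqr rho s) lexx.
Qed.

Lemma slice_poisson_scaled a r g J c (rho e : R) z l : slice_regular_on a r g ->
  imag_units J -> 0 < rho ->
  (forall w, (w.1 - c.1) ^+ 2 + (w.2 - c.2) ^+ 2 <= rho ^+ 2 ->
    qball a r (slice_pt J w) /\ (w.2 != c.2 -> w.2 != 0)) ->
  (z.1 - c.1) ^+ 2 + (z.2 - c.2) ^+ 2 < rho ^+ 2 -> z.2 != c.2 ->
  let h s := e / (2 * pi) * poisson rho (z - c) s * g (slice_pt J (c + polar rho s)) 0 l in
  continuous_on_segment 0 (2 * pi) h /\
  segint 0 (2 * pi) h = e * g (slice_pt J z) 0 l.
Proof.
move=> sg Ju rho0 cB zc z2 h.
have hE : h = fun s => e / (2 * pi) * (poisson rho (z - c) s * g (slice_pt J (c + polar rho s)) 0 l).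
  by apply/funext => s; rewrite /h mulrA.
have ch : continuous_on_segment 0 (2 * pi)
    (fun s => poisson rho (z - c) s * g (slice_pt J (c + polar rho s)) 0 l).
  have cc := @circle_continuous a r g J c rho l sg (fun s => (cB _ (circle_in_disc c s rho0)).1).
  by apply: continuous_on_segmentM => s _; [exact: continuous_poisson|exact: cc].
rewrite hE; split; first by apply: continuous_on_segmentM => // s _; exact: cvg_cst.
rewrite segintZ// (slice_poisson _ sg Ju rho0 cB zc z2).
have pi0 : (pi : R) != 0 by rewrite gt_eqF ?pi_gt0.
move: (pi : R) pi0 => p p0; by field.
Qed.

(** By [slice_affine], [g x] is a combination of values on seven fixed slices with units close to
    the direction of [a], and the Poisson formula is applied in each. The weights are affine in
    [Im x / |Im x|], which is smooth because the ball avoids the real axis. *)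
Lemma reproducing_nonreal a r : 0 < r -> qIm a != 0 ->
  r ^+ 2 <= quat_sqnorm (qIm a) ->
  exists m k s, @reproducing R a r (r / 2) m k s.
Proof.
move=> r0 a0 ra; pose b := im_norm a; have b0 : 0 < b by exact: im_norm_gt0.
have bE : b ^+ 2 = quat_sqnorm (qIm a) by rewrite sqr_im_norm quat_sqnorm_qIm.
have rb : r <= b by rewrite -(@ler_pXn2r _ 2) ?bE// nnegrE ltW.
pose rho := r / 2; have rho0 : 0 < rho by rewrite divr_gt0.
have rhoE : rho ^+ 2 = r ^+ 2 / 4 by rewrite /rho; field.
have qu := im_dir_unit a0; have aE i : i != 0 -> a 0 i = b * im_dir a 0 i.
  by move=> i0; rewrite {1}(im_dirE a0) slice_point_im.
move: (im_dir a) qu aE => q qu aE.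
(* With [|J - q|^2] below this bound, the disc of radius [r / 2] in the slice of [J] stays in the
   ball: the squared distance to [a] is less than [2 * rho ^+ 2 + 2 * b ^+ 2 * (r ^+ 2 / (4 * b ^+
   2)) = r ^+ 2]. *)
have e0 : 0 < r ^+ 2 / (4 * b ^+ 2) by rewrite divr_gt0 ?mulr_gt0 ?exprn_gt0.
have [J [A [B [JP AB]]]] := affine_frame qu e0.
pose c : R * R := (a 0 0, b).
have cB l w : (w.1 - c.1) ^+ 2 + (w.2 - c.2) ^+ 2 <= rho ^+ 2 ->
    qball a r (slice_pt (J l) w) /\ (w.2 != c.2 -> w.2 != 0).
  move=> wc; have [Ju Jq] := JP l; split.
    have /imag_unitsP[J0 J1] := Ju; have /imag_unitsP[q0 q1] := qu.
    move: Jq; rewrite ltr_pdivlMr ?mulr_gt0 ?exprn_gt0// /quat_sqnorm !quatE J0 q0 => Jq.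
    have sE j : (slice_pt (J l) w - a) 0 j = w.1 * (1 : quat R) 0 j + w.2 * J l 0 j - a 0 j.
      by rewrite quat_addE quat_oppE slice_ptE.
    rewrite /qball /= /quat_sqnorm !sE !quat_1E !mkquatE J0 (aE 1 isT) (aE 2 isT) (aE 3 isT).
    move: wc; rewrite rhoE /c /=; set x := w.1; set y := w.2 => wc.
    have S (u v : R) : (x * 0 + y * u - b * v) ^+ 2 <=
        2 * (y - b) ^+ 2 * u ^+ 2 + 2 * b ^+ 2 * (u - v) ^+ 2.
      rewrite -subr_ge0 (_ : _ - _ = ((y - b) * u - b * (u - v)) ^+ 2); last by ring.
      exact: sqr_ge0.
    have s1 := S (J l 0 1) (q 0 1); have s2 := S (J l 0 2) (q 0 2).
    have s3 := S (J l 0 3) (q 0 3).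
    have E : 2 * (y - b) ^+ 2 * J l 0 1 ^+ 2 + 2 * (y - b) ^+ 2 * J l 0 2 ^+ 2 +
      2 * (y - b) ^+ 2 * J l 0 3 ^+ 2 = 2 * (y - b) ^+ 2.
      by rewrite -!mulrDr J1 mulr1.
    have X : 0 <= (x - a 0 0) ^+ 2 by exact: sqr_ge0.
    rewrite mulr0 addr0 mulr1.
    move: Jq; rewrite subrr expr0n /= add0r => Jq.
    lra.
  (* As [rho < r <= b], the disc does not reach the real axis. *)
  move=> _; apply: contraTneq wc => ->; rewrite -ltNge /= sub0r sqrrN.
  apply: (@lt_le_trans _ _ (b ^+ 2)); last by rewrite lerDr sqr_ge0.
  by rewrite ltr_pXn2r ?nnegrE ?ltW// /rho; lra.
pose k (l : 'I_7) t x : R := (A l + B l 1 * (x 0 1 / im_norm x) + B l 2 * (x 0 2 / im_norm x) +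
  B l 3 * (x 0 3 / im_norm x)) / (2 * pi) * poisson rho (x 0 0 - a 0 0, im_norm x - b) t.
have dist x : qball a (r / 2) x -> (x 0 0 - a 0 0) ^+ 2 + (im_norm x - b) ^+ 2 < rho ^+ 2.
  by move=> xB; exact: le_lt_trans (slice_coord_dist x a) xB.
have nr x : qball a (r / 2) x -> 0 < im_norm x.
  move=> /dist h; rewrite lt_neqAle sqrtr_ge0 andbT; apply: contraTneq h => <-.
  rewrite sub0r sqrrN -leNgt (@le_trans _ _ (b ^+ 2))//; last by rewrite lerDr sqr_ge0.
  by rewrite ler_pXn2r// ?nnegrE; [rewrite /rho; lra|exact: ltW|exact: ltW].
exists 7, k, (fun l t => slice_pt (J l) (c + polar rho t)); split.
- by move=> l; exact: slice_circle_continuous.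
- by move=> l t; have [] := cB l _ (circle_in_disc c t rho0).
- move=> n i N l; set D := [set x | _]; have oD : open D by exact: open_qball_coord.
  have X j := @smooth_qcoord R n i N (coord_dirs setT) D j oD.
  have nD (x : 'M[R]_(n, 4)) : D x -> 0 < im_norm (qcoord x i) by exact: nr.
  have Y : smooth N (coord_dirs setT) D (fun _ (x : 'M[R]_(n, 4)) => im_norm (qcoord x i)).
    rewrite /im_norm; apply: smooth_sqrt => //.
      by move=> _ x Dx; have := nD _ Dx; rewrite /im_norm sqrtr_gt0.
    apply: (@eq_smooth _ _ _ _ _ (fun _ (x : 'M[R]_(n, 4)) => qcoord x i 0 1 ^+ 2 + qcoord x i 0 2 ^+ 2 + qcoord x i 0 3 ^+ 2)) => //.
      by move=> _ x _; rewrite quat_sqnorm_qIm.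
    by do 2?[apply: smoothD => //]; apply: smoothX.
  have Yi : smooth N (coord_dirs setT) D (fun _ (x : 'M[R]_(n, 4)) => (im_norm (qcoord x i))^-1).
    by apply: smoothV => // _ x /nD; rewrite lt_neqAle eq_sym => /andP[].
  have C e := @smooth_cst R 'M[R]_(n, 4) N (coord_dirs setT) D e.
  have cosS : smooth N (coord_dirs setT) D (fun t (_ : 'M[R]_(n, 4)) => rho * cos t).
    by apply: smoothM => //; apply: smooth_fct; exact: continuous_cos.
  have sinS : smooth N (coord_dirs setT) D (fun t (_ : 'M[R]_(n, 4)) => rho * sin t).
    by apply: smoothM => //; apply: smooth_fct; exact: continuous_sin.
  have X0 : smooth N (coord_dirs setT) D (fun _ (x : 'M[R]_(n, 4)) => qcoord x i 0 0 - a 0 0).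
    exact: smoothB.
  have Y0 : smooth N (coord_dirs setT) D (fun _ (x : 'M[R]_(n, 4)) => im_norm (qcoord x i) - b).
    exact: smoothB.
  have T j : smooth N (coord_dirs setT) D (fun _ (x : 'M[R]_(n, 4)) => B l j * (qcoord x i 0 j / im_norm (qcoord x i))).
    by apply: smoothM => //; apply: smoothM.
  rewrite /k /poisson /=; apply: smoothM => //.
    by apply: smoothM => //; do 3?[apply: smoothD => //].
  apply: smoothM => //; first by apply: smoothB => //; apply: smoothD => //; apply: smoothX.
  apply: smoothV => //.
    move=> t x Dx; exact: (@poisson_denominator_neq0 R rho (qcoord x i 0 0 - a 0 0, im_norm (qcoord x i) - b) t (dist _ Dx)).
  by apply: smoothD => //; apply: smoothX => //; apply: smoothB.
- move=> g x l sg xB x0 xa; have xn := nr _ xB.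
  have Iu := im_dir_unit x0; have /imag_unitsP[I0 _] := Iu.
  have [t1 tJ] := AB _ I0.
  have xE : x = slice_pt (im_dir x) (x 0 0, im_norm x) by exact: im_dirE.
  have xd := dist _ xB.
  have xb : im_norm x != b.
    by apply: contra_neq xa => h; rewrite -bE -h sqr_sqrtr// quat_sqnorm_ge0.
  have IB : qball a r (slice_pt (im_dir x) (x 0 0, im_norm x)).
    rewrite -xE; apply: lt_trans xB _; have := exprn_gt0 2 r0; rewrite -/rho rhoE; lra.
  have JB j : qball a r (slice_pt (J j) (x 0 0, im_norm x)).
    by have [] := cB j (x 0 0, im_norm x) (ltW xd).
  have n0 : im_norm x != 0 by rewrite gt_eqF.
  have Ju j : imag_units (J j) by have [] := JP j.
  have -> : g x = g (slice_pt (im_dir x) (x 0 0, im_norm x)) by rewrite -xE.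
  rewrite (slice_affine sg n0 Iu Ju t1 tJ IB JB) quat_sum_coord.
  apply: eq_bigr => j _; rewrite quat_scaleE.
  have [_ <-] := slice_poisson_scaled (A j + B j 1 * (im_dir x) 0 1 + B j 2 * (im_dir x) 0 2 + B j 3 * (im_dir x) 0 3)
    l sg (Ju j) rho0 (cB j) (xd : ((x 0 0, im_norm x).1 - c.1) ^+ 2 + _ < _) xb.
  apply: eq_segint => t _; rewrite /k /=; congr (_ / _ * _ * _).
  have iE m : m != 0 -> im_dir x 0 m = x 0 m / im_norm x.
    move=> m0; have -> : x 0 m = im_norm x * im_dir x 0 m.
      by rewrite {1}(im_dirE x0) slice_point_im.
    by field.
  by rewrite !iE.
Qed.

End reproducing_exists.

(** * Kernels at a real centre *)

Section reproducing_exists_real.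
Variable R : realType.
Implicit Types (a x y q I J : quat R) (g : quat R -> quat R) (r : R) (w z c : R * R).

Lemma slice_ptN J (al be : R) : slice_pt (- J) (al, be) = slice_pt J (al, - be).
Proof. by rewrite /slice_pt !slice_pointE /= scalerN scaleNr. Qed.

Lemma imag_unit_qe (l : 'I_3) : imag_units (qe R (lift ord0 l)).
Proof.
apply/imag_unitsP; rewrite /qe !mxE.
by case: l => -[|[|[|l]]] hl //=; split=> //; rewrite !expr0n/= expr1n ?add0r ?addr0.
Qed.

Lemma imag_unitN I : imag_units I -> imag_units (- I).
Proof. by rewrite /imag_units /= sqrrN. Qed.

(** The units are [i], [j], [k] and their opposites, with weights [1/6 + I_l / 2] and
    [1/6 - I_l / 2] for [I = im_dir x]. The slice of [-J] at height [be] is that of [J] at height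
    [- be], so both Poisson integrals run over the same circle and their kernels add up. The sum
    involves [|Im x|] only through its square and through [|Im x| I_l], which is a coordinate of
    [x]; it is therefore smooth at real points. *)
Lemma reproducing_real a r : 0 < r -> qIm a = 0 ->
  exists m k s, @reproducing R a r (r / 2) m k s.
Proof.
move=> r0 a0; pose rho := r / 2; have rho0 : 0 < rho by rewrite divr_gt0.
have rhoE : rho ^+ 2 = r ^+ 2 / 4 by rewrite /rho; field.
have aE : forall l, l != 0 -> a 0 l = 0.
  have [a1 a2 a3] : [/\ a 0 1 = 0, a 0 2 = 0 & a 0 3 = 0].
    by rewrite -(qIm1 a) -(qIm2 a) -(qIm3 a) a0 !quat_0E.
  by apply: ord4_ind.
have an : im_norm a = 0 by rewrite /im_norm a0 (eqP (_ : quat_sqnorm 0 == 0)) ?sqrtr0 ?quat_sqnorm_eq0.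
pose c : R * R := (a 0 0, 0).
have cB J w : imag_units J -> (w.1 - c.1) ^+ 2 + (w.2 - c.2) ^+ 2 <= rho ^+ 2 ->
    qball a r (slice_pt J w) /\ (w.2 != c.2 -> w.2 != 0).
  move=> Ju wc; split=> //; have /imag_unitsP[J0 J1] := Ju.
  have sE j : (slice_pt J w - a) 0 j = w.1 * (1 : quat R) 0 j + w.2 * J 0 j - a 0 j.
    by rewrite quat_addE quat_oppE slice_ptE.
  rewrite /qball /= /quat_sqnorm !sE !quat_1E !mkquatE J0 (aE 1 isT) (aE 2 isT) (aE 3 isT).
  have := exprn_gt0 2 r0; have := rhoE; move: wc; rewrite /c /= => wc rE r2.
  have E : w.2 ^+ 2 * J 0 1 ^+ 2 + w.2 ^+ 2 * J 0 2 ^+ 2 + w.2 ^+ 2 * J 0 3 ^+ 2 = w.2 ^+ 2.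
    by rewrite -!mulrDr J1 mulr1.
  lra.
(* The two Poisson denominators are [N] minus and plus [2 * (rho * sin t) * im_norm x], and [Q] is
   their product. *)
pose N t x := (rho * cos t) ^+ 2 + (rho * sin t) ^+ 2 + (x 0 0 - a 0 0) ^+ 2 +
  (x 0 1 ^+ 2 + x 0 2 ^+ 2 + x 0 3 ^+ 2) - 2 * (rho * cos t) * (x 0 0 - a 0 0).
pose Q t x := N t x ^+ 2 - 4 * (rho * sin t) ^+ 2 * (x 0 1 ^+ 2 + x 0 2 ^+ 2 + x 0 3 ^+ 2).
pose k (l : 'I_3) t x : R :=
  (rho ^+ 2 - ((x 0 0 - a 0 0) ^+ 2 + (x 0 1 ^+ 2 + x 0 2 ^+ 2 + x 0 3 ^+ 2))) *
  (3^-1 * N t x + 2 * (rho * sin t) * x 0 (lift ord0 l)) * (Q t x)^-1 * (2 * pi)^-1.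
have dist x : qball a (r / 2) x -> (x 0 0 - a 0 0) ^+ 2 + im_norm x ^+ 2 < rho ^+ 2.
  by move=> xB; have := le_lt_trans (slice_coord_dist x a) xB; rewrite an subr0.
have M1 x t : qball a (r / 2) x ->
    (rho * cos t - (x 0 0 - a 0 0)) ^+ 2 + (rho * sin t - im_norm x) ^+ 2 != 0.
  by move=> /dist h; exact: (@poisson_denominator_neq0 R rho (x 0 0 - a 0 0, im_norm x)).
have M2 x t : qball a (r / 2) x ->
    (rho * cos t - (x 0 0 - a 0 0)) ^+ 2 + (rho * sin t - - im_norm x) ^+ 2 != 0.
  move=> /dist h; apply: (@poisson_denominator_neq0 R rho (x 0 0 - a 0 0, - im_norm x)).
  by rewrite /= sqrrN.
have QE x t : Q t x = ((rho * cos t - (x 0 0 - a 0 0)) ^+ 2 + (rho * sin t - im_norm x) ^+ 2) *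
    ((rho * cos t - (x 0 0 - a 0 0)) ^+ 2 + (rho * sin t - - im_norm x) ^+ 2).
  by rewrite /Q /N -!sqr_im_norm; ring.
have Q0 x t : qball a (r / 2) x -> Q t x != 0.
  by move=> xB; rewrite QE mulf_neq0 ?M1 ?M2.
exists 3, k, (fun l t => slice_pt (qe R (lift ord0 l)) (c + polar rho t)); split.
- by move=> l; exact: slice_circle_continuous.
- by move=> l t; have [] := cB _ _ (imag_unit_qe l) (circle_in_disc c t rho0).
- move=> n i M l; set D := [set x | _]; have oD : open D by exact: open_qball_coord.
  have X j := @smooth_qcoord R n i M (coord_dirs setT) D j oD.
  have C e := @smooth_cst R 'M[R]_(n, 4) M (coord_dirs setT) D e.
  have cosS : smooth M (coord_dirs setT) D (fun t (_ : 'M[R]_(n, 4)) => rho * cos t).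
    by apply: smoothM => //; apply: smooth_fct; exact: continuous_cos.
  have sinS : smooth M (coord_dirs setT) D (fun t (_ : 'M[R]_(n, 4)) => rho * sin t).
    by apply: smoothM => //; apply: smooth_fct; exact: continuous_sin.
  have X0 : smooth M (coord_dirs setT) D (fun _ (x : 'M[R]_(n, 4)) => qcoord x i 0 0 - a 0 0).
    exact: smoothB.
  have b2 : smooth M (coord_dirs setT) D (fun _ (x : 'M[R]_(n, 4)) =>
      qcoord x i 0 1 ^+ 2 + qcoord x i 0 2 ^+ 2 + qcoord x i 0 3 ^+ 2).
    by do 2?[apply: smoothD => //]; apply: smoothX.
  have NS : smooth M (coord_dirs setT) D (fun t (x : 'M[R]_(n, 4)) => N t (qcoord x i)).
    rewrite /N; apply: smoothB => //; last by apply: smoothM => //; apply: smoothM.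
    by do 3?[apply: smoothD => //]; apply: smoothX.
  have QS : smooth M (coord_dirs setT) D (fun t (x : 'M[R]_(n, 4)) => Q t (qcoord x i)).
    rewrite /Q; apply: smoothB => //; first exact: smoothX.
    by apply: smoothM => //; apply: smoothM => //; apply: smoothX.
  have QV : smooth M (coord_dirs setT) D (fun t (x : 'M[R]_(n, 4)) => (Q t (qcoord x i))^-1).
    by apply: smoothV => // t x Dx; exact: Q0.
  rewrite /k; apply: smoothM => //; apply: smoothM => //; apply: smoothM => //.
    by apply: smoothB => //; apply: smoothD => //; apply: smoothX.
  apply: smoothD => //; first exact: smoothM.
  by apply: smoothM => //; apply: smoothM.
- move=> g x l sg xB x0 xa; have xn := im_norm_gt0 x0.
  have Iu := im_dir_unit x0; have /imag_unitsP[I0 _] := Iu.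
  have xE : x = slice_pt (im_dir x) (x 0 0, im_norm x) by exact: im_dirE.
  have xd := dist _ xB.
  have n0 : im_norm x != 0 by rewrite gt_eqF.
  pose t1 (j : 'I_3) := 6^-1 + 2^-1 * im_dir x 0 (lift ord0 j).
  pose t2 (j : 'I_3) := 6^-1 - 2^-1 * im_dir x 0 (lift ord0 j).
  pose e (j : 'I_3) := qe R (lift ord0 j).
  pose J := [:: e 0; - e 0; e 1; - e 1; e 2; - e 2].
  pose T := [:: t1 0; t2 0; t1 1; t2 1; t1 2; t2 2].
  have IB : qball a r (slice_pt (im_dir x) (x 0 0, im_norm x)).
    by rewrite -xE; apply: lt_trans xB _; have := exprn_gt0 2 r0; rewrite -/rho rhoE; lra.
  have u1 := imag_unit_qe 0; have u2 := imag_unit_qe 1; have u3 := imag_unit_qe 2.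
  have Ju (j : 'I_6) : imag_units (nth 0 J j).
    by move: j => [[|[|[|[|[|[|j]]]]]] hj]//=; try apply: imag_unitN.
  have JB (j : 'I_6) : qball a r (slice_pt (nth 0 J j) (x 0 0, im_norm x)).
    by have [] := cB _ (x 0 0, im_norm x) (Ju j); rewrite //= subr0 ltW.
  have T1 : \sum_(j < 6) nth 0 T j = 1.
    by rewrite !big_ord_recl big_ord0 /= /t1 /t2; field.
  have TJ : \sum_(j < 6) nth 0 T j *: nth 0 J j = im_dir x.
    rewrite !big_ord_recl big_ord0 /= /t1 /t2 /e; move: (im_dir x) I0 => I I0.
    have -> : lift ord0 (0 : 'I_3) = 1 :> 'I_4 by exact: val_inj.
    have -> : lift ord0 (1 : 'I_3) = 2 :> 'I_4 by exact: val_inj.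
    have -> : lift ord0 (2 : 'I_3) = 3 :> 'I_4 by exact: val_inj.
    have qeE (j m : 'I_4) : qe R j 0 m = (m == j)%:R by rewrite /qe mxE.
    by apply: quatP; rewrite !(quat_addE, quat_scaleE, quat_oppE, quat_0E, qeE) ?I0 /=; field.
  have key b (j : 'I_3) : imag_units b ->
      t1 j * g (slice_pt b (x 0 0, im_norm x)) 0 l + t2 j * g (slice_pt (- b) (x 0 0, im_norm x)) 0 l =
      segint 0 (2 * pi) (fun t => k j t x * g (slice_pt b (c + polar rho t)) 0 l).
    move=> eu; rewrite slice_ptN.
    have d1 : ((x 0 0, im_norm x).1 - c.1) ^+ 2 + ((x 0 0, im_norm x).2 - c.2) ^+ 2 < rho ^+ 2.
      by rewrite /= subr0.
    have d2 : ((x 0 0, - im_norm x).1 - c.1) ^+ 2 + ((x 0 0, - im_norm x).2 - c.2) ^+ 2 < rho ^+ 2.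
      by rewrite /= subr0 sqrrN.
    have m0 : - im_norm x != 0 by rewrite oppr_eq0.
    have [c1 <-] := slice_poisson_scaled (t1 j) l sg eu rho0 (fun w => @cB b w eu) d1 n0.
    have [c2 <-] := slice_poisson_scaled (t2 j) l sg eu rho0 (fun w => @cB b w eu) d2 m0.
    rewrite -segintD//; apply: eq_segint => t _; rewrite -mulrDl; congr (_ * _).
    rewrite /k /poisson /= !subr0 -!sqr_im_norm sqrrN QE.
    have -> : x 0 (lift ord0 j) = im_norm x * im_dir x 0 (lift ord0 j).
      by rewrite {1}(im_dirE x0) slice_point_im.
    have := M1 x t xB; have := M2 x t xB; rewrite /N -!sqr_im_norm /t1 /t2.
    have : (pi : R) != 0 by rewrite gt_eqF ?pi_gt0.
    move: (pi : R) (rho * cos t) (rho * sin t) (x 0 0 - a 0 0) (im_norm x) (im_dir x 0 _).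
    by move=> p A B al be I p0 h1 h2; field; rewrite p0 h1 h2.
  have -> : g x = g (slice_pt (im_dir x) (x 0 0, im_norm x)) by rewrite -xE.
  rewrite (slice_affine sg n0 Iu Ju T1 TJ IB JB).
  have S3 (F : 'I_3 -> R) : \sum_j F j = F 0 + F 1 + F 2.
    rewrite !big_ord_recl big_ord0 addr0 addrA; congr (F _ + F _ + F _); exact: val_inj.
  under [RHS]eq_bigr => j _ do rewrite -(key _ _ (imag_unit_qe j)).
  rewrite quat_sum_coord S3 !big_ord_recl !big_ord0 /= !quat_scaleE !addr0.
  by rewrite !addrA.
Qed.

End reproducing_exists_real.

(** * Regularity across the real points *)

Section extension.
Variables (R : realType) (n : nat).
Implicit Types (f : 'M[R]_(n, 4) -> quat R) (p x z : 'M[R]_(n, 4))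
  (U D W : set 'M[R]_(n, 4)) (i : 'I_n) (c l : 'I_4) (K : {set 'I_n}) (r : R)
  (a : quat R).

Lemma reproducing_exists a r : 0 < r ->
  (qIm a != 0 -> r ^+ 2 <= quat_sqnorm (qIm a)) ->
  exists m k s, @reproducing R a r (r / 2) m k s.
Proof.
move=> r0 ar; have [a0|a0] := eqVneq (qIm a) 0; first exact: reproducing_real.
by apply: reproducing_nonreal => //; exact: ar.
Qed.

Lemma pderiv_mull D (J : quat R) (G : 'M[R]_(n, 4) -> quat R) i c x :
  qsmooth 1 D G -> D x ->
  is_derive x (delta_mx i c) (fun z => - (J * G z)) (- (J * pderiv i c G x)).
Proof.
move=> sG Dx; have h := qsmooth_is_derive sG i c Dx.
have h2 := is_derive_quatM (is_derive_cst J x (delta_mx i c)) h.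
rewrite -[J * _]add0r -(mul0r (G x)).
by apply: (@is_deriveN _ _ _ (fun z => J * G z)); exact: h2.
Qed.

(** By [vartheta_slice] the hypothesis on [vartheta_bar] says that [S w], the derivative across the
    slice, is [J] times the derivative along the real direction. These two supply the gradients of
    the pair. *)
Lemma Gamma_CR U f x i K (J : quat R) l : open U -> qsmooth 1 (U `\` @real_points R n) (Gamma i K f) ->
  (forall z, (U `\` @real_points R n) z -> vartheta_bar i (Gamma i K f) z = 0) ->
  imag_units J ->
  CR_on [set w | (w.2 != 0) /\ (U `\` @real_points R n) (subst_coord x i (slice_pt J w))]
    (fun w => Gamma i K f (subst_coord x i (slice_pt J w)) 0 l)
    (fun w => - (J * Gamma i K f (subst_coord x i (slice_pt J w))) 0 l).
Proof.
move=> oU sG v0 Ju; set D := U `\` _ in sG v0 *; have oD : open D by exact: open_nonreal.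
set G := Gamma i K f in sG v0 *.
pose y (w : R * R) := subst_coord x i (slice_pt J w).
pose S w : quat R := \sum_c J 0 c *: pderiv i c G (y w).
have JJ : J * J = - 1 by exact: Ju.
have SE w : w.2 != 0 -> D (y w) -> J * pderiv i 0 G (y w) = S w /\ J * S w = - pderiv i 0 G (y w).
  move=> w2 Dy.
  have := @vartheta_slice R n G (y w) i J w.1 w.2 Ju w2 (row_subst_coord _ _ _).
  rewrite v0// scaler0 -/(S w) => E.
  have E2 : J * S w = - pderiv i 0 G (y w) by apply/eqP; rewrite -subr_eq0 opprK addrC E.
  split=> //; have := congr1 (fun b => J * b) E2.
  by rewrite mulrA JJ mulN1r mulrN => /oppr_inj <-.
have yc w : {for w, continuous y}.
  by apply: continuous_comp; [exact: slice_pt_continuous|exact: subst_coord_continuous].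
have dc w c : D (y w) -> {for w, continuous (fun w => pderiv i c G (y w))}.
  move=> Dy; apply: (@continuous_comp _ _ _ y (pderiv i c G)); first exact: yc.
  exact: (qsmooth_continuous (@qsmooth_pderiv R n 0 D G i c oD sG) Dy).
have sc w : D (y w) -> {for w, continuous S}.
  move=> Dy; apply: sum_continuous => c.
  apply/quat_continuousP => m; have /quat_continuousP/(_ m) h := dc w c Dy.
  have -> : (fun w => (J 0 c *: pderiv i c G (y w)) 0 m) = fun w => J 0 c * pderiv i c G (y w) 0 m.
    by apply/funext => w'; rewrite quat_scaleE.
  exact: (@cvgM R _ (nbhs w) _ (fun=> J 0 c) (fun w => pderiv i c G (y w) 0 m) _ _ (cvg_cst _) h).
have dE w c : D (y w) -> 'D_(delta_mx i c) (fun z => G z 0 l) (y w) = pderiv i c G (y w) 0 l.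
  move=> Dy; rewrite pderivE//; exact: (@ex_derive _ _ _ _ _ _ _ (qsmooth_is_derive sG i c Dy)).
have dE2 w c : D (y w) -> 'D_(delta_mx i c) (fun z => (- (J * G z)) 0 l) (y w) =
    (- (J * pderiv i c G (y w))) 0 l.
  move=> Dy; have h := @pderiv_mull D J G i c _ sG Dy.
  by rewrite -pderivE ?(pderiv_val h)//; exact: (@ex_derive _ _ _ _ _ _ _ h).
have sG2 : qsmooth 1 D (fun z => - (J * G z)).
  by apply: qsmoothN => //; apply: qsmoothM => //; exact: qsmooth_cst.
exists (fun w => pderiv i 0 G (y w) 0 l), (fun w => S w 0 l) => w [w2 Dy].
have [e1 e2] := SE w w2 Dy; split.
- have := @slice_gradient R n (fun z => G z 0 l) D x i J w oD (sG l) Dy.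
  rewrite -[subst_coord x i _]/(y w) dE//.
  rewrite (_ : \sum_c J 0 c * _ = S w 0 l)//.
  by rewrite quat_sum_coord; apply: eq_bigr => c _; rewrite quat_scaleE dE.
- have := @slice_gradient R n (fun z => (- (J * G z)) 0 l) D x i J w oD (sG2 l) Dy.
  rewrite -[subst_coord x i _]/(y w) dE2// e1 quat_oppE.
  rewrite (_ : \sum_c J 0 c * _ = pderiv i 0 G (y w) 0 l).
    have -> : (fun w0 : R * R => (- (J * G (subst_coord x i (w0.1%:A + J * w0.2%:A)))) 0 l) =
      (fun w0 : R * R => - (J * G (y w0)) 0 l); last by [].
    by apply/funext => w0; rewrite quat_oppE.
  rewrite -[pderiv _ _ _ _]opprK -e2 mulr_sumr quat_oppE quat_sum_coord -sumrN.
  by apply: eq_bigr => c _; rewrite dE2// quat_oppE -scalerAr quat_scaleE mulrN.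
- by have /quat_continuousP := dc w 0 Dy; exact.
- by have /quat_continuousP := sc w Dy; exact.
Qed.

End extension.

(** * Extension of [Gamma] across the real points of one variable *)

Section slice_extension.
Variables (R : realType) (n : nat).
Implicit Types (f : 'M[R]_(n, 4) -> quat R) (p x z : 'M[R]_(n, 4))
  (U D W : set 'M[R]_(n, 4)) (i : 'I_n) (c l : 'I_4) (K : {set 'I_n}) (r : R)
  (a : quat R).

Lemma nonreal_subst U p r x i a : ebox p r `<=` U -> ebox p r x ->
  (forall j, qIm (qcoord x j) != 0) -> qball (qcoord p i) r a -> qIm a != 0 ->
  (U `\` @real_points R n) (subst_coord x i a).
Proof.
move=> BU xB xn aB an; split; first by apply: BU; exact: ebox_subst.
apply/nonrealP => j; have [->|ji] := eqVneq j i; first by rewrite row_subst_coord.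
by rewrite row_subst_coord_neq.
Qed.

Lemma qsmooth_nonreal U f : open U -> Ck n (U `\` @real_points R n) f ->
  qsmooth n (U `\` @real_points R n) f.
Proof. by move=> oU /Ck_qsmoothP; apply; exact: open_nonreal. Qed.

(** [Gamma] involves derivatives, about which continuity of [f] says nothing directly. But as a
    function of variable [i] alone it is a combination, with constant coefficients, of values of [f]
    at points whose first [i] coordinates are moved on their spheres; those values are continuous up
    to real [a]. *)
Lemma Gamma_extension U f p r x i K : open U -> locally_strongly_slice U f ->
  good_radius p r -> ebox p r `<=` U -> K \subset first_coords n i ->
  ebox p r x -> (forall j, qIm (qcoord x j) != 0) ->
  exists h : quat R -> quat R,
    (forall a, qball (qcoord p i) r a -> {for a, continuous h}) /\
    forall a, qball (qcoord p i) r a -> qIm a != 0 ->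
      h a = Gamma i K f (subst_coord x i a).
Proof.
move=> oU lf gr BU KS xB xn; set D := U `\` @real_points R n.
have oD : open D by exact: open_nonreal.
have y0 z j : D z -> qIm (qcoord z j) != 0 by move=> [_ /nonrealP].
have sB := slice_on_ebox oU lf gr BU; have [fc fs _] := lf.
have sf : qsmooth n D f by exact: qsmooth_nonreal.
have [r' [[r'0 _] _ r'B]] := exists_good_radius (@open_ebox R n p r) xB ltr01.
have r2 : 0 < r' ^+ 2 by rewrite exprn_gt0.
have /choice[b bP] : forall j : 'I_n, exists b : quat R,
    [/\ b != qcoord x j, b 0 0 = qcoord x j 0 0,
      quat_sqnorm (qIm b) = quat_sqnorm (qIm (qcoord x j)) &
      quat_sqnorm (b - qcoord x j) < r' ^+ 2].
  by move=> j; apply: exists_near_on_sphere => //; exact: xn.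
pose CC (h : quat R -> quat R) := exists h' : quat R -> quat R,
    (forall a, qball (qcoord p i) r a -> {for a, continuous h'}) /\
    forall a, qball (qcoord p i) r a -> qIm a != 0 -> h' a = h a.
suff : CC (fun a => Gamma i K f (subst_coord x i a)) by [].
move: K KS; apply: (@neg_conj_prod_coefficients R n (quat R) CC i
  (fun K a => Gamma i K f (subst_coord x i a)) x b) => //.
- move=> h k [h' [hc hE]] [k' [kc kE]]; exists (fun a => h' a - k' a); split.
    move=> a aB; apply/quat_continuousP => l.
    have /quat_continuousP/(_ l) h1 := hc a aB; have /quat_continuousP/(_ l) h2 := kc a aB.
    have -> : (fun a => (h' a - k' a) 0 l) = fun a => h' a 0 l - k' a 0 l.
      by apply/funext => w; rewrite quat_addE quat_oppE.
    exact: (@cvgB R R _ (nbhs a) _ _ _ _ _ h1 h2).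
  by move=> a aB an; rewrite hE// kE.
- move=> e h [h' [hc hE]]; exists (fun a => e * h' a); split.
    by move=> a aB; apply: quat_mull_continuous; exact: hc.
  by move=> a aB an; rewrite hE.
- exact: ltnW.
- by move=> j; have [] := bP j.
move=> z zE.
pose z' : 'M[R]_(n, 4) := \matrix_(l, c) (if (l < i)%N then z l c else x l c).
have z'E j : qcoord z' j = if (j < i)%N then qcoord z j else qcoord x j.
  by apply/rowP => l; rewrite !mxE; case: ifP => _; rewrite mxE.
have z'B : ebox p r z'.
  apply: r'B => j; have xx := ebox_center x r'0 j; rewrite z'E; case: ifP => _ //.
  by case: (zE j) => -> //; have [] := bP j.
have sph j : qcoord x j 0 0 = qcoord z' j 0 0 /\
    quat_sqnorm (qIm (qcoord x j)) = quat_sqnorm (qIm (qcoord z' j)).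
  by rewrite z'E; case: ifP => // _; case: (zE j) => -> //; have [_ -> ->] := bP j.
have z'n j : qIm (qcoord z' j) != 0.
  by rewrite -quat_sqnorm_eq0 -(sph j).2 quat_sqnorm_eq0 xn.
exists (fun a => f (subst_coord z' i a)); split.
  move=> a aB; apply: (@continuous_comp _ _ _ (fun a => subst_coord z' i a) f).
    exact: subst_coord_continuous.
  by have [+ _] := fc; apply; apply: BU; exact: ebox_subst.
move=> a aB an.
have Dz := nonreal_subst BU z'B z'n aB an; have Dx := nonreal_subst BU xB xn aB an.
rewrite (Gamma_sum oD y0 sf (ltnW (ltn_ord i)) Dz).
apply: eq_bigr => L; rewrite powersetE => LS.
have -> : neg_conj_prod (first_coords n i :\: L)%SET (subst_coord z' i a) =
    neg_conj_prod (first_coords n i :\: L)%SET z.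
  apply: eq_neg_conj_prod => j; rewrite finset.in_setD inE => /andP[_ ji].
  by rewrite row_subst_coord_neq ?z'E ?ji// neq_ltn ji.
suff -> : Gamma i L f (subst_coord x i a) = Gamma i L f (subst_coord z' i a) by [].
apply: sB => //; [exact: ltnW|exact: ebox_subst|exact: ebox_subst|by move=> j; exact: y0|].
apply/polysphereP; split=> j ji.
  have jn : j != i by rewrite neq_ltn ji.
  by rewrite !row_subst_coord_neq//; exact: sph.
have [->|jn] := eqVneq j i; first by rewrite !row_subst_coord.
by rewrite !row_subst_coord_neq// z'E ltnNge ji.
Qed.

Lemma Gamma_slice_regular U f p r x i K : open U -> locally_strongly_slice U f ->
  (forall m x, (U `\` @real_points R n) x -> theta_bar m f x = 0) ->
  good_radius p r -> ebox p r `<=` U -> K \subset first_coords n i ->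
  ebox p r x -> (forall j, qIm (qcoord x j) != 0) ->
  exists h : quat R -> quat R, slice_regular_on (qcoord p i) r h /\
    forall a, qball (qcoord p i) r a -> qIm a != 0 ->
      h a = Gamma i K f (subst_coord x i a).
Proof.
move=> oU lf th gr BU KS xB xn; set D := U `\` @real_points R n.
have oD : open D by exact: open_nonreal.
have y0 z j : D z -> qIm (qcoord z j) != 0 by move=> [_ /nonrealP].
have sB := slice_on_ebox oU lf gr BU; have [fc fs _] := lf.
have sf : qsmooth n D f by exact: qsmooth_nonreal.
have [h [hc hE]] := Gamma_extension oU lf gr BU KS xB xn.
have Da a : qball (qcoord p i) r a -> qIm a != 0 -> D (subst_coord x i a).
  by move=> aB an; exact: (nonreal_subst BU xB xn aB an).
exists h; split=> //; split=> //.
(* [Gamma_decomp] is the affine form in variable [i]; its two coefficients are constant on spheres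
   by the slice property. *)
- exists (fun a => Gamma i.+1 (i |: K)%SET f (subst_coord x i a)),
    (fun a => Gamma i.+1 K f (subst_coord x i a)); split.
    move=> a aB an; rewrite hE// (Gamma_decomp oD y0 sf (Da a aB an)) ?row_subst_coord//.
    by apply: contraTN KS => iK; apply/negP => /fintype.subsetP/(_ _ iK); rewrite inE ltnn.
  move=> a b aB bB an ab abn.
  have KS1 : K \subset first_coords n i.+1.
    by apply/fintype.subsetP => j /(fintype.subsetP KS); rewrite !inE => /ltnW.
  have KS2 : (i |: K)%SET \subset first_coords n i.+1.
    apply/fintype.subsetP => j; rewrite in_setU1 => /orP[/eqP ->|/(fintype.subsetP KS1)//].
    by rewrite inE.
  have ps : polysphere i.+1 (subst_coord x i a) (subst_coord x i b).
    apply/polysphereP; split=> j ji.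
      have [->|jn] := eqVneq j i; first by rewrite !row_subst_coord.
      by rewrite !row_subst_coord_neq.
    have jn : j != i by rewrite neq_ltn ji orbT.
    by rewrite !row_subst_coord_neq.
  split; apply: sB => //; try exact: ebox_subst; by move=> j; exact: y0 (Da a aB an).
- move=> J l Ju.
  have sG : qsmooth 1 D (Gamma i K f).
    apply: qsmoothW (qsmooth_Gamma K oD y0 sf (ltnW (ltn_ord i))) => //.
    by rewrite subn_gt0.
  have v0 z : D z -> vartheta_bar i (Gamma i K f) z = 0.
    by move=> Dz; exact: (theta_bar_vartheta oU lf th KS Dz).
  have CR := @Gamma_CR R n U f x i K J l oU sG v0 Ju.
  pose G := [set w : R * R | w.2 != 0 /\ qball (qcoord p i) r (slice_pt J w)].
  have GD : G `<=` [set w | w.2 != 0 /\ D (subst_coord x i (slice_pt J w))].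
    move=> w [w2 wB]; split=> //; apply: Da => //.
    by rewrite qIm_slice_point// scaler_eq0 negb_or w2 imag_unit_neq0.
  have oG w : G w -> \forall w' \near w, G w'.
    move=> [w2 wB].
    have c2 : {for w, continuous (fun w : R * R => w.2)} by exact: cvg_snd.
    have n2 : \forall w' \near w, w'.2 != 0 by exact: (cvgr_neq0 _ c2 w2).
    have c1 : {for w, continuous (fun w => quat_sqnorm (slice_pt J w - qcoord p i))}.
      apply: (@continuous_comp _ _ _ (fun w => slice_pt J w - qcoord p i) (@quat_sqnorm R)).
        exact: (@cvgB R (quat R) _ (nbhs w) _ (slice_pt J) (fun=> qcoord p i) _ _
          (@slice_pt_continuous R J w) (cvg_cst _)).
      exact: quat_sqnorm_continuous.
    have n1 : \forall w' \near w, quat_sqnorm (slice_pt J w' - qcoord p i) < r ^+ 2.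
      exact: (cvgr_lt _ c1 _ wB).
    by near=> w'; split; near: w'.
  have E w : G w -> h (slice_pt J w) = Gamma i K f (subst_coord x i (slice_pt J w)).
    move=> [w2 wB]; apply: hE => //.
    by rewrite qIm_slice_point// scaler_eq0 negb_or w2 imag_unit_neq0.
  apply: near_CR_on (sub_CR_on GD CR) => w /oG oGw; apply: filterS oGw => w' Gw'.
    by rewrite E.
  by rewrite E.
Unshelve. all: end_near. Qed.

End slice_extension.

(** * Approach to real points along rays *)

Section density.
Variable R : realType.

(** Reaching exceptional points: an identity between continuous functions is needed only at
    [t *: v + x] for small positive [t], with [v] chosen so that these points are generic. *)
Lemma continuous_ray_eq (V W : normedModType R) (h1 h2 : V -> W) (x v : V) :
  {for x, continuous h1} -> {for x, continuous h2} ->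
  (\forall t \near (0 : R)^'+, h1 (t *: v + x) = h2 (t *: v + x)) -> h1 x = h2 x.
Proof.
move=> c1 c2 E.
have lim (h : V -> W) : {for x, continuous h} -> h (t *: v + x) @[t --> (0 : R)^'+] --> h x.
  move=> ch; apply: cvg_at_right_filter.
  have l : {for (0 : R), continuous (fun t : R => t *: v + x)} by exact: line_continuous.
  have E0 : 0 *: v + x = x by rewrite scale0r add0r.
  have ch0 : {for (fun t : R => t *: v + x) 0, continuous h} by rewrite E0.
  by rewrite -[X in _ --> h X]E0; exact: (continuous_comp l ch0).
apply: (@cvg_unique W _ (h1 (t *: v + x) @[t --> (0 : R)^'+])); last 2 first.
- exact: lim.
- by apply: cvg_trans (lim _ c2); apply: near_eq_cvg; near=> t; symmetry; near: t.
- exact: norm_hausdorff.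
Unshelve. all: end_near. Qed.

Lemma near_ray (V : normedModType R) (U : set V) (x v : V) : open U -> U x ->
  \forall t \near (0 : R)^'+, U (t *: v + x).
Proof.
move=> oU Ux.
have l : {for (0 : R), continuous (fun t : R => t *: v + x)} by exact: line_continuous.
have := l U; rewrite scale0r add0r => /(_ (open_nbhs_nbhs (conj oU Ux))) h.
by apply: cvg_within; exact: h.
Qed.

Variable n : nat.
Implicit Types (x y p : 'M[R]_(n, 4)) (a : quat R).

(** Along this direction [|Im|] is strictly increasing, starting from its value at [a]. Using
    [qIm a] itself when it is nonzero keeps two points of one sphere on a common sphere for every
    [t]. *)
Definition away a : quat R := if qIm a == 0 then qi else qIm a.
Definition away_mx x : 'M[R]_(n, 4) := \matrix_(j, c) away (qcoord x j) 0 c.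

Lemma qcoord_ray x v (t : R) j : qcoord (t *: v + x : 'M[R]_(n, 4)) j =
  t *: qcoord v j + qcoord x j.
Proof. by apply/rowP => l; rewrite !mxE. Qed.

Lemma qcoord_away x j : qcoord (away_mx x) j = away (qcoord x j).
Proof. by apply/rowP => l; rewrite !mxE. Qed.

Lemma qIm_away a (t : R) : qIm (t *: away a + a) =
  (t + (qIm a != 0)%:R) *: away a.
Proof.
have qD (b c : quat R) (s : R) : qIm (s *: b + c) = s *: qIm b + qIm c.
  by elim/quatW: b => b0 b1 b2 b3; elim/quatW: c => c0 c1 c2 c3; rewrite !mkquatDE; congr mkquat; ring.
rewrite qD /away scalerDl; case: eqVneq => [->|an] /=.
  by rewrite scale0r !addr0 qIm_mkquat.
by rewrite scale1r; congr (_ *: _ + _); elim/quatW: a an => a0 a1 a2 a3 _; rewrite !mkquatDE.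
Qed.

Lemma away_neq0 a : away a != 0.
Proof.
rewrite /away; have [_|//] := eqVneq (qIm a) 0.
by rewrite -quat_sqnorm_eq0 /quat_sqnorm !mkquatE !expr0n /= expr1n add0r !addr0 oner_eq0.
Qed.

Lemma qIm_away_neq0 a (t : R) : 0 < t -> qIm (t *: away a + a) != 0.
Proof.
move=> t0; rewrite qIm_away scaler_eq0 negb_or away_neq0 andbT gt_eqF//.
by rewrite ltr_pwDl.
Qed.

(** By strict monotonicity the value [e] is taken at most once for positive [t]. *)
Lemma near_sqnorm_away a (e : R) :
  \forall t \near (0 : R)^'+, quat_sqnorm (qIm (t *: away a + a)) != e.
Proof.
pose h (t : R) := quat_sqnorm (qIm (t *: away a + a)).
have hmono s t : 0 < s -> s < t -> h s < h t.
  move=> s0 st; rewrite /h !qIm_away !quat_sqnorm_scale ltr_pM2r.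
    by rewrite ltr_pXn2r ?ltrD2r ?nnegrE ?addr_ge0// ltW// (lt_trans s0).
  by rewrite lt_neqAle eq_sym quat_sqnorm_eq0 away_neq0 quat_sqnorm_ge0.
have [[t0 [t00 ht0]]|no] := pselect (exists t0, 0 < t0 /\ h t0 = e).
  near=> t; have t1 : 0 < t by near: t; exact: nbhs_right_gt.
  have t2 : t < t0 by near: t; exact: nbhs_right_lt.
  by rewrite -ht0 lt_eqF// hmono.
near=> t; have t1 : 0 < t by near: t; exact: nbhs_right_gt.
by apply/eqP => ht; apply: no; exists t.
Unshelve. all: end_near. Qed.

End density.

Section reproduction.
Variable R : realType.
Implicit Types (a : quat R) (r : R).

Variables (m : nat) (k : 'I_m -> R -> quat R -> R) (s : 'I_m -> R -> quat R).

Definition reproduces a (h : quat R -> quat R) :=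
  (forall l, continuous (fun t => h (s l t))) /\
  forall c, h a 0 c = \sum_l segint 0 (2 * pi) (fun t => k l t a * h (s l t) 0 c).

Lemma reproduces0 a : reproduces a (fun=> 0).
Proof.
split=> [l t|c]; first exact: cvg_cst.
rewrite big1 => [|l _]; first by rewrite quat_0E.
rewrite (@eq_segint _ _ _ _ (fun=> 0)) ?segint_cst ?mul0r// ?mulr_ge0 ?pi_ge0//.
by move=> t _; rewrite quat_0E mulr0.
Qed.

Lemma reproducesD a (h g : quat R -> quat R) : (forall l, continuous (k l ^~ a)) ->
  reproduces a h -> reproduces a g -> reproduces a (fun x => h x + g x).
Proof.
move=> kc [hc hE] [gc gE]; split=> [l t|c].
  apply/quat_continuousP => c.
  have -> : (fun t => (h (s l t) + g (s l t)) 0 c) = fun t => h (s l t) 0 c + g (s l t) 0 c.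
    by apply/funext => u; rewrite quat_addE.
  have /quat_continuousP/(_ c) h1 := hc l t; have /quat_continuousP/(_ c) h2 := gc l t.
  exact: (@cvgD R R _ (nbhs t) _ _ _ _ _ h1 h2).
have kM (u : quat R -> quat R) l : (forall l, continuous (fun t => u (s l t))) ->
    continuous_on_segment 0 (2 * pi) (fun t => k l t a * u (s l t) 0 c).
  move=> uc; apply: continuous_on_segmentM => t _; first exact: kc.
  by have /quat_continuousP := uc l t; exact.
rewrite quat_addE hE gE -big_split/=; apply: eq_bigr => l _.
rewrite -segintD; [|exact: kM|exact: kM].
by apply: eq_segint => t _; rewrite quat_addE mulrDr.
Qed.

(** Left multiplication by [b] acts on the components by a real matrix, which passes through the
    kernels. *)
Lemma reproduces_mull a b (h : quat R -> quat R) : (forall l, continuous (k l ^~ a)) ->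
  reproduces a h -> reproduces a (fun x => b * h x).
Proof.
move=> kc [hc hE]; split=> [l t|c]; first by apply: quat_mull_continuous; exact: hc.
have kM l d : continuous_on_segment 0 (2 * pi) (fun t => k l t a * h (s l t) 0 d).
  apply: continuous_on_segmentM => t _; first exact: kc.
  by have /quat_continuousP := hc l t; exact.
rewrite quat_mulE_basis.
under eq_bigr => d _ do rewrite hE mulr_sumr.
rewrite exchange_big; apply: eq_bigr => l _ /=.
under eq_bigr => d _ do rewrite -segintZ//.
rewrite -segint_sum.
  apply: eq_segint => t _; rewrite quat_mulE_basis mulr_sumr.
  by apply: eq_bigr => d _; rewrite mulrCA.
by move=> d; apply: continuous_on_segmentM => // t _; exact: cvg_cst.
Qed.

Lemma reproduces_sum a (T : finType) (F : T -> quat R -> quat R) :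
  (forall l, continuous (k l ^~ a)) -> (forall K, reproduces a (F K)) ->
  reproduces a (fun x => \sum_K F K x).
Proof.
move=> kc FK; rewrite /index_enum; move: (Finite.enum _) => e.
elim: e => [|K e IH].
  by rewrite (_ : (fun x => _) = fun=> 0); [exact: reproduces0|apply/funext => x; rewrite big_nil].
rewrite (_ : (fun x => _) = fun x => F K x + \sum_(L <- e) F L x).
  exact: reproducesD.
by apply/funext => x; rewrite big_cons.
Qed.

End reproduction.

Section reproduction_formula.
Variables (R : realType) (n : nat).
Implicit Types (f : 'M[R]_(n, 4) -> quat R) (p x z : 'M[R]_(n, 4))
  (U D W : set 'M[R]_(n, 4)) (i : 'I_n) (c : 'I_4) (K : {set 'I_n}) (r : R)
  (a : quat R).

(** The extensions of the [Gamma i K f] are reproduced, hence so is their combination [F] with the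
    factors [N K], which are constant in variable [i]. It remains to see that [F] is [f] along
    variable [i]. *)
Lemma slice_reproduction U f p r x i m (k : 'I_m -> R -> quat R -> R) s c :
  open U -> locally_strongly_slice U f ->
  (forall m x, (U `\` @real_points R n) x -> theta_bar m f x = 0) ->
  good_radius p r -> ebox p r `<=` U ->
  reproducing (qcoord p i) r (r / 2) k s ->
  ebox p r x -> (forall j, qIm (qcoord x j) != 0) ->
  qball (qcoord p i) (r / 2) (qcoord x i) ->
  quat_sqnorm (qIm (qcoord x i)) != quat_sqnorm (qIm (qcoord p i)) ->
  f x 0 c = \sum_l segint 0 (2 * pi)
    (fun t => k l t (qcoord x i) * f (subst_coord x i (s l t)) 0 c).
Proof.
move=> oU lf th gr BU rep xB xn xi2 xg; set D := U `\` @real_points R n.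
have oD : open D by exact: open_nonreal.
have y0 z j : D z -> qIm (qcoord z j) != 0 by move=> [_ /nonrealP].
have [fc fs _] := lf; have sf : qsmooth n D f by exact: qsmooth_nonreal.
have [sc sB _ repE] := rep.
have kc l : continuous (k l ^~ (qcoord x i)) by exact: (reproducing_continuous rep).
have xiB : qball (qcoord p i) r (qcoord x i) by exact: xB.
(* The value [0] for sets outside [first_coords n i] lets the sum run over all [K]. *)
have /choice[g gP] : forall K, exists h : quat R -> quat R,
    (K \subset first_coords n i -> slice_regular_on (qcoord p i) r h /\
     forall a, qball (qcoord p i) r a -> qIm a != 0 ->
       h a = Gamma i K f (subst_coord x i a)) /\
    (~~ (K \subset first_coords n i) -> h = fun=> 0).
  move=> K; have [KS|KS] := boolP (K \subset first_coords n i).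
    by have [h hP] := Gamma_slice_regular oU lf th gr BU KS xB xn; exists h.
  by exists (fun=> 0).
pose N K := neg_conj_prod (first_coords n i :\: K)%SET x.
pose F a := \sum_K N K * g K a.
have repF : reproduces k s (qcoord x i) F.
  apply: reproduces_sum => // K; have [h1 h2] := gP K.
  have [KS|KS] := boolP (K \subset first_coords n i); last first.
    rewrite (_ : (fun _ => _) = fun=> 0); first exact: reproduces0.
    by apply/funext => a; rewrite h2// mulr0.
  have [sg gE] := h1 KS; have [gc _ _] := sg.
  apply: reproduces_mull => //; split.
    by move=> l t; apply: continuous_comp; [exact: sc|exact: gc].
  by move=> d; exact: repE.
have Fnr a : qball (qcoord p i) r a -> qIm a != 0 -> F a = f (subst_coord x i a).
  move=> aB an; have Da := nonreal_subst BU xB xn aB an.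
  rewrite (Gamma_sum oD y0 sf (ltnW (ltn_ord i)) Da) [RHS]big_mkcond.
  apply: eq_bigr => K _; rewrite powersetE; have [h1 h2] := gP K.
  case: ifPn => KS; last by rewrite h2// mulr0.
  have [_ ->//] := h1 KS; congr (_ * _); apply: eq_neg_conj_prod => j.
  rewrite finset.in_setD inE => /andP[_ ji].
  by rewrite row_subst_coord_neq// neq_ltn ji.
(* The curves may cross the real axis, where [Gamma] no longer represents [f]; there the identity
   follows by continuity of both sides. *)
have FE a : qball (qcoord p i) r a -> F a = f (subst_coord x i a).
  move=> aB; apply: (@continuous_ray_eq R (quat R) (quat R) F (fun a => f (subst_coord x i a)) a (away a)).
  - apply: sum_continuous => K; apply: quat_mull_continuous; have [h1 h2] := gP K.
    have [KS|KS] := boolP (K \subset first_coords n i); last first.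
      by rewrite (h2 KS) => A; exact: (@cvg_cst (quat R) 0 _ (nbhs a) _).
    by have [[gc _ _] _] := h1 KS; exact: gc.
  - apply: (@continuous_comp _ _ _ (fun a => subst_coord x i a) f).
      exact: subst_coord_continuous.
    by have [+ _] := fc; apply; apply: BU; exact: ebox_subst.
  near=> t; have t0 : 0 < t by near: t; exact: nbhs_right_gt.
  apply: Fnr; last exact: qIm_away_neq0.
  by near: t; apply: near_ray => //; exact: open_qball.
have [_ E] := repF; have := E c; rewrite FE// subst_coord_id => ->.
by apply: eq_bigr => l _; apply: eq_segint => t _; rewrite FE.
Unshelve. all: end_near. Qed.

End reproduction_formula.

Lemma smooth_local (R : realType) (V : normedModType R) k (S U : set V) (g : R -> V -> R) :
  (forall x, U x -> exists W, W x /\ smooth k S W g) -> smooth k S U g.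
Proof.
elim: k g => [|k IH] g H /=.
  by split=> // t x /H[W [Wx [Wc _]]]; exact: Wc.
split=> [t x /H[W [Wx [Wc _]]]|v Sv]; first exact: Wc.
split=> [t x /H[W [Wx [_ /(_ v Sv)[Wd _]]]]|]; first exact: Wd.
by apply: IH => x /H[W [Wx [_ /(_ v Sv)[_ Ws]]]]; exists W.
Qed.

(** * Smoothness of [f] near every point *)

Section regularity.
Variables (R : realType) (n : nat).
Implicit Types (f : 'M[R]_(n, 4) -> quat R) (p x z : 'M[R]_(n, 4))
  (U D W : set 'M[R]_(n, 4)) (i j : 'I_n) (c : 'I_4) (r : R)
  (a : quat R).

(** The variables already treated are arguments of kernels, which are smooth for radius [r / 2]; the
    others are still arguments of [f] and range over the full radius, as the curves do. *)
Definition half_box p r m : set 'M[R]_(n, 4) :=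
  [set x | ebox p r x /\ forall j, (j < m)%N -> qball (qcoord p j) (r / 2) (qcoord x j)].

Lemma open_half_box p r m : open (half_box p r m).
Proof.
rewrite openE => x [xB xm]; rewrite /interior.
have h1 : \forall y \near x, ebox p r y by exact: (open_nbhs_nbhs (conj (@open_ebox R n p r) xB)).
have h2 : \forall y \near x, forall j, (j < m)%N -> qball (qcoord p j) (r / 2) (qcoord y j).
  apply: (@filter_forall _ _ (fun j y => (j < m)%N -> qball (qcoord p j) (r / 2) (qcoord y j)) (nbhs x)) => j.
  case: (ltnP j m) => [jm|_]; last exact: nearW.
  apply: filterS (open_nbhs_nbhs (conj (@open_qball_coord R n j (qcoord p j) (r / 2)) (xm j jm))).
  by [].
by near=> y; split; near: y.
Unshelve. all: end_near. Qed.

Lemma subst_coord_split x i a :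
  subst_coord x i a = x - subst_coord 0 i (qcoord x i) + subst_coord 0 i a.
Proof.
apply/matrixP => j c; rewrite !mxE; case: eqVneq => [->|_]; last by rewrite subr0 addr0.
by rewrite subrr add0r.
Qed.

Lemma subst_curve_continuous i (s : R -> quat R) t x : continuous s ->
  {for (t, x), continuous (fun q : R * 'M[R]_(n, 4) => subst_coord q.2 i (s q.1))}.
Proof.
move=> sc.
rewrite (_ : (fun q => _) = fun q : R * 'M[R]_(n, 4) =>
  q.2 - subst_coord 0 i (qcoord q.2 i) + subst_coord 0 i (s q.1)); last first.
  by apply/funext => q; exact: subst_coord_split.
have c2 : {for (t, x), continuous (fun q : R * 'M[R]_(n, 4) => q.2)} by exact: cvg_snd.
have c3 : {for (t, x), continuous (fun q : R * 'M[R]_(n, 4) => subst_coord (0 : 'M[R]_(n, 4)) i (qcoord q.2 i))}.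
  apply: (@continuous_comp _ _ _ (fun q : R * 'M[R]_(n, 4) => qcoord q.2 i) (subst_coord 0 i)).
    exact: (@continuous_comp _ _ _ (fun q : R * 'M[R]_(n, 4) => q.2) (fun z => qcoord z i) _ c2
      (@qcoord_continuous R n i x)).
  exact: subst_coord_continuous.
have c4 : {for (t, x), continuous (fun q : R * 'M[R]_(n, 4) => subst_coord (0 : 'M[R]_(n, 4)) i (s q.1))}.
  apply: (@continuous_comp _ _ _ (fun q : R * 'M[R]_(n, 4) => s q.1) (subst_coord 0 i)).
    apply: (@continuous_comp _ _ _ (fun q : R * 'M[R]_(n, 4) => q.1) s); [exact: cvg_fst|exact: sc].
  exact: subst_coord_continuous.
have c5 := @cvgB R 'M[R]_(n, 4) _ (nbhs (t, x)) _ (fun q : R * 'M[R]_(n, 4) => q.2)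
  (fun q => subst_coord 0 i (qcoord q.2 i)) _ _ c2 c3.
exact: (@cvgD R 'M[R]_(n, 4) _ (nbhs (t, x)) _
  (fun q : R * 'M[R]_(n, 4) => q.2 - subst_coord 0 i (qcoord q.2 i))
  (fun q => subst_coord 0 i (s q.1)) _ _ (c5 _) c4).
Qed.

(** After the substitution [f] no longer sees variable [i]: in that direction only the kernel is
    differentiated, and the map on directions that clears row [i] sends it to [0]. In the earlier
    directions the smoothness of [f] is inherited. *)
Lemma reproduction_smooth f p r i m (k : 'I_m -> R -> quat R -> R) s c N :
  reproducing (qcoord p i) r (r / 2) k s ->
  smooth N (coord_dirs [set j | (j < i)%N]) (half_box p r i) (fun _ x => f x 0 c) ->
  smooth N (coord_dirs [set j | (j < i.+1)%N]) (half_box p r i.+1)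
    (fun _ x => \sum_l segint 0 (2 * pi)
      (fun t => k l t (qcoord x i) * f (subst_coord x i (s l t)) 0 c)).
Proof.
move=> [sc sB ks _] sf; set D := half_box p r i.+1; have oD : open D by exact: open_half_box.
apply: smooth_sum => // l.
apply: (@smooth_segint R 'M[R]_(n, 4) N _ D (fun t x => k l t (qcoord x i) * f (subst_coord x i (s l t)) 0 c)) => //.
  by rewrite mulr_ge0// pi_ge0.
apply: smoothM => //.
  apply: smooth_sub (ks n i N l).
    by move=> v [j _ [d ->]]; exists j => //; exists d.
  by move=> x [_ /(_ i)]; apply.
apply: (@smooth_comp R 'M[R]_(n, 4) 'M[R]_(n, 4) N _ D (coord_dirs [set j | (j < i)%N])
  (half_box p r i) (fun t x => subst_coord x i (s l t)) (fun v => subst_coord v i 0)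
  (fun _ x => f x 0 c)) => //.
- by move=> t x _; exact: subst_curve_continuous.
- move=> t x v h _; apply/matrixP => j d; rewrite !mxE.
  by case: eqVneq => // _; rewrite mulr0 add0r.
- move=> v [j /= ji [d ->]]; have [jE|jn] := eqVneq j i.
    left; apply/matrixP => j' d'; rewrite !mxE jE; case: eqVneq => //.
  right; exists j; first by rewrite /= ltn_neqAle -ltnS ji andbT; exact: jn.
  exists d; apply/matrixP => j' d'; rewrite !mxE; case: eqVneq => // ->.
  by rewrite eq_sym (negbTE jn).
- move=> t x [xB xm]; split; first by apply: ebox_subst => //; exact: sB.
  move=> j ji; rewrite row_subst_coord_neq ?neq_ltn ?ji//.
  by apply: xm; exact: ltnW.
Qed.

(** Induction on the number of variables in which smoothness is known; with none, only continuity of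
    [f] is claimed. The reproduction formula holds at generic points, and as both of its sides are
    continuous, rays along [away_mx] extend it to the whole box. *)
Lemma smooth_half_box U f p r c N m : open U -> locally_strongly_slice U f ->
  (forall m x, (U `\` @real_points R n) x -> theta_bar m f x = 0) ->
  good_radius p r -> ebox p r `<=` U -> (m <= n)%N ->
  smooth N (coord_dirs [set j | (j < m)%N]) (half_box p r m) (fun _ x => f x 0 c).
Proof.
move=> oU lf th gr BU; have [r0 gr'] := gr; have [[fc _] _ _] := lf.
have fcc x : ebox p r x -> {for x, continuous (fun x => f x 0 c)}.
  by move=> /BU /fc /quat_continuousP; exact.
have fcj x : ebox p r x -> forall t : R,
    {for (t, x), continuous (fun q : R * 'M[R]_(n, 4) => f q.2 0 c)}.
  move=> xB t; apply: (@continuous_comp _ _ _ (fun q : R * 'M[R]_(n, 4) => q.2) (fun x => f x 0 c)).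
    exact: cvg_snd.
  exact: fcc.
elim: m N => [|m IH] N mn.
  by case: N => [|N] /=; split=> //; [move=> t x [/fcj]|move=> t x [/fcj]|move=> v [j]].
pose i := Ordinal mn; have := IH^~ (ltnW mn); rewrite -[X in [set j | (j < X)%N]]/(nat_of_ord i) => IHi.
have [M [k [s rep]]] := reproducing_exists r0 (gr' i).
pose g x := \sum_l segint 0 (2 * pi)
  (fun t => k l t (qcoord x i) * f (subst_coord x i (s l t)) 0 c).
have sg N' : smooth N' (coord_dirs [set j | (j < i.+1)%N]) (half_box p r i.+1) (fun _ => g).
  exact: reproduction_smooth rep (IHi N').
have oD := @open_half_box p r i.+1.
apply: (eq_smooth oD _ (sg N)) => _ x Dx.
symmetry; have [xB xm] := Dx.
apply: (@continuous_ray_eq R 'M[R]_(n, 4) R (fun x => f x 0 c) g x (away_mx x)).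
- exact: fcc.
- exact: (@smooth_continuousr _ _ _ _ _ _ (sg 0%N) 0 x Dx).
near=> t.
have t0 : 0 < t by near: t; exact: nbhs_right_gt.
have [yB ym] : half_box p r i.+1 (t *: away_mx x + x).
  by near: t; exact: (@near_ray R _ _ x (away_mx x) oD Dx).
apply: (slice_reproduction c oU lf th gr BU rep) => //.
- by move=> j; rewrite qcoord_ray qcoord_away qIm_away_neq0.
- exact: ym.
- rewrite qcoord_ray qcoord_away; near: t; exact: near_sqnorm_away.
Unshelve. all: end_near. Qed.

Lemma slice_Ck U f k : open U -> locally_strongly_slice U f ->
  (forall m x, (U `\` @real_points R n) x -> theta_bar m f x = 0) -> Ck k U f.
Proof.
move=> oU lf th; apply/Ck_qsmoothP => // c.
apply: smooth_local => p Up.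
have [r [gr _ BU]] := exists_good_radius oU Up ltr01; have [r0 _] := gr.
exists (half_box p r n); split.
  split=> [|j _]; first exact: ebox_center.
  rewrite /qball /= subrr (eqP (_ : quat_sqnorm 0 == 0)) ?quat_sqnorm_eq0//.
  by rewrite exprn_gt0// divr_gt0.
apply: smooth_sub (smooth_half_box c k oU lf th gr BU (leqnn n)) => //.
by move=> v [j _ [d ->]]; exists j => //=; exists d.
Qed.

End regularity.

(** * Strongly slice-regular functions *)

Section strongly_slice_regular.
Variables (R : realType) (n : nat).
Implicit Types (f : 'M[R]_(n, 4) -> quat R) (p x y z : 'M[R]_(n, 4))
  (U D W : set 'M[R]_(n, 4)) (i j : 'I_n) (c : 'I_4) (K : {set 'I_n}) (m : nat).

Lemma strongly_slice_locally U f : strongly_slice U f -> locally_strongly_slice U f.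
Proof.
move=> [f0 fn fc]; split=> // y m K yU mn KS x [xy xU].
apply: filterS (withinT (polysphere m y `&` U) (nbhs_filter x)) => x' Sx'.
by apply: fc Sx' _ => //.
Qed.

Lemma A_op_slice U f : open U -> locally_strongly_slice U f ->
  (forall i x, (U `\` @real_points R n) x -> theta_bar i f x = 0) ->
  forall m K x, (m <= n)%N -> K \subset first_coords n m ->
  (U `\` @real_points R n) x -> A_op m K f x = Gamma m K f x.
Proof.
move=> oU lf th m K x mn KS Dx; have [_ fs _] := lf.
apply: (@A_op_Gamma R n (U `\` @real_points R n) f) => //.
- exact: open_nonreal.
- by move=> z j [_ /nonrealP].
- exact: qsmooth_nonreal.
- by move=> i L z LS Dz; right; exact: (theta_bar_vartheta oU lf th LS Dz).
Qed.

Lemma qsmooth_sum k D m (F : 'I_m -> 'M[R]_(n, 4) -> quat R) : open D ->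
  (forall s, qsmooth k D (F s)) -> qsmooth k D (fun x => \sum_s F s x).
Proof.
move=> oD sF l; apply: (eq_smooth oD _ (smooth_sum oD (fun s => sF s l))) => _ x _.
by rewrite quat_sum_coord.
Qed.

(** Off the real points the slice operator is twice [vartheta_bar] of [Gamma i K f], which vanishes.
    Elsewhere the expression, continuous because [f] is smooth on [U], is a limit of such values
    along a ray inside the slice of [I]. *)
Lemma slice_SR_slice U f : open U -> locally_strongly_slice U f ->
  (forall i x, (U `\` @real_points R n) x -> theta_bar i f x = 0) -> SR_slice U f.
Proof.
move=> oU lf th y i K I yU KS Iu _ al be; rewrite /fiber /= => Uy.
set D := U `\` @real_points R n; have oD : open D by exact: open_nonreal.
have sf : qsmooth n U f by apply/Ck_qsmoothP => //; exact: slice_Ck.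
have sA : qsmooth 1 U (A_op i K f).
  apply: qsmoothW (qsmooth_A_op K oU sf (ltnW (ltn_ord i))) => //.
  by rewrite subn_gt0.
have [dA ->] := @slice_derivative R n (A_op i K f) U y i I al be oU sA Uy.
split=> //; set x := subst_coord y i _ in Uy *.
pose g z := pderiv i 0 (A_op i K f) z + I * \sum_c I 0 c *: pderiv i c (A_op i K f) z.
(* Coordinate [i] moves in the direction [I], so as to stay on its slice; every other coordinate
   moves off the real axis. *)
pose v : 'M[R]_(n, 4) := subst_coord (away_mx x) i I.
apply: (@continuous_ray_eq R 'M[R]_(n, 4) (quat R) g (fun=> 0) x v).
- have sg : qsmooth 0 U g.
    apply: qsmoothD => //; first exact: qsmooth_pderiv.
    apply: qsmoothM => //; first exact: qsmooth_cst.
    have s c : qsmooth 0 U (fun z => I 0 c *: pderiv i c (A_op i K f) z).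
      by apply: qsmooth_scale => //; [exact: smooth_cst|exact: qsmooth_pderiv].
    exact: qsmooth_sum.
  exact: (qsmooth_continuous sg Uy).
- by move=> A; exact: (@cvg_cst (quat R) 0 _ (nbhs x) _).
near=> t; have t0 : 0 < t by near: t; exact: nbhs_right_gt.
(* For negative [be] the ray must stop before height [0] is reached. *)
have bt : be + t != 0.
  near: t; have [b0|b0] := ltP be 0.
    near=> t; have tb : t < - be by near: t; apply: nbhs_right_lt; rewrite oppr_gt0.
    by rewrite lt_eqF// addrC -ltrBrDr sub0r.
  near=> t; have tb : 0 < t by near: t; exact: nbhs_right_gt.
  by rewrite gt_eqF// ltr_wpDl.
have xi : qcoord (t *: v + x) i = al%:A + I * (be + t)%:A.
  rewrite qcoord_ray !row_subst_coord !slice_pointE scalerDl addrC -addrA.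
  by congr (_ + _).
have Dx : D (t *: v + x).
  split; first by near: t; exact: near_ray.
  apply/nonrealP => j; have [->|ji] := eqVneq j i.
    by rewrite xi qIm_slice_point// scaler_eq0 negb_or bt imag_unit_neq0.
  by rewrite qcoord_ray row_subst_coord_neq// qcoord_away qIm_away_neq0.
rewrite /g (vartheta_slice _ Iu bt xi) (eq_vartheta_bar (D := D) _ oD (g := Gamma i K f))//.
  by rewrite (theta_bar_vartheta oU lf th KS Dx) scaler0.
by move=> z Dz; exact: (A_op_slice oU lf th (ltnW (ltn_ord i)) KS Dz).
Unshelve. all: end_near. Qed.

Lemma polysphere_away m x x' (t : R) : polysphere m x x' ->
  polysphere m (t *: away_mx x + x) (t *: away_mx x' + x').
Proof.
move=> /polysphereP[h1 h2]; apply/polysphereP; split=> j jm; last first.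
  by rewrite !qcoord_ray !qcoord_away h2.
rewrite !qcoord_ray !qcoord_away; have [e1 e2] := h1 j jm.
have away0 (a : quat R) : away a 0 0 = 0.
  by rewrite /away; case: ifP => _; rewrite ?mkquatE ?qIm0.
rewrite !qIm_away !quat_sqnorm_scale !quat_addE !quat_scaleE !away0 e1; split=> //.
have e : (qIm (qcoord x j) == 0) = (qIm (qcoord x' j) == 0).
  by rewrite -!quat_sqnorm_eq0 e2.
by rewrite /away e; case: ifP => _; rewrite ?e2.
Qed.

(** Both points are pushed off the real points at once and stay on a common polysphere, where [A_op]
    equals [Gamma] and the slice property applies; then [t] tends to [0]. *)
Lemma A_op_sphere U W f m K x x' : open U -> locally_strongly_slice U f ->
  (forall i x, (U `\` @real_points R n) x -> theta_bar i f x = 0) ->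
  open W -> W `<=` U -> slice_on W f -> (m <= n)%N -> K \subset first_coords n m ->
  W x -> W x' -> polysphere m x x' -> A_op m K f x = A_op m K f x'.
Proof.
move=> oU lf th oW WU sW mn KS Wx Wx' xx'.
have sf : qsmooth n U f by apply/Ck_qsmoothP => //; exact: slice_Ck.
have cA z : W z -> {for z, continuous (A_op m K f)}.
  by move=> Wz; exact: (qsmooth_continuous (qsmooth_A_op K oU sf mn) (WU _ Wz)).
(* A single ray in the space of pairs, so that both points move with the same [t]. *)
apply: (@continuous_ray_eq R ('M[R]_(n, 4) * 'M[R]_(n, 4))%type (quat R)
  (fun q => A_op m K f q.1) (fun q => A_op m K f q.2) (x, x') (away_mx x, away_mx x')).
- apply: (@continuous_comp _ _ _ (@fst 'M[R]_(n, 4) 'M[R]_(n, 4)) (A_op m K f)).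
    exact: cvg_fst.
  exact: cA.
- apply: (@continuous_comp _ _ _ (@snd 'M[R]_(n, 4) 'M[R]_(n, 4)) (A_op m K f)).
    exact: cvg_snd.
  exact: cA.
near=> t; have t0 : 0 < t by near: t; exact: nbhs_right_gt.
have nr z j : qIm (qcoord (t *: away_mx z + z) j) != 0.
  by rewrite qcoord_ray qcoord_away qIm_away_neq0.
have Wt : W (t *: away_mx x + x) by near: t; exact: near_ray.
have Wt' : W (t *: away_mx x' + x') by near: t; exact: near_ray.
have Dt z : W (t *: away_mx z + z) -> (U `\` @real_points R n) (t *: away_mx z + z).
  by move=> Wz; split; [exact: WU|apply/nonrealP => j; exact: nr].
rewrite /= !(A_op_slice oU lf th mn KS)//; try exact: Dt.
by apply: sW => //; exact: polysphere_away.
Unshelve. all: end_near. Qed.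

Lemma slice_on_strongly U f : strongly_slice U f -> slice_on U f.
Proof.
move=> [_ _ fc] m K x x' mn KS Ux Ux' xn xx'; case: m mn KS xx' => [|m] mn KS xx'.
  suff -> : x = x' by [].
  have /polysphereP[_ h] := xx'.
  by apply/row_matrixP => j; exact/esym/h.
have xx : polysphere m.+1 x x by apply/polysphereP.
by apply: (fc x m.+1 K) => //; split=> //; apply/nonrealP.
Qed.

Lemma polysphere_trans m y x x' : polysphere m y x -> polysphere m y x' -> polysphere m x x'.
Proof.
move=> /polysphereP[h1 h2] /polysphereP[h3 h4]; apply/polysphereP; split=> j jm.
  by have [<- <-] := h1 j jm; exact: h3.
by rewrite h4// h2.
Qed.

End strongly_slice_regular.

Theorem theorem47 (R : realType) (n : nat) (hn : (1 <= n)%N)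
    (U : set 'M[R]_(n, 4)) (hU : open U) (f : 'M[R]_(n, 4) -> quat R)
    (f0 : Ck 0 U f) (fn : Ck n (U `\` @real_points R n) f) :
  (strongly_slice U f ->
    (SR U f <->
     forall (m : 'I_n) (x : 'M[R]_(n, 4)),
       (U `\` @real_points R n) x -> theta_bar m f x = 0)) /\
  (locally_strongly_slice U f ->
    (SR_loc U f <->
     forall (m : 'I_n) (x : 'M[R]_(n, 4)),
       (U `\` @real_points R n) x -> theta_bar m f x = 0)).
Proof.
split=> [sf|lf].
  split=> [[fU fS _] m x|th]; first exact: SR_theta_bar.
  have lf := strongly_slice_locally sf.
  split; [exact: slice_Ck|exact: slice_SR_slice|].
  move=> y m K yU /andP[_ mn] KS x x' [yx Ux] [yx' Ux'].
  exact: (A_op_sphere hU lf th hU (@subset_refl _ U) (slice_on_strongly sf) mn KS Ux Ux'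
    (polysphere_trans yx yx')).
split=> [[fU fS _] m x|th]; first exact: SR_theta_bar.
split; [exact: slice_Ck|exact: slice_SR_slice|].
move=> y m K yU /andP[_ mn] KS x [yx Ux].
(* Local constancy at [x] is tested on a good box centred at [x], where the local slice condition
   becomes constancy on the whole intersection with a polysphere. *)
have [r [gr _ BU]] := exists_good_radius hU Ux ltr01; have [r0 _] := gr.
have xB := ebox_center x r0.
have nB : \forall x' \near x, ebox x r x' by exact: (open_nbhs_nbhs (conj (@open_ebox R n x r) xB)).
have nW : \forall x' \near within (polysphere m y `&` U) (nbhs x), ebox x r x'.
  by apply: filterS nB => x' x'B _.
have nS : \forall x' \near within (polysphere m y `&` U) (nbhs x), (polysphere m y `&` U) x'.
  exact: withinT.
near=> x'; have [yx' Ux'] : (polysphere m y `&` U) x' by near: x'.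
have x'B : ebox x r x' by near: x'.
exact: (A_op_sphere hU lf th (@open_ebox R n x r) BU (slice_on_ebox hU lf gr BU) mn KS
  x'B xB (polysphere_trans yx' yx)).
Unshelve. all: end_near. Qed.
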